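(* Let $(D_n)_{n\ge1}$ be connected regular domains of the family $\mathcal D$ such that $x_0\in D_1$, $D_n\Subset D_{n+1}$ for all $n$, and $D=\bigcup_{n\ge1}D_n$, and suppose that for every $n$ the relative kernel $K_{D_n}$ has a jointly continuous version on $D_n\times\partial D_n$ (this version is used). Let the compact product $P$, the maps $T_n:\partial D_n\to P$ and the measures $\rho_n^u=(T_n)_\#(u\,\omega_{x_0}^{D_n})$ on $P$ be as defined in the context. For each harmonic $u>0$ on $D$ there is a unique finite positive Borel measure $\sigma_u$ carried by $\mathcal E(D)$ such that $$u(x)=\int_{\mathcal E(D)}g(x)\,d\sigma_u(g),\qquad x\in D.$$ Moreover, $$\rho_n^u\Longrightarrow\sigma_u\quad\text{weakly on }P.$$ Consequently, for every compact metrizable compactification $\widehat D$ of $D$, every weak subsequential limit on $\widehat D\times P$ of the measures $\Lambda_n^u=(\mathrm{id},T_n)_\#(u\,\omega_{x_0}^{D_n})$ is carried by $(\widehat D\setminus D)\times\mathcal E(D)$. It is not required that the kernels $K_{D_n}(\cdot,y)$ be minimal.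
   Context: Let $X$ be a metric space. A domain is a nonempty connected open set; $V\Subset U$ means that $\overline V$ is compact and contained in $U$. Measures are positive Borel measures (completed when integrable functions are considered). A harmonic measure on a domain $U$ with $\partial U\ne\varnothing$ is a family $\{\omega_x^U:x\in U\}$ of measures on $\partial U$ with $\omega_x^U(\partial U)=1$ and $\omega_x^U\ll\omega_y^U$ for all $x,y\in U$; write $\omega_x^U(f)=\int_{\partial U}f\,d\omega_x^U$. It is continuous if $x\mapsto\omega_x^U(f)$ is continuous on $U$ for every $f\in\bigcap_{x\in U}L^1(\partial U,\omega_x^U)$, and Radon if every $\omega_x^U$ is Radon. The domain $U$ is regular if for every $\zeta\in\partial U$ and every bounded Borel $f$ on $\partial U$ continuous at $\zeta$ one has $\omega_x^U(f)\to f(\zeta)$ as $U\ni x\to\zeta$. Standing framework: $\mathcal D$ is a family of domains of $X$, each with nonempty boundary and equipped with a continuous Radon harmonic measure, such that (i) every $U\in\mathcal D$ is the union of an increasing sequence of regular domains of $\mathcal D$ whose closures are compact and contained in $U$; (ii) for $V\Subset U$ in $\mathcal D$ with $V$ regular, $\omega_x^U(f)=\int_{\partial V}\omega_y^U(f)\,d\omega_x^V(y)$ for all $x\in V$ and all bounded Borel $f$ on $\partial U$. $D\subseteq X$ is a domain and $x_0\in D$ is fixed. A function $u:W\to\mathbb R$ on an open set $W$ is harmonic if it is continuous and $u(x)=\int_{\partial V}u\,d\omega_x^V$ for every regular $V\in\mathcal D$ with $V\Subset W$ and every $x\in V$. $\mathcal H_1(D)$ is the set of strictly positive harmonic functions $h$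 on $D$ with $h(x_0)=1$, with the topology of locally uniform convergence, and $\mathcal E(D)$ is its set of extreme points (equivalently, the $h\in\mathcal H_1(D)$ that are minimal: every harmonic $v$ with $0\le v\le h$ equals $ch$ for some $c\in[0,1]$). For regular $U\in\mathcal D$ with $U\Subset D$, $x_0\in U$, $K_U(x,y)=\frac{d\omega_x^U}{d\omega_{x_0}^U}(y)$. Compact product: put $L_m=\overline{D_m}$, $a_m=\min_{L_m\times\partial D_{m+1}}K_{D_{m+1}}>0$, $b_m=\max_{L_m\times\partial D_{m+1}}K_{D_{m+1}}$, $\Omega_m(s,t)=\max_{z\in\partial D_{m+1}}|K_{D_{m+1}}(s,z)-K_{D_{m+1}}(t,z)|$. Let $\mathcal Q_m\subset C(L_m)$ (uniform norm) be the compact convex set of all $g\in C(L_m)$ that are harmonic in $D_m$, satisfy $g(x_0)=1$, and satisfy $a_i\le g(s)\le b_i$ and $|g(s)-g(t)|\le\Omega_i(s,t)$ for all $s,t\in L_i$ and all $i\le m$. It contains $g|_{L_m}$ for $g\in\mathcal H_1(D)$, the constant $1$, and $K_{D_n}(\cdot,y)|_{L_m}$ for $n\ge m+2$, $y\in\partial D_n$. Put $P=\prod_{m\ge1}\mathcal Q_m$ and identify $\mathcal H_1(D)$ with the closed subset of $P$ of sequences compatible under restriction, via $g\mapsto(g|_{L_m})_m$. Define the continuous maps $T_n:\partial D_n\to P$ by $T_n(y)_m=K_{D_n}(\cdot,y)|_{L_m}$ if $m\le n-2$ and $T_n(y)_m=1$ if $m>n-2$. In $\Lambda_n^u$, $\mathrm{id}$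 is the inclusion $\partial D_n\subset D\subset\widehat D$. A compactification of $D$ is a compact Hausdorff space containing $D$ as a dense subspace; $\Longrightarrow$ denotes weak convergence of finite measures against continuous functions on a compact space; a measure is carried by a Borel set if the complement has measure zero; $f_\#\mu$ is the push-forward. *)

(* Defs.v *)
From HB Require Import structures.
From mathcomp Require Import all_boot all_order all_algebra.
From mathcomp Require Import all_classical all_reals all_analysis.

Set Implicit Arguments.
Unset Strict Implicit.
Unset Printing Implicit Defensive.

Import Order.TTheory GRing.Theory Num.Theory.
Import numFieldNormedType.Exports.

Local Open Scope classical_set_scope.
Local Open Scope ring_scope.

(* Measurable types of the library are pointed, hence so are the metric spaces
   whose Borel sets we use.  Every space below is nonempty anyway. *)
#[short(type="pmetricType")]
HB.structure Definition PointedMetric (R : numDomainType) :=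
  {M of Metric R M & isPointed M}.

HB.instance Definition _ (S T : ptopologicalType) := Pointed.on (S * T)%type.

Notation borel T := (g_sigma_algebraType (@open T)).

Section topology.

Definition domain (T : topologicalType) (A : set T) :=
  [/\ A !=set0, open A & connected A].

Definition boundary (T : topologicalType) (A : set T) := closure A `\` A°.

Definition compactly_inside (T : topologicalType) (V U : set T) :=
  compact (closure V) /\ closure V `<=` U.

Definition embedding (S T : topologicalType) (j : S -> T) :=
  injective j /\
  forall A : set S, open A <-> exists2 B : set T, open B & j @^-1` B = A.

End topology.

Section measures.
Context (R : realType).
Local Open Scope ereal_scope.

Definition radon (T : ptopologicalType) (mu : set (borel T) -> \bar R) :=
  (forall C : set T, compact C -> mu C < +oo) /\
  (forall A : set (borel T), measurable A ->
    mu A = ereal_sup [set mu C | C in [set C : set T | compact C /\ C `<=` A]]).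

Definition carried (T : ptopologicalType) (mu : set (borel T) -> \bar R)
    (A : set (borel T)) :=
  measurable A /\ mu (~` A) = 0.

(* Integrability for the completion of mu.  The library integral of such an f
   is a supremum over simple functions below f^+ and f^-, hence it has the same
   value as the integral of a Borel representative of f. *)
Definition completed_integrable (T : ptopologicalType)
    (mu : {measure set (borel T) -> \bar R}) (A : set T) (f : T -> R) :=
  exists2 g : borel T -> R, mu.-integrable A (EFin \o g) &
    {ae mu, forall y, A y -> f y = g y}.

(* The measure f . mu restricted to B. *)
Definition density_on (T : ptopologicalType) (mu : set (borel T) -> \bar R)
    (B : set T) (f : T -> R) : set (borel T) -> \bar R :=
  fun A => \int[mu]_(y in A `&` B) (f y)%:E.

(* Weak convergence of finite measures on a compact set C, seen as measures on
   the ambient space T that do not charge the complement of C. *)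
Definition weakly_cvg_on (T : ptopologicalType) (C : set T)
    (mu : nat -> set (borel T) -> \bar R) (nu : set (borel T) -> \bar R) :=
  forall f : T -> R, {within C, continuous f} ->
    \int[mu n]_(p in C) (f p)%:E @[n --> \oo] --> \int[nu]_(p in C) (f p)%:E.

End measures.

Definition extreme_points (R : numDomainType) (V : lmodType R) (C : set V) :=
  [set h | C h /\ forall (h1 h2 : V) (t : R), C h1 -> C h2 ->
     0 < t -> t < 1 -> h = t *: h1 + (1 - t) *: h2 -> h1 = h /\ h2 = h].

Section harmonic.
Context (R : realType) (X : pmetricType R).
Implicit Types (U V W : set X) (u f : X -> R).

(* A measure on the closed set boundary U is a measure on X that does not charge
   the complement of boundary U.  [w x] is only meaningful for x in U. *)
Definition harmonic_measure (U : set X)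
    (w : X -> {measure set (borel X) -> \bar R}) :=
  (forall x, U x -> w x (~` boundary U) = 0%E /\ w x (boundary U) = 1%E) /\
  (forall x y, U x -> U y -> w x `<< w y).

Definition continuous_measure (U : set X)
    (w : X -> {measure set (borel X) -> \bar R}) :=
  forall f, (forall x, U x -> completed_integrable (w x) (boundary U) f) ->
    {within U, continuous (fun x => \int[w x]_(y in boundary U) f y)}.

Definition bounded_borel (A : set X) f :=
  measurable_fun (A : set (borel X)) f /\
  exists M : R, forall y, A y -> `|f y| <= M.

Definition regular (U : set X) (w : X -> {measure set (borel X) -> \bar R}) :=
  forall (z : X) f, boundary U z -> bounded_borel (boundary U) f ->
    f y @[y --> within (boundary U) (nbhs z)] --> f z ->
    \int[w x]_(y in boundary U) f y @[x --> within U (nbhs z)] --> f z.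

(* [w U] is the harmonic measure of U, meaningful for U in Dom. *)
Record framework (Dom : set (set X))
    (w : set X -> X -> {measure set (borel X) -> \bar R}) : Prop := Framework {
  framework_domain : forall U, Dom U -> domain U;
  framework_boundary : forall U, Dom U -> boundary U !=set0;
  framework_harmonic : forall U, Dom U -> harmonic_measure U (w U);
  framework_continuous : forall U, Dom U -> continuous_measure U (w U);
  framework_radon : forall U x, Dom U -> U x -> radon (w U x);
  framework_exhaustion : forall U, Dom U -> exists V_ : nat -> set X,
    [/\ forall n, [/\ Dom (V_ n), regular (V_ n) (w (V_ n)) &
                      compactly_inside (V_ n) U],
        forall n, V_ n `<=` V_ n.+1 &
        U = \bigcup_n V_ n];
  framework_nested : forall U V, Dom U -> Dom V -> regular V (w V) ->
    compactly_inside V U -> forall x f, V x -> bounded_borel (boundary U) f ->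
    \int[w U x]_(y in boundary U) f y =
      \int[w V x]_(y in boundary V) \int[w U y]_(z in boundary U) f z
}.

(* Only the values of u on W matter. *)
Definition harmonic_on (Dom : set (set X))
    (w : set X -> X -> {measure set (borel X) -> \bar R}) W u :=
  {within W, continuous u} /\
  forall V, Dom V -> regular V (w V) -> compactly_inside V W ->
    forall x, V x -> u x = \int[w V x]_(y in boundary V) u y.

(* [k] is a version on boundary U of (x, y) |-> dw_x / dw_x0 (y). *)
Definition relative_kernel U (w : X -> {measure set (borel X) -> \bar R})
    (x0 : X) (k : X -> X -> R) :=
  forall x, U x -> forall A : set (borel X), measurable A ->
    w x A = (\int[w x0]_(y in A `&` boundary U) (k x y)%:E)%E.

Definition jointly_continuous U (k : X -> X -> R) :=
  {within U `*` boundary U, continuous (fun p : X * X => k p.1 p.2)}.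

(* Locally uniform convergence on D is compact convergence, D being locally
   compact in all uses below. *)
Definition fun_space (D : set X) : Type := {family compact, D -> R}.
HB.instance Definition _ (D : set X) := Uniform.on (fun_space D).
HB.instance Definition _ (D : set X) :=
  Pointed.copy (fun_space D) (D -> R : Type).

(* Extension by 0 of a function defined on A. *)
Definition ext0 (A : set X) (g : A -> R) : X -> R := valL_ 0 g.

Definition H1 (Dom : set (set X))
    (w : set X -> X -> {measure set (borel X) -> \bar R})
    (D : set X) (x0 : X) : set (D -> R^o) :=
  [set h | [/\ harmonic_on Dom w D (ext0 h), forall x, 0 < h x &
               ext0 h x0 = 1]].

Arguments H1 Dom w D x0 : clear implicits.

Definition minimal_boundary (Dom : set (set X))
    (w : set X -> X -> {measure set (borel X) -> \bar R})
    (D : set X) (x0 : X) : set (fun_space D) :=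
  extreme_points (H1 Dom w D x0).

Arguments minimal_boundary Dom w D x0 : clear implicits.

Definition represents (Dom : set (set X))
    (w : set X -> X -> {measure set (borel X) -> \bar R})
    (D : set X) (x0 : X) (u : X -> R)
    (sigma : set (borel (fun_space D)) -> \bar R) :=
  carried sigma (minimal_boundary Dom w D x0) /\
  forall x : D, (u (val x))%:E =
    (\int[sigma]_(g in minimal_boundary Dom w D x0) (g x)%:E)%E.

End harmonic.
Arguments H1 {R X} Dom w D x0 _.
Arguments minimal_boundary {R X} Dom w D x0 _.
Arguments represents {R X} Dom w {D} x0 u sigma.

Section compact_product.
Context (R : realType) (X : pmetricType R).
Variables (Dom : set (set X))
  (w : set X -> X -> {measure set (borel X) -> \bar R}).
Variables (x0 : X) (D_ : nat -> set X) (K : nat -> X -> X -> R).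

(* The index n : nat stands for n + 1 in a sequence starting at 1. *)
Definition LL (m : nat) : set X := closure (D_ m).

Definition bnd (m : nat) : set X := boundary (D_ m).

(* The extrema below are attained: the kernels are continuous and the index sets
   compact and nonempty. *)
Definition amin (m : nat) : R :=
  inf [set K m.+1 p.1 p.2 | p in LL m `*` bnd m.+1].

Definition bmax (m : nat) : R :=
  sup [set K m.+1 p.1 p.2 | p in LL m `*` bnd m.+1].

Definition omega_mod (m : nat) (s t : X) : R :=
  sup [set `|K m.+1 s z - K m.+1 t z| | z in bnd m.+1].

(* All functions L_m -> R, uniform convergence; it induces the uniform norm
   topology on C(L_m). *)
Definition fun_LL (m : nat) : Type := arrow_uniform_type (LL m) R.
HB.instance Definition _ (m : nat) := PseudoMetric.on (fun_LL m).
HB.instance Definition _ (m : nat) := Pointed.copy (fun_LL m) (LL m -> R : Type).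

Definition Qset (m : nat) : set (fun_LL m) :=
  [set g : LL m -> R |
    [/\ continuous g, harmonic_on Dom w (D_ m) (ext0 g), ext0 g x0 = 1 &
        forall i s t, (i <= m)%N -> LL i s -> LL i t ->
          [/\ amin i <= ext0 g s, ext0 g s <= bmax i &
              `|ext0 g s - ext0 g t| <= omega_mod i s t]]].

Definition prod_LL : Type := prod_topology fun_LL.
HB.instance Definition _ := PseudoMetric.on prod_LL.
HB.instance Definition _ := Pointed.copy prod_LL (forall m, fun_LL m : Type).

Definition Pset : set prod_LL := [set p | forall m, Qset (p m)].

Definition Tmap (n : nat) (y : X) : prod_LL :=
  fun m (s : LL m) => if (m + 2 <= n)%N then K n (val s) y else 1.

Definition restrict_LL (D : set X) (g : fun_space D) : prod_LL :=
  fun m (s : LL m) => ext0 g (val s).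

Definition rho (u : X -> R) (n : nat) : set (borel prod_LL) -> \bar R :=
  pushforward (density_on (w (D_ n) x0) (bnd n) u)
    (Tmap n : borel X -> borel prod_LL).

(* [j] embeds D in Dh; [valL_ point j] is its (arbitrary) extension to X. *)
Definition Lambda (D : set X) (Dh : pmetricType R) (j : D -> Dh)
    (u : X -> R) (n : nat) : set (borel (Dh * prod_LL)%type) -> \bar R :=
  pushforward (density_on (w (D_ n) x0) (bnd n) u)
    ((fun y => (valL_ point j y, Tmap n y)) :
       borel X -> borel (Dh * prod_LL)%type).

End compact_product.
Arguments Pset {R X} Dom w x0 D_ K _.
Arguments rho {R X} w x0 D_ K u n _.
Arguments Lambda {R X} w x0 D_ K {D Dh} j u n _.
Arguments restrict_LL {R X} D_ {D} g.

(* Main.v *)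
Require Import Defs.
From HB Require Import structures.
From mathcomp Require Import all_boot all_order all_algebra.
From mathcomp Require Import all_classical all_reals all_analysis.
From mathcomp Require Import measurable_realfun.
From mathcomp Require Import zify ring lra.
Set Implicit Arguments.
Unset Strict Implicit.
Unset Printing Implicit Defensive.
Import Order.TTheory GRing.Theory Num.Theory.
Import numFieldNormedType.Exports.
Local Open Scope classical_set_scope.
Local Open Scope ring_scope.

(** The reproducing formula of [D_ n] writes [u x] as the integral of [K n x y]
    against the measure [u y dw(y)] on the boundary of [D_ n], whose mass is
    [u x0]: the function [u] is a mixture of kernels, and the theorem says that
    this mixture converges to a mixture of extreme functions.

    Existence of a representing measure.  The values of the kernels at a dense
    sequence of points [dseq j] are countably many bounded observables.  Along an
    ultrafilter their joint laws converge, and the limit law is realized on the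
    interval [0, u x0) with Lebesgue measure (lemma [skorokhod]): every point [t]
    of the interval is shadowed by boundary points, and first and second moments
    pass to the limit.  Normalized positive harmonic functions being compact
    ([ultra_montel]), the values observed at [t] are those of some [g] in [H1],
    and the image of Lebesgue measure under this map represents [u].

    Extreme functions have no variance.  For [g] in [H1] let [S n x g] be the
    integral of [K n x y ^+ 2 * g y]; then [S n x g - g x ^+ 2] is the variance
    of [K n x] under the probability measure [g y dw(y)].  As [S] is linear in
    [g], a decomposition of [g] into [h1] and [h2] costs a variance of at least
    [t * (1 - t) * (h1 x - h2 x) ^+ 2], so that small variances force [g] to be
    extreme ([small_variance_extreme]).  Conversely, the functions
    [z |-> \int K n z y * K n x y * g y / g x] are harmonic, normalized and at
    most a multiple of [g]; if [g] is extreme, all their limits are [g], and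
    their value at [x] is [S n x g / g x] ([extreme_small_variance]).  Thus the
    extreme functions form a Borel set.  For the measure found above, the
    integral of [S n x g] is [S n x u], which tends along the ultrafilter to
    the integral of [g x ^+ 2], so that the variances have small integrals and
    the measure is carried by the extreme functions ([harmonic_mixture]).

    Weak convergence and uniqueness.  If [g] is extreme, the maps [Tmap]
    concentrate at [g] under [g y dw(y)], by Chebyshev's inequality
    ([minimal_test]).  Integrating over any measure carried by the extreme
    functions that represents [u], Fubini and dominated convergence give the
    weak limit of the measures [rho] ([test_cvg]).  The limit determines the measure,
    whence uniqueness ([representing_unique]).

    Compactifications.  The second marginal of a weak limit of the measures [Lambda]
    is the limit of the measures [rho], hence is carried by the extreme functions.  The
    boundaries of the [D_ n] leave every compact subset of [D], so that the first
    marginal does not charge [D] ([weak_limit_carried]). *)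

(** * Bounded measurable functions *)

Section finite_of.
Context d (T : measurableType d) (R : realType).
Variables (mu : {measure set T -> \bar R}) (Hmu : (mu setT < +oo)%E).

(** The proof is an argument, so that the structure of finite measure can be
    inferred from the term; [dens] and [image_measure] below use the same device. *)
Definition fin_of of (mu setT < +oo)%E : set T -> \bar R := mu.
HB.instance Definition _ := Measure.on (fin_of Hmu).
Lemma sub_finite A : measurable A -> (mu A < +oo)%E.
Proof. by move=> mA; apply: le_lt_trans Hmu; apply: le_measure; rewrite ?inE. Qed.

Lemma fin_of_fin : fin_num_fun (fin_of Hmu).
Proof. by move=> A mA; rewrite ge0_fin_numE ?measure_ge0//; exact: sub_finite. Qed.
HB.instance Definition _ := Measure_isFinite.Build d T R (fin_of Hmu) fin_of_fin.
End finite_of.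

Section bounded_measurable.
Context d (T : measurableType d) (R : realType).
Variable B : set T.
Hypothesis mB : measurable B.
Implicit Types f g : T -> R.

(** On a set of finite measure, the integral of such functions is finite and
    linear: no other functions are integrated below. *)
Definition bmeas f := measurable_fun B f /\ exists M : R, forall y, B y -> `|f y| <= M.

Lemma bmeas_cst c : bmeas (fun=> c).
Proof. by split; [exact: measurable_cst|exists `|c|]. Qed.

Lemma bmeasD f g : bmeas f -> bmeas g -> bmeas (fun x => f x + g x).
Proof.
move=> [mf [M fM]] [mg [N gN]]; split; first exact: measurable_funD.
exists (M + N) => y By; apply: (le_trans (ler_normD _ _)).
by apply: lerD; [exact: fM|exact: gN].
Qed.

Lemma bmeasM f g : bmeas f -> bmeas g -> bmeas (fun x => f x * g x).
Proof.
move=> [mf [M fM]] [mg [N gN]]; split; first exact: measurable_funM.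
exists (M * N) => y By; rewrite normrM.
by apply: ler_pM => //; [exact: fM|exact: gN].
Qed.

Lemma bmeasN f : bmeas f -> bmeas (fun x => - f x).
Proof.
move=> [mf [M fM]]; split; first exact: measurableT_comp.
by exists M => y By; rewrite normrN; exact: fM.
Qed.

Lemma bmeasB f g : bmeas f -> bmeas g -> bmeas (fun x => f x - g x).
Proof. by move=> bf bg; apply: bmeasD => //; exact: bmeasN. Qed.

Lemma bmeas_norm f : bmeas f -> bmeas (fun x => `|f x|).
Proof.
move=> [mf [M fM]]; split; first exact: measurableT_comp.
by exists M => y By; rewrite normr_id; exact: fM.
Qed.

Lemma eq_bmeas f g : (forall x, B x -> f x = g x) -> bmeas f -> bmeas g.
Proof.
move=> fg [mf [M fM]]; split.
  by apply: (eq_measurable_fun f) mf => x /[!inE] /fg.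
by exists M => y By; rewrite -fg//; exact: fM.
Qed.

Variable mu : {measure set T -> \bar R}.
Hypothesis Hmu : (mu B < +oo)%E.

Lemma bmeas_integrable f : bmeas f -> mu.-integrable B (EFin \o f).
Proof.
move=> [mf [M fM]]; apply: measurable_bounded_integrable => //.
by exists M; split; [exact: num_real|]; move=> x Mx y By; apply: le_trans (fM _ By) (ltW _).
Qed.

Lemma Rint_D f g : bmeas f -> bmeas g ->
  \int[mu]_(x in B) (f x + g x) = \int[mu]_(x in B) f x + \int[mu]_(x in B) g x.
Proof. by move=> bf bg; apply: RintegralD => //; exact: bmeas_integrable. Qed.

Lemma Rint_B f g : bmeas f -> bmeas g ->
  \int[mu]_(x in B) (f x - g x) = \int[mu]_(x in B) f x - \int[mu]_(x in B) g x.
Proof. by move=> bf bg; apply: RintegralB => //; exact: bmeas_integrable. Qed.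

Lemma Rint_Zl c f : bmeas f ->
  \int[mu]_(x in B) (c * f x) = c * \int[mu]_(x in B) f x.
Proof. by move=> bf; apply: RintegralZl => //; exact: bmeas_integrable. Qed.

Lemma le_Rint f g : bmeas f -> bmeas g -> (forall x, B x -> f x <= g x) ->
  \int[mu]_(x in B) f x <= \int[mu]_(x in B) g x.
Proof. by move=> bf bg; apply: le_Rintegral => //; exact: bmeas_integrable. Qed.

Lemma Rint_norm f : bmeas f ->
  `|\int[mu]_(x in B) f x| <= \int[mu]_(x in B) `|f x|.
Proof. by move=> bf; apply: le_normr_Rintegral => //; exact: bmeas_integrable. Qed.

Lemma Rint_EFin f : bmeas f ->
  (\int[mu]_(x in B) (f x)%:E)%E = (\int[mu]_(x in B) f x)%:E.
Proof.
move=> bf; rewrite fineK//.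
by apply: integrable_fin_num => //; exact: bmeas_integrable.
Qed.

Lemma Rint_dist f g e : bmeas f -> bmeas g ->
  (forall x, B x -> `|f x - g x| <= e) ->
  `|\int[mu]_(x in B) f x - \int[mu]_(x in B) g x| <= e * fine (mu B).
Proof.
move=> bf bg fge; rewrite -Rint_B//; apply: (le_trans (Rint_norm (bmeasB bf bg))).
rewrite -[leRHS]Rintegral_cst//; apply: le_Rint => //; last exact: bmeas_cst.
by apply/bmeas_norm/bmeasB.
Qed.
End bounded_measurable.

Lemma eq_Rint d (T : measurableType d) (R : realType) (mu : {measure set T -> \bar R})
  (B : set T) (f g : T -> R) : (forall x, B x -> f x = g x) ->
  \int[mu]_(x in B) f x = \int[mu]_(x in B) g x.
Proof. by move=> fg; apply: eq_Rintegral => x /[!inE]; exact: fg. Qed.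

Section density.
Context d (T : measurableType d) (R : realType).
Variables (mu nu : {measure set T -> \bar R}) (B : set T) (k : T -> R).
Hypotheses (mB : measurable B) (Hmu : (mu setT < +oo)%E) (Hnu : (nu setT < +oo)%E).
Hypothesis bk : bmeas B k.
Hypothesis nuE : forall A, measurable A ->
  nu A = (\int[mu]_(x in A `&` B) (k x)%:E)%E.

(** The Radon-Nikodym derivative of [nu] agrees almost everywhere with [k]. *)
Lemma Rint_density f : bmeas B f ->
  \int[nu]_(x in B) f x = \int[mu]_(x in B) (k x * f x).
Proof.
move=> bf.
pose mu' : {finite_measure set T -> \bar R} := fin_of Hmu.
pose nu' : {finite_measure set T -> \bar R} := fin_of Hnu.
have muB : (mu B < +oo)%E.
  exact: (sub_finite Hmu).
have nuB : (nu B < +oo)%E.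
  exact: (sub_finite Hnu).
have numu : nu' `<< mu'.
  apply/null_content_dominatesP => A mA muA; rewrite [LHS]nuE//.
  apply: null_set_integral; [exact: measurableI| |].
    apply: (measurable_funS mB) => //; apply/measurable_EFinP; exact: bk.1.
  apply/eqP; rewrite eq_le measure_ge0 andbT -[leRHS]muA.
  by apply: le_measure; rewrite ?inE//; exact: measurableI.
have RNi : mu.-integrable setT (Radon_Nikodym (charge_of_finite_measure nu') mu').
  exact: (@Radon_Nikodym_integrable _ _ _ (charge_of_finite_measure nu') mu').
have H := @Radon_Nikodym_change_of_variables _ _ _ nu' mu' numu (EFin \o f) B mB
  (bmeas_integrable (mu := nu) mB nuB bf).
rewrite /Rintegral -[in LHS]H; congr fine.
apply: ae_eq_integral => //.
- apply: emeasurable_funM; first by apply/measurable_EFinP; exact: bf.1.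
  by apply: measurable_funTS; exact: measurable_int RNi.
- by apply/measurable_EFinP; apply: measurable_funM; [exact: bk.1|exact: bf.1].
under [X in ae_eq _ _ _ X]eq_fun do rewrite mulrC EFinM.
apply: ae_eqe_mul2l.
apply: integral_ae_eq => //.
- by apply: (integrableS measurableT).
- by apply/measurable_EFinP; exact: bk.1.
- move=> E EB mE; rewrite -(@Radon_Nikodym_integral _ _ _ (charge_of_finite_measure nu') mu')//; rewrite [LHS]nuE//.
  by rewrite setIidl.
Qed.
End density.

(** * Continuity on a subset and Borel sets *)

Section within_continuity.
Context (R : realType).

Lemma within_contP (T : topologicalType) (A : set T) (f : T -> R) :
  {within A, continuous f} <->
  forall x, A x -> forall e, 0 < e -> \forall y \near x, A y -> `|f y - f x| < e.
Proof.
split.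
  move=> /subspace_continuousP cf x Ax e e0.
  have /cvgrPdist_lt/(_ _ e0) := cf _ Ax.
  rewrite near_withinE; apply: filterS => y h Ay.
  by rewrite distrC; exact: h.
move=> cf; apply/subspace_continuousP => x Ax; apply/cvgrPdist_lt => e e0.
rewrite near_withinE; have := cf _ Ax _ e0; apply: filterS => y h Ay.
by rewrite distrC; exact: h.
Qed.

Lemma eq_within_cont (T : topologicalType) (A : set T) (f g : T -> R) :
  (forall x, A x -> f x = g x) -> {within A, continuous f} -> {within A, continuous g}.
Proof.
move=> fg /within_contP cf; apply/within_contP => x Ax e e0.
by have := cf _ Ax _ e0; apply: filterS => y h Ay; rewrite -!fg//; exact: h.
Qed.

Lemma within_contD (T : topologicalType) (A : set T) (f g : T -> R) :
  {within A, continuous f} -> {within A, continuous g} ->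
  {within A, continuous (fun x => f x + g x)}.
Proof. by move=> cf cg x; apply: cvgD; [exact: cf|exact: cg]. Qed.

Lemma within_contM (T : topologicalType) (A : set T) (f g : T -> R) :
  {within A, continuous f} -> {within A, continuous g} ->
  {within A, continuous (fun x => f x * g x)}.
Proof. by move=> cf cg x; apply: cvgM; [exact: cf|exact: cg]. Qed.

Lemma within_cont_cst (T : topologicalType) (A : set T) (c : R) :
  {within A, continuous (fun=> c)}.
Proof. by move=> x; exact: cvg_cst. Qed.

Lemma within_contB (T : topologicalType) (A : set T) (f g : T -> R) :
  {within A, continuous f} -> {within A, continuous g} ->
  {within A, continuous (fun x => f x - g x)}.
Proof. by move=> cf cg x; apply: cvgB; [exact: cf|exact: cg]. Qed.

Lemma within_cont_norm (T : topologicalType) (A : set T) (f : T -> R) :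
  {within A, continuous f} -> {within A, continuous (fun x => `|f x|)}.
Proof. by move=> cf x; apply: cvg_norm; exact: cf. Qed.

Lemma jointP (S T : topologicalType) (A : set S) (B : set T) (F : S -> T -> R) :
  {within A `*` B, continuous (fun p => F p.1 p.2)} ->
  forall x y, A x -> B y -> forall e, 0 < e ->
  \forall x' \near x & y' \near y, A x' -> B y' -> `|F x' y' - F x y| < e.
Proof.
move=> /within_contP cF x y Ax By e e0.
have [[P Q] /= [nP nQ] PQ] := cF (x, y) (conj Ax By) _ e0.
exists (P, Q) => //= -[x' y'] /= [Px Qy] Ax' By'.
by apply: (PQ (x', y')) => //.
Qed.

Lemma joint_fst (S T : topologicalType) (A : set S) (B : set T) (F : S -> T -> R) y :
  {within A `*` B, continuous (fun p => F p.1 p.2)} -> B y ->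
  {within A, continuous (F^~ y)}.
Proof.
move=> cF By; apply/within_contP => x Ax e e0.
have [[P Q] /= [nP nQ] PQ] := jointP cF Ax By e0.
apply: filterS nP => x' Px' Ax'; apply: (PQ (x', y)) => //; split => //.
exact: nbhs_singleton.
Qed.

Lemma joint_snd (S T : topologicalType) (A : set S) (B : set T) (F : S -> T -> R) x :
  {within A `*` B, continuous (fun p => F p.1 p.2)} -> A x ->
  {within B, continuous (F x)}.
Proof.
move=> cF Ax; apply/within_contP => y By e e0.
have [[P Q] /= [nP nQ] PQ] := jointP cF Ax By e0.
apply: filterS nQ => y' Py' By'; apply: (PQ (x, y')) => //; split => //.
exact: nbhs_singleton.
Qed.

Lemma joint_swap (S T : topologicalType) (A : set S) (B : set T) (F : S -> T -> R) :
  {within A `*` B, continuous (fun p => F p.1 p.2)} ->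
  {within B `*` A, continuous (fun p => F p.2 p.1)}.
Proof.
move=> cF; apply/within_contP => -[y x] [/= By Ax] e e0.
have [[P Q] /= [nP nQ] PQ] := jointP cF Ax By e0.
exists (Q, P) => //= -[y' x'] /= [Py Px] [By' Ax'].
exact: (PQ (x', y')).
Qed.

Lemma jointW (S T : topologicalType) (A A' : set S) (B : set T) (F : S -> T -> R) :
  A' `<=` A ->
  {within A `*` B, continuous (fun p => F p.1 p.2)} ->
  {within A' `*` B, continuous (fun p => F p.1 p.2)}.
Proof.
move=> AA; apply: continuous_subspaceW => -[x y] [/= Ax By]; split => //; exact: AA.
Qed.

(** Compactness of the second factor makes the continuity in the first variable
    uniform in the second one. *)
Lemma tube (S T : topologicalType) (A : set S) (B : set T) (F : S -> T -> R) :
  compact B -> {within A `*` B, continuous (fun p => F p.1 p.2)} ->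
  forall x, A x -> forall e, 0 < e ->
  \forall x' \near x, A x' -> forall y, B y -> `|F x' y - F x y| < e.
Proof.
move=> cB cF x Ax e e0.
have /compact_near_coveringP/near_covering_withinP := cB.
move=> /(_ S (nbhs x) (fun x' y => A x' -> `|F x' y - F x y| < e)).
have h : forall y, B y -> \forall y' \near y & x' \near x,
    B y' -> A x' -> `|F x' y' - F x y'| < e.
  move=> y By; have e20 : 0 < e / 2 by rewrite divr_gt0.
  have [[P Q] /= [nP nQ] PQ] := jointP cF Ax By e20.
  exists (Q, P) => //= -[y' x'] /= [Qy Px] By' Ax'.
  have h1 := PQ (x', y') (conj Px Qy) Ax' By'.
  have h2 := PQ (x, y') (conj (nbhs_singleton nP) Qy) Ax By'.
  rewrite /= in h1 h2.
  rewrite (splitr e) (le_lt_trans (ler_distD (F x y) _ _))// ltrD//.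
  by rewrite distrC.
by move=> /(_ _ h); apply: filterS => x' h' Ax' y By; exact: h'.
Qed.

Lemma within_cont_bounded (T : topologicalType) (C : set T) (f : T -> R) :
  compact C -> {within C, continuous f} -> exists M : R, forall y, C y -> `|f y| <= M.
Proof.
move=> cC cf; have cfC := continuous_compact cf cC.
have [M [_ hM]] := compact_bounded cfC.
exists (M + 1) => y Cy; apply: (hM (M + 1)); first by rewrite ltrDl.
by exists y.
Qed.

End within_continuity.

Section borel_sets.
Lemma borel_open (T : ptopologicalType) (A : set T) :
  open A -> measurable (A : set (borel T)).
Proof. exact: sub_sigma_algebra. Qed.

Lemma borel_closed (T : ptopologicalType) (A : set T) :
  closed A -> measurable (A : set (borel T)).
Proof.
by move=> cA; rewrite -(setCK A); apply: measurableC; apply: borel_open; exact: closed_openC.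
Qed.

Lemma borel_compact (T : ptopologicalType) (A : set T) :
  hausdorff_space T -> compact A -> measurable (A : set (borel T)).
Proof. by move=> hT cA; apply: borel_closed; exact: compact_closed. Qed.

Lemma within_cont_preimage (S T : ptopologicalType) (C : set S) (f : S -> T) (O : set T) :
  measurable (C : set (borel S)) -> {within C, continuous f} -> open O ->
  measurable (C `&` f @^-1` O : set (borel S)).
Proof.
move=> mC /continuousP cf oO.
have /open_subspaceP [V oV VC] := cf _ oO.
rewrite setIC -VC; apply: measurableI => //; exact: borel_open.
Qed.

Lemma within_cont_measurable (S T : ptopologicalType) (C : set S) (f : S -> T) :
  measurable (C : set (borel S)) -> {within C, continuous f} ->
  measurable_fun (C : set (borel S)) (f : borel S -> borel T).
Proof.
move=> mC cf.
have H := @measurability _ _ (borel S) (borel T) C (f : borel S -> borel T) (@open T) erefl.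
by apply: H => _ [V oV <-]; exact: within_cont_preimage.
Qed.

Lemma within_cont_measurableR (R : realType) (S : ptopologicalType) (C : set S) (f : S -> R) :
  measurable (C : set (borel S)) -> {within C, continuous f} ->
  measurable_fun (C : set (borel S)) (f : borel S -> R).
Proof.
move=> mC cf; apply: (measurability _ (RGenOpens.measurableE R)).
by move=> _ [_ [a [b ->] <-]]; apply: within_cont_preimage => //; exact: interval_open.
Qed.

Lemma cont_measurable (S T : ptopologicalType) (f : S -> T) : continuous f ->
  measurable_fun setT (f : borel S -> borel T).
Proof.
by move=> cf; apply: within_cont_measurable => //; exact: continuous_subspaceT.
Qed.

Lemma bmeas_within (R : realType) (S : ptopologicalType) (C : set S) (f : S -> R) :
  hausdorff_space S -> compact C -> {within C, continuous f} ->
  bmeas (C : set (borel S)) (f : borel S -> R).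
Proof.
move=> hS cC cf; split; last exact: within_cont_bounded.
by apply: within_cont_measurableR => //; exact: borel_compact.
Qed.
End borel_sets.

(** * Joint measurability and Fubini *)

Section finite_net.
Lemma finite_subcover (T : ptopologicalType) (A : set T) (U : T -> set T) : compact A ->
  (forall a, A a -> open (U a) /\ U a a) ->
  exists s : seq T, (forall a, a \in s -> A a) /\ forall x, A x -> exists2 a, a \in s & U a x.
Proof.
rewrite compact_cover => cA HU.
have [||D' D'A D'cov] := cA T A (fun a => U a).
- by move=> a Aa; exact: (HU a Aa).1.
- by move=> x Ax; exists x => //; exact: (HU x Ax).2.
exists (finmap.enum_fset D'); split; first by move=> a aD; apply/set_mem/D'A; exact: aD.
by move=> x /D'cov[a /= aD Uax]; exists a.
Qed.
End finite_net.

Section joint_measurability.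
Context (R : realType) (X : pmetricType R) d (T : measurableType d).

Lemma measurable_find (U : X -> set X) (s : seq X) i :
  (forall a, a \in s -> open (U a)) ->
  measurable ([set x | find (fun a => `[< U a x >]) s = i] : set (borel X)).
Proof.
elim: s i => [|a s IH] [|i] /= oU.
- by rewrite (_ : [set _ | _] = setT)//; apply/seteqP; split.
- by rewrite (_ : [set _ | _] = set0)//; apply/seteqP; split.
- rewrite (_ : [set _ | _] = U a); first by apply: borel_open; apply: oU; rewrite inE eqxx.
  by apply/seteqP; split => x /=; case: asboolP.
rewrite (_ : [set _ | _] = (~` U a : set X) `&` [set x | find (fun a => `[< U a x >]) s = i]).
  apply: measurableI; last by apply: IH => b bs; apply: oU; rewrite inE bs orbT.
  by apply: measurableC; apply: borel_open; apply: oU; rewrite inE eqxx.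
apply/seteqP; split => x /=; case: asboolP => // Uax; last by move=> [_ ->].
  by move=> [].
by move=> [].
Qed.

(** [F] is the limit of the functions obtained by moving [x] to the first close
    point of a finite net; these are measurable because the net is finite. *)
Lemma joint_measurable (A : set X) (C : set T) (F : X -> T -> R) :
  compact A -> measurable C ->
  (forall t, C t -> {within A, continuous (F^~ t)}) ->
  (forall x, A x -> measurable_fun C (F x)) ->
  measurable_fun (A `*` C : set (borel X * T)%type) (fun p : borel X * T => F p.1 p.2).
Proof.
move=> cA mC cF mF.
have mA : measurable (A : set (borel X)) by apply: borel_compact => //; exact: metric_hausdorff.
pose U (k : nat) (a : X) : set X := (ball a (k.+1%:R^-1 : R))°.
have HU k a : A a -> open (U k a) /\ U k a a.
  move=> _; split; first exact: open_interior.
  by apply: nbhsx_ballx; rewrite invr_gt0.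
have Hs k := finite_subcover cA (HU k).
pose s k := projT1 (cid (Hs k)).
have sA k a : a \in s k -> A a by exact: (projT2 (cid (Hs k))).1.
have sC k x : A x -> exists2 a, a \in s k & U k a x by exact: (projT2 (cid (Hs k))).2.
pose c k x := nth point (s k) (find (fun a => `[< U k a x >]) (s k)).
have fs k x : A x -> (find (fun a => `[< U k a x >]) (s k) < size (s k))%N.
  by move=> /(sC k)[a ask Uax]; rewrite -has_find; apply/hasP; exists a => //; apply/asboolP.
apply: (@measurable_fun_cvg _ (borel X * T)%type R _ (fun k (p : borel X * T) => F (c k p.1) p.2)).
- move=> k _ Y mY.
  rewrite (_ : _ `&` _ = \bigcup_(i in [set i | (i < size (s k))%N])
    ((A `&` [set x | find (fun a => `[< U k a x >]) (s k) = i]) `*`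
     (C `&` F (nth point (s k) i) @^-1` Y))).
    apply: bigcup_measurable => i /= ik; apply: measurableX.
      apply: measurableI => //; apply: measurable_find => a _; exact: open_interior.
    by apply: (mF (nth point (s k) i)) => //; apply: (sA k); exact: mem_nth.
  apply/seteqP; split => [[x t] /= [[Ax Ct] FY]|[x t] /= [i /= ik [[Ax fi] [Ct FY]]]].
    by exists (find (fun a => `[< U k a x >]) (s k)) => //=; exact: fs.
  by split => //; rewrite /c fi.
- move=> [x t] /= [Ax Ct].
  apply/cvgrPdist_lt => e e0.
  have /within_contP/(_ x Ax e e0) := cF t Ct.
  move=> /nbhs_ballP[r /= r0 rA].
  near=> k.
  have cA' : A (c k x) by apply: (sA k); apply: mem_nth; exact: fs.
  rewrite distrC; apply: (rA _ _ cA').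
  have : U k (c k x) x.
    by have := fs k _ Ax; rewrite -has_find => /(nth_find point)/asboolP.
  move=> /interior_subset /ball_sym; apply: le_ball.
  near: k; exists (Num.trunc (r^-1)) => // k /= hk.
  rewrite -[r]invrK lef_pV2 ?posrE ?invr_gt0//.
  apply: (le_trans (ltW (truncnS_gt r^-1))).
  by rewrite ler_nat.
Unshelve. all: by end_near. Qed.
End joint_measurability.

Section fubini_bounded.
Context (R : realType) d1 d2 (T1 : measurableType d1) (T2 : measurableType d2).
Variables (mu : {measure set T1 -> \bar R}) (nu : {measure set T2 -> \bar R}).
Hypotheses (Hmu : (mu setT < +oo)%E) (Hnu : (nu setT < +oo)%E).
Variables (A : set T1) (C : set T2) (F : T1 -> T2 -> R) (M : R).
Hypotheses (mA : measurable A) (mC : measurable C).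
Hypothesis mF : measurable_fun (A `*` C) (fun p => F p.1 p.2).
Hypothesis FM : forall x y, A x -> C y -> `|F x y| <= M.

Lemma section_snd x : A x -> bmeas C (F x).
Proof.
move=> Ax; split; last by exists M => y; exact: FM.
have m2 : measurable_fun C (fun y => (x, y)).
  by apply: measurable_funTS; exact: pair1_measurable.
apply: (measurable_comp (measurableX mA mC) _ mF m2).
by move=> _ [y Cy <-].
Qed.

Lemma section_fst y : C y -> bmeas A (F^~ y).
Proof.
move=> Cy; split; last by exists M => x Ax; exact: FM.
have m2 : measurable_fun A (fun x => (x, y)).
  by apply: measurable_funTS; exact: pair2_measurable.
apply: (measurable_comp (measurableX mA mC) _ mF m2).
by move=> _ [x Ax <-].
Qed.

Let G := (fun p => (F p.1 p.2)%:E) \_ (A `*` C).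

Let muA : (mu A < +oo)%E.
Proof. exact: (sub_finite Hmu). Qed.
Let nuC : (nu C < +oo)%E.
Proof. exact: (sub_finite Hnu). Qed.

Let mu' : {finite_measure set T1 -> \bar R} := fin_of Hmu.
Let nu' : {finite_measure set T2 -> \bar R} := fin_of Hnu.

Let mG : measurable_fun setT G.
Proof.
apply/(measurable_restrictT _ _).1; first exact: measurableX.
exact/measurable_EFinP.
Qed.

Let GM x y : (`|G (x, y)| <= `|M|%:E)%E.
Proof.
rewrite /G patchE; case: ifPn => [|_]; last by rewrite abse0 lee_fin.
rewrite inE => -[/= Ax Cy]; rewrite lee_fin (le_trans (FM Ax Cy))//.
exact: ler_norm.
Qed.

Let iG : (mu' \x nu')%E.-integrable setT G.
Proof.
apply/integrable12ltyP => //.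
have : (\int[mu']_x \int[nu']_y `|G (x, y)| <= \int[mu']_x (cst (`|M|%:E * nu' setT) x))%E.
  apply: ge0_le_integral => //.
  - by move=> x _; exact: integral_ge0.
  - apply: (measurable_fun_fubini_tonelli_F (abse \o G)) => //=.
    exact: measurableT_comp.
  - move=> x _; rewrite -integral_cst//; apply: ge0_le_integral => //.
    by apply: measurableT_comp => //; exact: (measurableT_comp mG (pair1_measurable x)).
move=> /le_lt_trans; apply; rewrite integral_cst//.
by apply: lte_mul_pinfty; rewrite ?mule_ge0 ?fin_numM ?fin_num_measure// -ge0_fin_numE ?fin_num_measure.
Qed.

Let inner2 x : (\int[nu']_y G (x, y) = if x \in A then (\int[nu]_(y in C) F x y)%:E else 0)%E.
Proof.
case: ifPn => [|xA].
  rewrite inE => Ax; rewrite -(Rint_EFin mC nuC (section_snd Ax)).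
  rewrite [RHS]integral_mkcond; apply: eq_integral => y _; rewrite /G !patchE.
  congr (if _ then _ else _).
  by apply/idP/idP; rewrite !inE => //= -[].
rewrite -[RHS](@integral0 _ _ _ nu' setT); apply: eq_integral => y _; rewrite /G patchE ifF//.
by apply/negP; rewrite inE => -[/= Ax _]; move/negP: xA; apply; rewrite inE.
Qed.

Let inner1 y : (\int[mu']_x G (x, y) = if y \in C then (\int[mu]_(x in A) F x y)%:E else 0)%E.
Proof.
case: ifPn => [|yC].
  rewrite inE => Cy; rewrite -(Rint_EFin mA muA (section_fst Cy)).
  rewrite [RHS]integral_mkcond; apply: eq_integral => x _; rewrite /G !patchE.
  congr (if _ then _ else _).
  by apply/idP/idP; rewrite !inE => //= -[].
rewrite -[RHS](@integral0 _ _ _ mu' setT); apply: eq_integral => x _; rewrite /G patchE ifF//.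
by apply/negP; rewrite inE => -[/= _ Cy]; move/negP: yC; apply; rewrite inE.
Qed.

Lemma bmeas_inner_snd : bmeas A (fun x => \int[nu]_(y in C) F x y).
Proof.
split.
  have mI := measurable_int _ (integrable_fubini_F iG).
  apply/measurable_EFinP; apply: (eq_measurable_fun (fun x => \int[nu']_y G (x, y))%E).
    by move=> x xA /=; rewrite inner2 xA.
  exact: measurable_funTS.
exists (M * fine (nu C)) => x Ax.
apply: (le_trans (Rint_norm mC nuC (section_snd Ax))).
rewrite -Rintegral_cst//; apply: (le_Rint mC nuC).
- exact/bmeas_norm/section_snd.
- exact: bmeas_cst.
- by move=> y; exact: FM.
Qed.

Lemma bmeas_inner_fst : bmeas C (fun y => \int[mu]_(x in A) F x y).
Proof.
split.
  have mI := measurable_fubini_G iG.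
  apply/measurable_EFinP; apply: (eq_measurable_fun (fun y => \int[mu']_x G (x, y))%E).
    by move=> y yC /=; rewrite inner1 yC.
  exact: measurable_funTS.
exists (M * fine (mu A)) => y Cy.
apply: (le_trans (Rint_norm mA muA (section_fst Cy))).
rewrite -Rintegral_cst//; apply: (le_Rint mA muA).
- exact/bmeas_norm/section_fst.
- exact: bmeas_cst.
- by move=> x Ax; exact: FM.
Qed.

Lemma Rint_fubini :
  \int[mu]_(x in A) \int[nu]_(y in C) F x y = \int[nu]_(y in C) \int[mu]_(x in A) F x y.
Proof.
have := @Fubini _ _ _ _ _ mu' nu' _ iG.
under eq_integral do rewrite inner2.
under [X in _ = X -> _]eq_integral do rewrite inner1.
move=> H; rewrite /Rintegral; congr fine.
by rewrite [LHS]integral_mkcond [RHS]integral_mkcond; exact: H.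
Qed.
End fubini_bounded.

(** * Densities *)

Section extension_by_zero.
Context (R : realType) d (T : measurableType d).
Implicit Types (B : set T) (f : T -> R).

(** Turns an integral over [B] into an integral over the whole space while
    staying with real-valued functions. *)
Definition zext B f : T -> R := fun y => if y \in B then f y else 0.

Lemma zext_in B f y : B y -> zext B f y = f y.
Proof. by move=> By; rewrite /zext mem_set. Qed.

Lemma zext_out B f y : ~ B y -> zext B f y = 0.
Proof. by move=> By; rewrite /zext memNset. Qed.

Lemma zext_ge0 B f y : (forall y, B y -> 0 <= f y) -> 0 <= zext B f y.
Proof. by move=> f0; rewrite /zext; case: ifPn => // /set_mem; exact: f0. Qed.

Lemma bmeas_zext B f : measurable B -> bmeas B f -> bmeas setT (zext B f).
Proof.
move=> mB [mf [M fM]]; split; first exact/(measurable_restrictT _ mB).1.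
exists `|M| => y _; rewrite /zext; case: ifPn => [/set_mem By|_].
  by apply: (le_trans (fM _ By)); exact: ler_norm.
by rewrite normr0.
Qed.

Lemma EFin_zext B f : EFin \o zext B f = (EFin \o f) \_ B.
Proof. by apply/funext => y; rewrite /= patchE /zext; case: ifP. Qed.

Lemma Rint_zext (mu : {measure set T -> \bar R}) B f :
  \int[mu]_(x in B) f x = \int[mu]_x zext B f x.
Proof.
rewrite /Rintegral [in LHS]integral_mkcond; congr fine; apply: eq_integral => x _.
by rewrite -[RHS]/((EFin \o zext B f) x) EFin_zext.
Qed.
End extension_by_zero.

Section density_push.
Context (R : realType) d1 (X : measurableType d1) d (T : measurableType d).
Variables (mu : {measure set X -> \bar R}) (B : set X) (k : X -> R).
Hypotheses (Hmu : (mu setT < +oo)%E) (mB : measurable B) (bk : bmeas B k).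
Hypothesis k0 : forall y, B y -> 0 <= k y.

Let k' : X -> R := zext B k.
Let k'0 y : 0 <= k' y.
Proof. exact: zext_ge0. Qed.
Let bk' : bmeas setT k'.
Proof. exact: bmeas_zext. Qed.
Definition dens of (bmeas setT k') : set X -> \bar R :=
  fun A => (\int[mu]_(x in A) (k' x)%:E)%E.
Let nu := dens bk'.
Let nu0 : nu set0 = 0%E. Proof. exact: integral_set0. Qed.
Let nu_ge0 A : (0 <= nu A)%E.
Proof. by apply: integral_ge0 => x _; rewrite lee_fin. Qed.
Let nu_sa : semi_sigma_additive nu.
Proof.
apply: (semi_sigma_additive_nng_induced (f := EFin \o k')); last by move=> x; rewrite lee_fin.
by apply/measurable_EFinP; exact: bk'.1.
Qed.
HB.instance Definition _ := isMeasure.Build _ _ _ nu nu0 nu_ge0 nu_sa.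

Let densE : (fun A : set X => (\int[mu]_(y in A `&` B) (k y)%:E)%E) = nu.
Proof.
apply/funext => A; rewrite /nu /dens integral_mkcondr.
apply: eq_integral => x _.
by rewrite -[RHS]/((EFin \o zext B k) x) EFin_zext.
Qed.

Variables (S : X -> T) (C : set T).
Hypotheses (mS : measurable_fun B S) (mC : measurable C).
Hypothesis SC : forall y, B y -> C (S y).

(** Both sides integrate [h \o S] against the measure of density [k] on [B].  The
    map [S] is measurable on [B] only, so it is made constant outside [B] before
    pushing forward. *)
Lemma integral_density_push (h : T -> R) : bmeas C h ->
  (\int[pushforward (fun A : set X => (\int[mu]_(y in A `&` B) (k y)%:E)%E) S]_(p in C) (h p)%:E)%E =
  (\int[mu]_(y in B) (h (S y) * k y))%:E.
Proof.
move=> bh.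
have [[y0 By0]|B0] := pselect (B !=set0); last first.
  have -> : B = set0 by apply/seteqP; split => // y By; apply: B0; exists y.
  rewrite Rintegral_set0.
  have E : pushforward (fun A : set X => (\int[mu]_(y in A `&` set0) (k y)%:E)%E) S = (@mzero _ T R).
    by apply/funext => A; rewrite /pushforward setI0 integral_set0.
  by rewrite E integral_measure_zero.
pose S' : X -> T := fun y => if y \in B then S y else S y0.
have mS' : measurable_fun setT S'.
  move=> _ Y mY; rewrite setTI.
  rewrite (_ : _ @^-1` _ = (B `&` S @^-1` Y) `|` (~` B `&` (fun=> S y0) @^-1` Y)).
    apply: measurableU; first exact: mS.
    have := @measurable_cst _ _ _ _ (~` B) (S y0); apply => //; exact: measurableC.
  apply/seteqP; split => y /=; rewrite /S'; case: ifPn => [/set_mem By|].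
  - by left.
  - by move=> /negP yB Y0; right; split => // By; apply: yB; exact: mem_set.
  - by case=> -[].
  - by move=> /negP yB [[By]|[]//]; exfalso; apply: yB; exact: mem_set.
have pE : pushforward (fun A : set X => (\int[mu]_(y in A `&` B) (k y)%:E)%E) S = pushforward nu S'.
  apply/funext => A; rewrite /pushforward -densE.
  congr (integral _ _ _); apply/seteqP; split => y [/= SA By]; split => //=;
    move: SA; rewrite /S' ifT//; exact: mem_set.
rewrite pE integral_mkcond.
have hC : (fun p => (h p)%:E) \_ C = EFin \o zext C h by rewrite EFin_zext.
rewrite hC.
have bhC : bmeas setT (zext C h) by exact: bmeas_zext.
have bhS : bmeas setT (zext C h \o S').
  case: bhC => mh [M hM]; split; first exact: measurableT_comp.
  by exists M => y _; exact: hM.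
have Hnu : (nu setT < +oo)%E.
  rewrite /nu /dens; rewrite Rint_EFin ?ltry//.
have inu : nu.-integrable setT (EFin \o (zext C h \o S')).
  exact: bmeas_integrable.
rewrite integral_pushforward//; last first.
  by apply/measurable_EFinP; exact: bhC.1.
rewrite preimage_setT.
transitivity ((\int[nu]_(y in setT) (zext C h \o S') y)%:E); first by rewrite -Rint_EFin.
congr EFin; rewrite (Rint_density (mu := mu) (nu := nu) measurableT Hmu Hnu bk') //.
  rewrite [RHS]Rint_zext; apply: eq_Rint => y _ /=.
  have [By|By] := pselect (B y); last by rewrite /k' !(zext_out _ By) mul0r.
  by rewrite /k' !(zext_in _ By) /S' mem_set// zext_in; [exact: mulrC|exact: SC].
by move=> A mA; rewrite setIT.
Qed.
End density_push.

Section small_integrals.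
Context (R : realType) d (T : measurableType d).
Variables (mu : {measure set T -> \bar R}) (C : set T) (f : nat -> T -> R).
Hypotheses (Hmu : (mu setT < +oo)%E) (mC : measurable C).
Hypothesis bf : forall n, bmeas C (f n).
Hypothesis f0 : forall n x, C x -> 0 <= f n x.
Hypothesis small : forall e, 0 < e -> exists n, \int[mu]_(x in C) f n x < e.

Lemma small_set k : measurable (C `&` [set x | forall n, k.+1%:R^-1 <= f n x]) /\
  mu (C `&` [set x | forall n, k.+1%:R^-1 <= f n x]) = 0%E.
Proof.
set N := _ `&` _.
have mN : measurable N.
  rewrite (_ : N = \bigcap_n (C `&` f n @^-1` `[k.+1%:R^-1, +oo[)).
    by apply: bigcap_measurableType => n _; apply: (bf n).1.
  apply/seteqP; split => [x [Cx h] n _|x h]; first by split; rewrite //= in_itv/= h.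
  split; first exact: (h 0%N I).1.
  by move=> n; have := (h n I).2; rewrite /= in_itv/= andbT.
split=> //.
have NC : N `<=` C by move=> x [].
have muC : (mu C < +oo)%E by exact: (sub_finite Hmu).
have muN : (mu N < +oo)%E by exact: (sub_finite Hmu).
have k0 : 0 < k.+1%:R^-1 :> R by rewrite invr_gt0.
apply/eqP; rewrite eq_le measure_ge0 andbT.
rewrite -(@fineK _ (mu N)) ?ge0_fin_numE// lee_fin.
apply/ler_addgt0Pl => e e0; rewrite addr0.
have [n hn] := small (mulr_gt0 e0 k0).
have : k.+1%:R^-1 * fine (mu N) <= \int[mu]_(x in C) f n x.
  rewrite -(Rintegral_cst mu mN) Rint_zext [leRHS]Rint_zext.
  apply: (le_Rint measurableT Hmu).
  - by apply: bmeas_zext => //; exact: bmeas_cst.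
  - exact: bmeas_zext.
  - move=> x _; have [Nx|Nx] := pselect (N x).
      by rewrite !zext_in//; [exact: (Nx.2 n)|exact: NC].
    by rewrite zext_out//; apply: zext_ge0 => y; exact: f0.
move=> h; have {h}/ltW := le_lt_trans h hn.
by rewrite mulrC ler_pM2r.
Qed.

(** By Markov's inequality, the set where every [f n] is at least [1 / (k + 1)]
    has measure at most [k + 1] times arbitrarily small numbers. *)
Lemma small_ae : measurable (C `&` ~` [set x | forall e, 0 < e -> exists n, f n x < e]) /\
  mu (C `&` ~` [set x | forall e, 0 < e -> exists n, f n x < e]) = 0%E.
Proof.
rewrite (_ : _ `&` _ = \bigcup_k (C `&` [set x | forall n, k.+1%:R^-1 <= f n x])).
  have mk k := (small_set k).1.
  have mU : measurable (\bigcup_k (C `&` [set x | forall n, k.+1%:R^-1 <= f n x])).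
    exact: bigcupT_measurable.
  split => //; apply/eqP; rewrite eq_le measure_ge0 andbT.
  apply: (le_trans (measure_sigma_subadditive mu mk mU (@subset_refl _ _))).
  by rewrite eseries0// => i _ _; exact: (small_set i).2.
apply/seteqP; split => [x [Cx]|x [k _ [Cx h]]].
  move=> /= /existsNP[e /not_implyP[e0 h]].
  exists (Num.trunc e^-1) => //; split => //= n; apply: contrapT => /negP; rewrite -ltNge => fn.
  apply: h; exists n; apply: (lt_trans fn); rewrite -[ltRHS]invrK ltf_pV2 ?posrE ?invr_gt0//.
  exact: truncnS_gt.
split => // H; have [|n] := H k.+1%:R^-1; first by rewrite invr_gt0.
by rewrite ltNge h.
Qed.
End small_integrals.

Section compare_densities.
Context (R : realType) (X : pmetricType R).
Variables (mu : {measure set (borel X) -> \bar R}) (B : set X).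
Hypotheses (Hmu : (mu setT < +oo)%E) (cB : compact B).
Hypothesis full : forall V : set X, open V -> V `&` B !=set0 -> (0 < mu (V `&` B))%E.

(** If [k2 z < k1 z], the inequality persists near [z], on a set of positive
    measure. *)
Lemma le_of_density (k1 k2 : X -> R) :
  {within B, continuous k1} -> {within B, continuous k2} ->
  (forall A : set (borel X), measurable A ->
    \int[mu]_(y in A `&` B) k1 y <= \int[mu]_(y in A `&` B) k2 y) ->
  forall y, B y -> k1 y <= k2 y.
Proof.
move=> c1 c2 H z Bz; rewrite leNgt; apply/negP => k12.
have hX : hausdorff_space X by exact: metric_hausdorff.
have mB : measurable (B : set (borel X)) by exact: borel_compact.
pose e := (k1 z - k2 z) / 2.
have e0 : 0 < e by rewrite divr_gt0// subr_gt0.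
have /within_contP/(_ z Bz e e0) := within_contB c1 c2.
rewrite /prop_near1 nbhsE => -[V [oV Vz] VB].
have mV : measurable (V : set (borel X)) by exact: borel_open.
have mVB : measurable (V `&` B : set (borel X)) by exact: measurableI.
have muVB : (mu (V `&` B) < +oo)%E.
  exact: (sub_finite Hmu).
have b1 : bmeas (V `&` B : set (borel X)) k1.
  have [m1 [M hM]] := bmeas_within hX cB c1; split; first exact: (measurable_funS mB).
  by exists M => y [_ /hM].
have b2 : bmeas (V `&` B : set (borel X)) k2.
  have [m1 [M hM]] := bmeas_within hX cB c2; split; first exact: (measurable_funS mB).
  by exists M => y [_ /hM].
have := H V mV; rewrite -subr_ge0 -Rint_B// => le0.
have : e * fine (mu (V `&` B)) <= \int[mu]_(y in V `&` B) (k1 y - k2 y).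
  rewrite -Rintegral_cst//; apply: le_Rint => //; [exact: bmeas_cst|exact: bmeasB|].
  move=> y [Vy By]; have := VB _ Vy By; rewrite ltr_norml => /andP[+ _].
  by rewrite /e; lra.
have : \int[mu]_(y in V `&` B) (k1 y - k2 y) = - \int[mu]_(y in V `&` B) (k2 y - k1 y).
  by rewrite !Rint_B// opprB.
move=> -> h.
have : 0 < e * fine (mu (V `&` B)).
  rewrite mulr_gt0// fine_gt0// muVB andbT; apply: full => //; by exists z.
by move: le0 h; lra.
Qed.

Lemma param_continuous (S : topologicalType) (A : set S) (F : S -> X -> R) :
  {within A `*` B, continuous (fun p => F p.1 p.2)} ->
  {within A, continuous (fun s => \int[mu]_(y in B) F s y)}.
Proof.
move=> cF; apply/within_contP => s As e e0.
have hX : hausdorff_space X by exact: metric_hausdorff.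
have mB : measurable (B : set (borel X)) by exact: borel_compact.
have muB : (mu B < +oo)%E by exact: (sub_finite Hmu).
have d0 : 0 < e / (fine (mu B) + 1) by rewrite divr_gt0// ltr_wpDl// fine_ge0.
have := tube cB cF As d0; apply: filterS => s' h As'.
have b s1 : A s1 -> bmeas (B : set (borel X)) (F s1).
  by move=> As1; apply: bmeas_within => //; exact: joint_snd cF As1.
apply: (@le_lt_trans _ _ (e / (fine (mu B) + 1) * fine (mu B))).
  by apply: Rint_dist; [exact: mB|exact: muB|exact: b|exact: b|move=> y /h => /(_ As')/ltW].
have m0 : 0 <= fine (mu B) by exact: fine_ge0.
rewrite mulrAC ltr_pdivrMr ?ltr_wpDl// ltr_pM2l// ltrDl//.
Qed.
End compare_densities.

(** * Limits along ultrafilters *)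

Section ultrafilters.

Lemma fmap_ultra (I T : Type) (f : I -> T) (U : set_system I) :
  UltraFilter U -> UltraFilter (f @ U).
Proof.
move=> UU; split; first exact: fmap_proper_filter.
move=> G PG UG; apply/seteqP; split => // A GA.
have [//|UA] := in_ultra_setVsetC (f @^-1` A) UU.
have : G (A `&` ~` A) by apply: filterI => //; apply: UG.
by rewrite setICr => /filter_not_empty.
Qed.

Lemma compact_ultra_lim (I : Type) (T : topologicalType) (C : set T) (f : I -> T)
    (U : set_system I) : compact C -> UltraFilter U -> U (f @^-1` C) ->
  exists2 p, C p & f @ U --> p.
Proof.
move=> cC UU UC; have UfU := fmap_ultra f UU.
have := cC; rewrite compact_ultra => /(_ (f @ U) UfU UC)[p [Cp fp]].
by exists p.
Qed.

Lemma bounded_ultra_lim (R : realType) (I : Type) (f : I -> R) (U : set_system I) (M : R) :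
  UltraFilter U -> U [set i | `|f i| <= M] -> exists l : R, f @ U --> l.
Proof.
move=> UU UM.
have [||l _ fl] := @compact_ultra_lim I _ `[- M, M] f U.
- exact: segment_compact.
- by apply: filterS UM => i /=; rewrite in_itv/= ler_norml.
by exists l.
Qed.

Lemma ultra_infty : exists2 U : set_system nat, UltraFilter U & \oo `<=` U.
Proof. by have [U [UU sU]] := @ultraFilterLemma nat \oo _; exists U. Qed.

(** If the sequence does not converge, it stays away from [l] along some
    ultrafilter containing the neighbourhoods of infinity. *)
Lemma cvg_ultra (R : realType) (u : nat -> R) (l : R) :
  (forall U : set_system nat, UltraFilter U -> \oo `<=` U -> u @ U --> l) ->
  u @ \oo --> l.
Proof.
move=> H; apply/cvgrPdist_lt => e e0; apply: contrapT => Ne.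
pose N := [set n | ~ `|l - u n| < e].
have PN : ProperFilter (within N \oo).
  apply: Build_ProperFilter_ex => P; rewrite /within => hP; apply: contrapT => PN.
  apply: Ne; have {}hP : \forall n \near \oo, N n -> P n := hP.
  apply: filterS hP => n NP; apply: contrapT => Nn; apply: PN; exists n; exact: NP.
have [U [UU sU]] := ultraFilterLemma PN.
have oU : \oo `<=` U.
  by move=> P hP; apply: sU; apply: filterS hP => n Pn.
have /cvgrPdist_lt/(_ e e0) h := H U UU oU.
have UN : U N by apply: sU; rewrite /within /=; apply: nearW.
by have [n [/= h1]] := filter_ex (filterI h UN); apply.
Qed.

Lemma within_cvg_comp (I : Type) (T S : topologicalType) (C : set T) (e : T -> S)
    (U : set_system I) (f : I -> T) p : Filter U ->
  {within C, continuous e} -> C p -> f @ U --> p -> U (f @^-1` C) ->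
  (e \o f) @ U --> e p.
Proof.
move=> FU /subspace_continuousP ce Cp fp UC A /(ce _ Cp).
rewrite /within /= => /fp h; have h' : U (fun i => C (f i) -> A (e (f i))) := h.
apply: (@filterS _ U _ _ _ _ (filterI h' UC)) => i [/= h1 Ci]; exact: h1.
Qed.

End ultrafilters.

Section dominated.
Context (R : realType) d (T : measurableType d).
Variables (mu : {measure set T -> \bar R}) (C : set T).
Hypotheses (mC : measurable C) (muC : (mu C < +oo)%E).

Lemma Rint_dominated (f : nat -> T -> R) (g : T -> R) (M : R) :
  (forall n, measurable_fun C (f n)) ->
  (forall n x, C x -> `|f n x| <= M) ->
  (forall x, C x -> f ^~ x @ \oo --> g x) ->
  bmeas C g /\ (fun n => \int[mu]_(x in C) f n x) @ \oo --> \int[mu]_(x in C) g x.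
Proof.
move=> mf fM fg.
have bf n : bmeas C (f n) by split => //; exists M; exact: fM.
have bg : bmeas C g.
  split; first exact: (measurable_fun_cvg mf fg).
  exists M => x Cx; have /(cvg_norm) h := fg x Cx.
  by apply: (ler_cvg_to h (cvg_cst M)); apply: nearW => n; exact: fM.
split => //.
have := @dominated_convergence _ T R mu C mC (fun n => EFin \o f n) (EFin \o g) (cst M%:E).
case.
- by move=> n; apply/measurable_EFinP.
- by apply/measurable_EFinP; exact: bg.1.
- by apply: aeW => x Cx; apply/fine_cvgP; split; [exact: nearW|exact: fg].
- apply: (bmeas_integrable (mu := mu) mC muC (f := cst M)); exact: bmeas_cst.
- by apply: aeW => x n Cx; rewrite lee_fin; exact: fM.
move=> _ _; rewrite (Rint_EFin mC muC bg) => /fine_cvg.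
by apply.
Unshelve. all: by end_near. Qed.
End dominated.

(** * Measures separated by countably many coordinates *)

Lemma within_cont_sum (R : realType) (T : topologicalType) (A : set T) n (f : nat -> T -> R) :
  (forall i, {within A, continuous (f i)}) ->
  {within A, continuous (fun x => \sum_(i < n) f i x)}.
Proof.
move=> cf; elim: n => [|n IH].
  by apply: (@eq_within_cont R T A (fun=> 0)); [move=> x _; rewrite big_ord0|exact: within_cont_cst].
apply: (@eq_within_cont R T A (fun x => \sum_(i < n) f i x + f n x)).
  by move=> x _; rewrite big_ord_recr.
exact: within_contD.
Qed.

Lemma within_cont_prod (R : realType) (T : topologicalType) (A : set T) n (f : nat -> T -> R) :
  (forall i, {within A, continuous (f i)}) ->
  {within A, continuous (fun x => \prod_(i < n) f i x)}.
Proof.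
move=> cf; elim: n => [|n IH].
  by apply: (@eq_within_cont R T A (fun=> 1)); [move=> x _; rewrite big_ord0|exact: within_cont_cst].
apply: (@eq_within_cont R T A (fun x => \prod_(i < n) f i x * f n x)).
  by move=> x _; rewrite big_ord_recr.
exact: within_contM.
Qed.

Lemma within_cont_min (R : realType) (T : topologicalType) (A : set T) (f g : T -> R) :
  {within A, continuous f} -> {within A, continuous g} ->
  {within A, continuous (fun x => Num.min (f x) (g x))}.
Proof.
move=> cf cg.
apply: (@eq_within_cont R T A (fun x => 2^-1 * (f x + g x - `|f x - g x|))).
  by move=> x _; rewrite minr_absE mulrC.
apply: within_contM; first exact: within_cont_cst.
by apply: within_contB; [exact: within_contD|apply: within_cont_norm; exact: within_contB].
Qed.

Lemma within_cont_max (R : realType) (T : topologicalType) (A : set T) (f g : T -> R) :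
  {within A, continuous f} -> {within A, continuous g} ->
  {within A, continuous (fun x => Num.max (f x) (g x))}.
Proof.
move=> cf cg.
apply: (@eq_within_cont R T A (fun x => 2^-1 * (f x + g x + `|f x - g x|))).
  by move=> x _; rewrite maxr_absE mulrC.
apply: within_contM; first exact: within_cont_cst.
by apply: within_contD; [exact: within_contD|apply: within_cont_norm; exact: within_contB].
Qed.

Section coordinates.
Context (R : realType) (T : ptopologicalType).
Variables (C : set T) (e : nat -> T -> R).
Hypothesis cC : compact C.
Hypothesis ce : forall j, {within C, continuous (e j)}.
Hypothesis sep : forall p q, C p -> C q -> (forall j, e j p = e j q) -> p = q.

(** Otherwise there are points outside [V] whose first coordinates approach those
    of [q]; a limit point of them has the same coordinates as [q], hence is [q]. *)
Lemma coord_nbhs (V : set T) q : open V -> C q -> V q ->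
  exists N, exists2 r : R, 0 < r &
    forall p, C p -> (forall j, (j < N)%N -> `|e j p - e j q| < r) -> V p.
Proof.
move=> oV Cq Vq; apply: contrapT => H.
have {}H N : exists p, [/\ C p, forall j, (j < N)%N -> `|e j p - e j q| < N.+1%:R^-1 & ~ V p].
  apply: contrapT => H'; apply: H; exists N, N.+1%:R^-1; first by rewrite invr_gt0.
  by move=> p Cp hp; apply: contrapT => Vp; apply: H'; exists p.
pose p N := projT1 (cid (H N)).
have pP N : [/\ C (p N), forall j, (j < N)%N -> `|e j (p N) - e j q| < N.+1%:R^-1 & ~ V (p N)].
  exact: (projT2 (cid (H N))).
have [U UU sU] := ultra_infty.
have UC : U (p @^-1` C) by apply: (@filterS _ U _ setT) => [N _|]; [by case: (pP N)|exact: filterT].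
have [p' Cp' pp'] := compact_ultra_lim cC UU UC.
have pq : p' = q.
  apply: sep => // j.
  have h1 : (e j \o p) @ U --> e j p' by apply: within_cvg_comp pp' UC.
  have h2 : (e j \o p) @ U --> e j q.
    apply: (@cvg_trans _ ((e j \o p) @ \oo)); first by move=> A; exact: sU.
    apply/cvgrPdist_lt => r r0; near=> N.
    have [_ h _] := pP N; rewrite distrC; apply: (lt_trans (h j _)).
      by near: N; exists j.+1.
    near: N; exists (Num.trunc r^-1) => // N /= hN.
    rewrite -[r]invrK ltf_pV2 ?posrE ?invr_gt0//.
    by apply: (lt_le_trans (truncnS_gt r^-1)); rewrite ler_nat.
  exact: (cvg_unique (@Rhausdorff R) h1 h2).
have : U (p @^-1` V).
  by apply: pp'; rewrite pq; exact: open_nbhs_nbhs.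
by move=> /filter_ex[N /= VpN]; case: (pP N).
Unshelve. all: by end_near. Qed.

Definition box (b : seq rat * nat) : set T :=
  [set p | forall j, (j < size b.1)%N -> `|e j p - ratr (nth 0 b.1 j)| < b.2.+1%:R^-1].

Lemma box_nbhs (V : set T) q : open V -> C q -> V q ->
  exists b, box b q /\ box b `&` C `<=` V.
Proof.
move=> oV Cq Vq; have [N [r r0 H]] := coord_nbhs oV Cq Vq.
pose k := Num.trunc (2 / r).
have kr : 2 / k.+1%:R < r.
  by rewrite ltr_pdivrMr// mulrC -ltr_pdivrMr//; exact: truncnS_gt.
have k0 : 0 < k.+1%:R^-1 :> R by rewrite invr_gt0.
have Hs j : exists s : rat, `|e j q - ratr s| < k.+1%:R^-1.
  have [|s] := @rat_in_itvoo R (e j q - k.+1%:R^-1) (e j q + k.+1%:R^-1).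
    by rewrite ltrBlDr -addrA ltrDl addr_gt0.
  rewrite in_itv/= => /andP[h1 h2]; exists s.
  by rewrite distrC ltr_distl h1.
pose s j := projT1 (cid (Hs j)).
have sP j : `|e j q - ratr (s j)| < k.+1%:R^-1 by exact: (projT2 (cid (Hs j))).
exists (mkseq s N, k); split => /=.
  by move=> j /=; rewrite size_mkseq => jN; rewrite nth_mkseq.
move=> p [/= bp Cp]; apply: H => // j jN; apply: lt_trans kr.
have := bp j; rewrite size_mkseq => /(_ jN); rewrite nth_mkseq// => h1.
have := sP j; rewrite distrC => h2.
apply: (le_lt_trans (ler_distD (ratr (s j)) _ _)).
apply: (lt_le_trans (ltrD h1 h2)).
by rewrite mulrDl !mul1r.
Qed.

(** An open set meets [C] in a union of boxes with rational data, and there are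
    countably many of them. *)
Lemma measurable_into d (S : measurableType d) (E : set S) (f : S -> T) : measurable E ->
  (forall s, E s -> C (f s)) -> (forall j, measurable_fun E (e j \o f)) ->
  measurable_fun E (f : S -> borel T).
Proof.
move=> mE fC mef.
have H := @measurability _ _ S (borel T) E (f : S -> borel T) (@open T) erefl.
apply: H => _ [V oV <-].
have mbox b : measurable (E `&` f @^-1` box b).
  rewrite (_ : _ `&` _ = \bigcap_j (if (j < size b.1)%N then
      E `&` (e j \o f) @^-1` (ball (ratr (nth 0 b.1 j) : R) (b.2.+1%:R^-1 : R)) else E)).
    apply: bigcap_measurableType => j _; case: ifP => // _.
    by apply: mef => //; apply: measurable_ball.
  apply/seteqP; split => [x [Ex bx] j _|x h]; last first.
    split => [|j jb]; first by have := h 0%N I; case: ifP => [_ []|].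
    by have := h j I; rewrite jb => -[_]; rewrite /= /ball/= distrC.
  by case: ifP => // jb; split => //; rewrite /= /ball/= distrC; exact: bx.
rewrite (_ : _ `&` _ = \bigcup_(i : nat)
    (if unpickle i is Some b then
       if `[< box b `&` C `<=` V >] then E `&` f @^-1` box b else set0 else set0)).
  by apply: bigcupT_measurable => i; case: (unpickle i) => [b|//]; case: asboolP.
apply/seteqP; split => [x [Ex Vx]|x [i _]].
  have [b [bx bV]] := box_nbhs oV (fC x Ex) Vx.
  by exists (pickle b) => //; rewrite pickleK; case: asboolP.
case: (unpickle i) => [b|[]]; case: asboolP => [bV|_ []] [Ex bx]; split => //=.
by apply: bV; split => //; exact: fC.
Qed.

(** Encodes membership in a box by a continuous function of the coordinates: its
    value is positive exactly on the box. *)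
Definition box_bump (b : seq rat * nat) (x : nat -> R) : R :=
  \prod_(j < size b.1) Num.max 0 (b.2.+1%:R^-1 - `|x j - ratr (nth 0 b.1 j)|).

Lemma box_bump_ge0 b x : 0 <= box_bump b x.
Proof. by apply: prodr_ge0 => j _; rewrite le_max lexx. Qed.

Lemma box_bump_gt0 b p : 0 < box_bump b (e ^~ p) <-> box b p.
Proof.
split=> [|bp]; last first.
  by apply: prodr_gt0 => j _; rewrite lt_max ltxx /= subr_gt0; exact: bp.
move=> h j jb; rewrite ltNge; apply/negP => hj; move: h.
rewrite /box_bump (bigD1 (Ordinal jb))//= max_l ?mul0r ?ltxx//.
by rewrite subr_le0.
Qed.

Lemma box_bump_cont (S : topologicalType) (A : set S) (x : nat -> S -> R) b :
  (forall j, {within A, continuous (x j)}) -> {within A, continuous (fun p => box_bump b (x ^~ p))}.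
Proof.
move=> cx; apply: (within_cont_prod (f := fun j p =>
  Num.max 0 (b.2.+1%:R^-1 - `|x j p - ratr (nth 0 b.1 j)|))) => j.
apply: within_cont_max; first exact: within_cont_cst.
apply: within_contB; first exact: within_cont_cst.
by apply: within_cont_norm; apply: within_contB => //; exact: within_cont_cst.
Qed.

Section uniqueness.
Variables (mu nu : {measure set (borel T) -> \bar R}).
Variables (T' : topologicalType) (C' : set T') (e' : nat -> T' -> R).
Hypothesis ce' : forall j, {within C', continuous (e' j)}.
Hypotheses (mC : measurable (C : set (borel T))).
Hypotheses (Hmu : (mu setT < +oo)%E) (Hnu : (nu setT < +oo)%E).
Hypotheses (muC : mu (~` C) = 0%E) (nuC : nu (~` C) = 0%E).
Hypothesis H : forall f : (nat -> R) -> R, {within C', continuous (fun p => f (e' ^~ p))} ->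
  \int[mu]_(p in C) f (e ^~ p) = \int[nu]_(p in C) f (e ^~ p).

(* Continuous functions of the coordinates that tend to the indicator function of
   [V] on [C]: sums of bumps over boxes inside [V], scaled up and cut at 1. *)
Let approx (V : set T) (k : nat) (x : nat -> R) : R :=
  Num.min 1 (k%:R * \sum_(i < k)
    if unpickle i is Some b then
      if `[< box b `&` C `<=` V >] then box_bump b x else 0 else 0).

Let approx_cont (S : topologicalType) (A : set S) (x : nat -> S -> R) V k :
  (forall j, {within A, continuous (x j)}) -> {within A, continuous (fun p => approx V k (x ^~ p))}.
Proof.
move=> cx; apply: within_cont_min; first exact: within_cont_cst.
apply: within_contM; first exact: within_cont_cst.
apply: (within_cont_sum (f := fun i p => if unpickle i is Some b then
      if `[< box b `&` C `<=` V >] then box_bump b (x ^~ p) else 0 else 0)) => i.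
case: (unpickle i) => [b|]; last exact: within_cont_cst.
by case: asboolP => _; [exact: box_bump_cont|exact: within_cont_cst].
Qed.

Let term_ge0 V i p : 0 <= (if unpickle i is Some b then
      if `[< box b `&` C `<=` V >] then box_bump b p else 0 else 0 : R).
Proof. by case: unpickle => [b|//]; case: asboolP => // _; exact: box_bump_ge0. Qed.

Let approx_le1 V k p : `|approx V k p| <= 1.
Proof.
rewrite ger0_norm ?ge_min ?lexx// le_min ler01/= mulr_ge0//.
by apply: sumr_ge0 => i _; exact: term_ge0.
Qed.

Let approx_cvg (V : set T) p : open V -> C p -> (fun k => approx V k (e ^~ p)) @ \oo --> (\1_V p : R).
Proof.
move=> oV Cp; have [Vp|Vp] := pselect (V p); last first.
  rewrite indicE memNset//; apply: cvg_near_cst; apply: nearW => k.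
  rewrite /approx big1 ?mulr0 ?min_r// => i _.
  case: unpickle => [b|//]; case: asboolP => // bV.
  have [//|n0] := eqVneq (box_bump b (e ^~ p)) 0; exfalso; apply: Vp; apply: bV; split => //.
  by apply/box_bump_gt0; rewrite lt_def n0 box_bump_ge0.
rewrite indicE mem_set//; have [b [bp bV]] := box_nbhs oV Cp Vp.
have /box_bump_gt0 b0 := bp.
apply: cvg_near_cst; near=> k; rewrite /approx min_l//.
have hk : (pickle b < k)%N by near: k; exists (pickle b).+1.
apply: (@le_trans _ _ (k%:R * box_bump b (e ^~ p))).
  rewrite -ler_pdivrMr// div1r; apply: ltW; near: k.
  exists (Num.trunc (box_bump b (e ^~ p))^-1).+1 => // k /= hk.
  by apply: (lt_le_trans (truncnS_gt _)); rewrite ler_nat.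
rewrite ler_wpM2l// (bigD1 (Ordinal hk))//= pickleK asboolT// lerDl.
by apply: sumr_ge0 => i _; exact: term_ge0.
Unshelve. all: by end_near. Qed.

(** Open sets generate the Borel sets and are stable under intersection, and the
    indicator function of an open set is a limit of continuous functions of the
    coordinates.  The continuity of the test functions is tested in a second space
    [T'] with its own coordinates: measures on a set of functions will be compared
    through test functions that are continuous on a product containing it. *)
Lemma coord_measure_unique A : measurable (A : set (borel T)) -> mu A = nu A.
Proof.
have part (m : {measure set (borel T) -> \bar R}) : (m setT < +oo)%E -> m (~` C) = 0%E ->
    forall V : set T, open V ->
    (m V = (\int[m]_(p in C) (\1_V p))%:E)%E /\
    (fun k => \int[m]_(p in C) approx V k (e ^~ p)) @ \oo --> \int[m]_(p in C) (\1_V p).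
  move=> hm mC0 V oV; have mV := borel_open oV.
  have mfin : (m C < +oo)%E by exact: (sub_finite hm).
  have [|||b1 c1] := @Rint_dominated R _ (borel T) m C mC mfin (fun k p => approx V k (e ^~ p)) (\1_V) 1.
  - by move=> k; apply: within_cont_measurableR => //; exact: approx_cont.
  - by move=> k p _; exact: approx_le1.
  - by move=> p Cp; exact: approx_cvg.
  split => //; rewrite -(Rint_EFin mC mfin b1) integral_indic//.
  rewrite -[in LHS](setIT V) -(setUv C) setIUr measureU//; last first.
  - by apply/seteqP; split => // x [[_ Cx] [_ nCx]]; exact: nCx.
  - by apply: measurableI => //; exact: measurableC.
  - exact: measurableI.
  rewrite [X in (_ + X)%E = _](_ : _ = 0%E) ?adde0//.
  apply/eqP; rewrite eq_le measure_ge0 andbT -mC0; apply: le_measure; rewrite ?inE//.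
    by apply: measurableI => //; exact: measurableC.
  exact: measurableC.
apply: (@measure_unique _ R (borel T) (@open T) (fun=> setT)) => //.
- exact: openI.
- by move=> _; exact: openT.
- by apply/seteqP; split => // x _; exists 0%N.
- move=> V oV; have [-> h1] := part mu Hmu muC V oV.
  have [-> h2] := part nu Hnu nuC V oV; congr EFin.
  apply: (cvg_unique (@Rhausdorff R) h1).
  have -> : (fun k => \int[mu]_(p in C) approx V k (e ^~ p)) = (fun k => \int[nu]_(p in C) approx V k (e ^~ p)).
    by apply/funext => k; apply: H; exact: approx_cont.
  exact: h2.
Qed.
End uniqueness.
End coordinates.

(** * Realizing limit laws on an interval *)

(** The measures of density [k n] have the same mass [M], and [bit] lists countably
    many binary observables.  For a finite word [w], let [mass w] be the limit
    along [U] of the measure of the points whose first bits are [w].  It is additive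
    when [w] is split by its next bit, so that the words of length [N] cut [0, M)
    into consecutive intervals of length [mass w], finer and finer as [N] grows.
    The address of [t] consists of the words of the intervals that contain [t]; its
    law under Lebesgue measure is the limit law of the observed bits. *)
Section skorokhod.
Context (R : realType) d (T : measurableType d).
Variables (mu : nat -> {measure set T -> \bar R}) (B : nat -> set T) (k : nat -> T -> R).
Variables (M : R) (bit : nat -> nat -> T -> bool).
Hypotheses (mB : forall n, measurable (B n)) (Hmu : forall n, (mu n (B n) < +oo)%E).
Hypotheses (bk : forall n, bmeas (B n) (k n)) (k0 : forall n y, B n y -> 0 <= k n y).
Hypothesis kM : forall n, \int[mu n]_(y in B n) k n y = M.
Hypothesis bbit : forall n i, bmeas (B n) (fun y => (bit n i y)%:R : R).

Let J n (f : T -> R) := \int[mu n]_(y in B n) (f y * k n y).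

(** Stored backwards, the last observed bit being the head, so that one more
    observation is a [cons]. *)
Fixpoint word n (y : T) N : seq bool :=
  if N is N'.+1 then bit n N' y :: word n y N' else [::].

Lemma nth_word n y N i : (i < N)%N -> nth false (rev (word n y N)) i = bit n i y.
Proof.
elim: N => // N IH; rewrite ltnS leq_eqVlt => /orP[/eqP->|iN] /=.
  rewrite rev_cons nth_rcons size_rev.
  have -> : size (word n y N) = N by elim: N {IH} => //= N ->.
  by rewrite ltnn eqxx.
rewrite rev_cons nth_rcons size_rev.
have -> : size (word n y N) = N by elim: N {IH iN} => //= N ->.
by rewrite iN; exact: IH.
Qed.

Lemma size_word n y N : size (word n y N) = N.
Proof. by elim: N => //= N ->. Qed.

Let ind n (w : seq bool) (y : T) : R := (word n y (size w) == w)%:R.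

Let ind_cons n b w y : ind n (b :: w) y =
  ind n w y * (if b then (bit n (size w) y)%:R else 1 - (bit n (size w) y)%:R).
Proof.
rewrite /ind /= eqseq_cons; case: b; case: (bit n (size w) y) => //=;
  by rewrite ?mulr0 ?mulr1 ?subr0 ?subrr ?mulr0 ?mulr1.
Qed.

Let bind n w : bmeas (B n) (ind n w).
Proof.
elim: w => [|b w IH]; first exact: bmeas_cst.
apply: (@eq_bmeas _ _ _ _ (fun y => ind n w y *
  (if b then (bit n (size w) y)%:R else 1 - (bit n (size w) y)%:R))).
  by move=> y _; rewrite ind_cons.
apply: bmeasM => //; case: b => //; apply: bmeasB => //; exact: bmeas_cst.
Qed.

Let ind01 n w y : 0 <= ind n w y <= 1.
Proof. by rewrite /ind; case: eqP => _; rewrite lexx ler01. Qed.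

Let JD n f g : bmeas (B n) f -> bmeas (B n) g -> J n (fun y => f y + g y) = J n f + J n g.
Proof.
move=> bf bg; rewrite /J -(Rint_D (mB n) (Hmu n)); [|exact: bmeasM|exact: bmeasM].
by apply: eq_Rint => y _; rewrite mulrDl.
Qed.

Let JZ n c f : bmeas (B n) f -> J n (fun y => c * f y) = c * J n f.
Proof.
move=> bf; rewrite /J -(Rint_Zl (mB n) (Hmu n)); last exact: bmeasM.
by apply: eq_Rint => y _; rewrite mulrA.
Qed.

Let Jle n f g : bmeas (B n) f -> bmeas (B n) g -> (forall y, B n y -> f y <= g y) ->
  J n f <= J n g.
Proof.
move=> bf bg fg; apply: (le_Rint (mB n) (Hmu n)); [exact: bmeasM|exact: bmeasM|].
by move=> y By; rewrite ler_wpM2r ?k0 ?fg.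
Qed.

Let Jcst n c : J n (fun=> c) = c * M.
Proof.
rewrite -(kM n) -(Rint_Zl (mB n) (Hmu n))//.
Qed.

Let Jdist n f g (r : R) : bmeas (B n) f -> bmeas (B n) g ->
  (forall y, B n y -> `|f y - g y| <= r) -> `|J n f - J n g| <= r * M.
Proof.
move=> bf bg fg; rewrite -(Jcst n) ler_norml; apply/andP; split.
  rewrite lerNl opprB lerBlDr -JD//; last exact: bmeas_cst.
  apply: Jle => //; first by apply: bmeasD => //; exact: bmeas_cst.
  by move=> y /fg; rewrite ler_norml => /andP[+ _]; rewrite lerNl opprB lerBlDr.
rewrite lerBlDr -JD//; last exact: bmeas_cst.
apply: Jle => //; first by apply: bmeasD => //; exact: bmeas_cst.
by move=> y /fg; rewrite ler_norml => /andP[_]; rewrite lerBlDr.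
Qed.

Let M0 : 0 <= M.
Proof. by rewrite -(kM 0%N); apply: Rintegral_ge0 => y; exact: k0. Qed.

Variable U : set_system nat.
Hypothesis UU : UltraFilter U.

Let mass_ex w : exists l : R, (fun n => J n (ind n w)) @ U --> l.
Proof.
apply: (@bounded_ultra_lim R nat _ U M UU).
apply: (@filterS _ U _ setT) => [n _ /=|]; last exact: filterT.
have h0 : 0 <= J n (ind n w).
  by apply: Rintegral_ge0 => y By; rewrite mulr_ge0 ?k0.
rewrite ger0_norm// -[leRHS]mul1r -(Jcst n); apply: Jle => //; first exact: bmeas_cst.
by move=> y _; have /andP[] := ind01 n w y.
Qed.

Let mass w : R := projT1 (cid (mass_ex w)).
Let massP w : (fun n => J n (ind n w)) @ U --> mass w.
Proof. exact: (projT2 (cid (mass_ex w))). Qed.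

Let mass_ge0 w : 0 <= mass w.
Proof.
apply: (cvgr_to_ge (@massP w)); apply: (@filterS _ U _ setT) => [n _|]; last exact: filterT.
by apply: Rintegral_ge0 => y By; rewrite mulr_ge0 ?k0.
Qed.

Let mass_nil : mass [::] = M.
Proof.
apply: (cvg_unique (@Rhausdorff R) (@massP [::])).
rewrite (_ : (fun n => _) = fun=> M); first exact: cvg_cst.
by apply/funext => n; rewrite /ind /= Jcst mul1r.
Qed.

Let mass_split w : mass w = mass (false :: w) + mass (true :: w).
Proof.
apply: (cvg_unique (@Rhausdorff R) (@massP w)).
rewrite (_ : (fun n => J n (ind n w)) =
  (fun n => J n (ind n (false :: w))) \+ (fun n => J n (ind n (true :: w)))).
  by apply: cvgD; exact: massP.
apply/funext => n /=; rewrite -JD//; congr (J n); apply/funext => y.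
by rewrite !ind_cons /= -mulrDr subrK mulr1.
Qed.

(** Left end of the interval of [w]; the interval of [false :: w] comes before that
    of [true :: w]. *)
Fixpoint left_end (w : seq bool) : R :=
  if w is b :: w' then left_end w' + (if b then mass (false :: w') else 0) else 0.

Fixpoint address (t : R) N : seq bool :=
  if N is N'.+1 then
    let w := address t N' in (left_end w + mass (false :: w) <= t) :: w else [::].

Lemma size_address t N : size (address t N) = N.
Proof. by elim: N => //= N ->. Qed.

Let addressE t w : 0 <= t < M ->
  (address t (size w) == w) = (left_end w <= t < left_end w + mass w).
Proof.
move=> t0M; elim: w => [|b w IH] /=; first by rewrite mass_nil add0r t0M.
rewrite eqseq_cons andbC.
have [ww|ww] := eqVneq (address t (size w)) w.
  rewrite ww /=; move: IH; rewrite ww eqxx => /esym/andP[l1 l2].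
  rewrite mass_split in l2; have := mass_ge0 (false :: w).
  case: b => m0.
    by rewrite eqb_id -addrA l2 andbT.
  by rewrite eqbF_neg -ltNge addr0 l1.
rewrite /=; apply/esym/negP => /andP[l1 l2].
move: IH; rewrite (negbTE ww) => /esym/negP; apply.
rewrite mass_split; have := mass_ge0 (false :: w); have := mass_ge0 (true :: w).
case: b l1 l2; rewrite ?addr0 => l1 l2 h1 h2; apply/andP; split; lra.
Qed.

Let left_bounds w : 0 <= left_end w /\ left_end w + mass w <= M.
Proof.
elim: w => [|b w [l1 l2]] /=; first by rewrite mass_nil add0r.
rewrite mass_split in l2.
have := mass_ge0 (false :: w); have := mass_ge0 (true :: w).
by case: b; rewrite ?addr0 => h1 h2; split; lra.
Qed.

Local Notation TR := (measurableTypeR R).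
Let I : set TR := `[0, M[%classic.
Local Notation leb := (@lebesgue_measure R).
Let mI : measurable I. Proof. exact: (measurable_itv `[0, M[). Qed.
Let lebI : (leb I < +oo)%E.
Proof. by rewrite /I lebesgue_measure_itv /=; case: ifP; rewrite ?ltry. Qed.

Let indw (w : seq bool) (t : TR) : R := (address t (size w) == w)%:R.

Let bindw w : bmeas I (indw w).
Proof.
apply: (@eq_bmeas _ _ _ _ (fun t : TR => \1_(`[left_end w, left_end w + mass w[%classic : set TR) t)).
  move=> t; rewrite /I /= in_itv/= => t0M; rewrite /indw addressE// indicE.
  by congr (nat_of_bool _)%:R; apply/idP/idP; rewrite inE /= in_itv.
split; first by apply: measurable_funTS; apply: measurable_indic; exact: measurable_itv.
by exists 1 => t _; rewrite indicE; case: (_ \in _); rewrite ?normr1 ?normr0.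
Qed.

Let int_indw w : \int[leb]_(t in I) indw w t = mass w.
Proof.
transitivity (\int[leb]_(t in I) \1_(`[left_end w, left_end w + mass w[%classic : set TR) t).
  apply: eq_Rint => t; rewrite /I /= in_itv/= => t0M; rewrite /indw addressE// indicE.
  by congr (nat_of_bool _)%:R; apply/idP/idP; rewrite inE /= in_itv.
rewrite /Rintegral integral_indic//.
rewrite setIidl; last first.
  have [l1 l2] := left_bounds w.
  by move=> t /=; rewrite /I /= !in_itv/= => /andP[]; lra.
transitivity (fine (@lebesgue_measure R `[left_end w, left_end w + mass w[)); first by []. rewrite lebesgue_measure_itv /= lte_fin ltrDl.
case: ifPn => [_|]; first by rewrite -EFinD /= addrC addKr.
by rewrite -leNgt => h /=; apply/eqP; rewrite eq_le mass_ge0 h.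
Qed.

Let decomp N (F : seq bool -> R) (s : seq bool) : size s = N ->
  F s = \sum_(w : N.-tuple bool) F w * (s == w)%:R.
Proof.
move=> sN; have sN' : size s == N by rewrite sN.
rewrite (bigD1 (Tuple sN'))//= eqxx mulr1 big1 ?addr0// => w ws.
suff /negbTE-> : s != w by rewrite mulr0.
by apply: contraNN ws => /eqP sw; apply/eqP/val_inj.
Qed.

Let sum_seq_bmeas d' (S : measurableType d') (A : set S) (mA : measurable A) (E : Type)
  (r : seq E) (f : E -> S -> R) :
  (forall i, bmeas A (f i)) -> bmeas A (fun x => \sum_(i <- r) f i x).
Proof.
move=> bf; elim: r => [|i r IH].
  by apply: (@eq_bmeas _ _ _ _ (fun=> 0)); [move=> x _; rewrite big_nil|exact: bmeas_cst].
apply: (@eq_bmeas _ _ _ _ (fun x => f i x + \sum_(i <- r) f i x)).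
  by move=> x _; rewrite big_cons.
exact: bmeasD.
Qed.

Let bword n N (F : seq bool -> R) : bmeas (B n) (fun y => F (word n y N)).
Proof.
apply: (@eq_bmeas _ _ _ _ (fun y => \sum_(w <- index_enum (N.-tuple bool)) F w * ind n w y)).
  move=> y _; rewrite (@decomp N F _ (size_word n y N)); apply: eq_bigr => w _.
  by rewrite /ind size_tuple.
apply: sum_seq_bmeas => // w; apply: bmeasM => //; exact: bmeas_cst.
Qed.

Let baddress N (F : seq bool -> R) : bmeas I (fun t : TR => F (address t N)).
Proof.
apply: (@eq_bmeas _ _ _ _ (fun t : TR => \sum_(w <- index_enum (N.-tuple bool)) F w * indw w t)).
  move=> t _; rewrite (@decomp N F _ (size_address t N)); apply: eq_bigr => w _.
  by rewrite /indw size_tuple.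
apply: sum_seq_bmeas => // w; apply: bmeasM => //; exact: bmeas_cst.
Qed.

(* A function of the first N bits is a finite combination of indicator functions of
   words, for which this is the definition of [mass]. *)
Let word_cvg N (F : seq bool -> R) :
  (fun n => J n (fun y => F (word n y N))) @ U --> \int[leb]_(t in I) F (address t N).
Proof.
have sumJ n (r : seq (N.-tuple bool)) : J n (fun y => \sum_(w <- r) F w * ind n w y) =
    \sum_(w <- r) F w * J n (ind n w).
  elim: r => [|w r IH].
    rewrite big_nil -[RHS](mul0r M) -(Jcst n).
    by congr (J n); apply/funext => y; rewrite big_nil.
  rewrite big_cons -IH -JZ// -JD; last 2 first.
  - by apply: bmeasM => //; exact: bmeas_cst.
  - by apply: sum_seq_bmeas => // v; apply: bmeasM => //; exact: bmeas_cst.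
  by congr (J n); apply/funext => y; rewrite big_cons.
have sumI (r : seq (N.-tuple bool)) : \int[leb]_(t in I) (\sum_(w <- r) F w * indw w t) =
    \sum_(w <- r) F w * mass w.
  elim: r => [|w r IH].
    rewrite big_nil; under eq_Rintegral do rewrite big_nil.
    by rewrite Rintegral_cst// mul0r.
  rewrite big_cons -IH -int_indw -(Rint_Zl (mu := leb) mI lebI)// -(Rint_D (mu := leb) mI lebI); last 2 first.
  - by apply: bmeasM => //; exact: bmeas_cst.
  - by apply: sum_seq_bmeas => // v; apply: bmeasM => //; exact: bmeas_cst.
  by apply: eq_Rint => t _; rewrite big_cons.
have -> : \int[leb]_(t in I) F (address t N) =
    \sum_(w <- index_enum (N.-tuple bool)) F w * mass w.
  rewrite -sumI; apply: eq_Rint => t _; rewrite (@decomp N F _ (size_address t N)).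
  by apply: eq_bigr => w _; rewrite /indw size_tuple.
have -> : (fun n => J n (fun y => F (word n y N))) =
    (fun n => \sum_(w <- index_enum (N.-tuple bool)) F w * J n (ind n w)).
  apply/funext => n; rewrite -sumJ; congr (J n); apply/funext => y.
  rewrite (@decomp N F _ (size_word n y N)).
  by apply: eq_bigr => w _; rewrite /ind size_tuple.
elim: (index_enum _) => [|w r IH].
  by rewrite big_nil; under eq_fun do rewrite big_nil; exact: cvg_cst.
rewrite big_cons; under eq_fun do rewrite big_cons.
by apply: cvgD => //; apply: cvgM; [exact: cvg_cst|exact: massP].
Qed.

(** The interval of this word contains [t], hence has positive length; so the word
    has positive mass for many [n]. *)
Lemma address_occurs t N : I t -> U [set n | exists2 y, B n y & word n y N = address t N].
Proof.
rewrite /I /= in_itv/= => t0M; set w := address t N.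
have w0 : 0 < mass w.
  have := addressE w t0M; rewrite /w size_address eqxx => /esym/andP[h1 h2].
  by rewrite -(ltrD2l (left_end w)) addr0 (le_lt_trans h1 h2).
have := @massP w => /cvgr_gt/(_ _ w0).
apply: filterS => n h; apply: contrapT => H; move: h.
rewrite [X in 0 < X](_ : _ = 0) ?ltxx//.
rewrite -[RHS](mul0r M) -(Jcst n); apply: eq_Rint => y By.
rewrite /ind; case: eqP => [E|_]; last by rewrite !mul0r.
by exfalso; apply: H; exists y; rewrite // -E /w size_address.
Qed.

(** [h] and [H] are uniformly close to one and the same function of finitely many
    bits. *)
Lemma observable_cvg (h : nat -> T -> R) (H : TR -> R) :
  (forall n, bmeas (B n) (h n)) -> bmeas I H ->
  (forall r : R, 0 < r -> exists N (F : seq bool -> R),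
    (forall n y, B n y -> `|h n y - F (word n y N)| <= r) /\
    (forall t, I t -> `|H t - F (address t N)| <= r)) ->
  (fun n => J n (h n)) @ U --> \int[leb]_(t in I) H t.
Proof.
move=> bh bH happ; apply/cvgrPdist_lt => e e0.
pose r := e / 3 / (M + 1).
have M1 : 0 < M + 1 by rewrite ltr_wpDl.
have r0 : 0 < r by rewrite /r !divr_gt0.
have rM : r * M < e / 3.
  by rewrite /r mulrAC ltr_pdivrMr// ltr_pM2l ?divr_gt0// ltrDl.
have [N [F [hF HF]]] := happ r r0.
have /cvgrPdist_lt/(_ (e / 3)) : (fun n => J n (fun y => F (word n y N))) @ U --> _ := @word_cvg N F.
rewrite divr_gt0// => /(_ isT); apply: filterS => n h1.
have h2 := Jdist (bh n) (bword n N F) (hF n).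
have h3 := Rint_dist (mu := leb) mI lebI bH (baddress N F) HF.
have lI : fine (leb I) = M.
  rewrite /I lebesgue_measure_itv /= lte_fin; case: ifPn => [_|]; first by rewrite /= subr0.
  by rewrite -leNgt => M0'; apply/eqP; rewrite eq_le M0 M0'.
rewrite lI in h3.
rewrite (_ : _ - _ = (\int[leb]_(t in I) H t - \int[leb]_(t in I) F (address t N)) +
  ((\int[leb]_(t in I) F (address t N) - J n (fun y => F (word n y N)))
   + (J n (fun y => F (word n y N)) - J n (h n)))); last by ring.
apply: (le_lt_trans (ler_normD _ _)); rewrite distrC in h2.
have := ler_normD (\int[leb]_(t in I) F (address t N) - J n (fun y => F (word n y N)))
   (J n (fun y => F (word n y N)) - J n (h n)).
move: h1 h2 h3 rM; lra.
Qed.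

Lemma address_coding : exists W : TR -> nat -> seq bool,
  [/\ forall t N, size (W t N) = N, forall t N, behead (W t N.+1) = W t N,
     forall t N, I t -> U [set n | exists2 y, B n y & word n y N = W t N],
     forall N (F : seq bool -> R), bmeas I (fun t : TR => F (W t N)) &
   forall (h : nat -> T -> R) (H : TR -> R),
    (forall n, bmeas (B n) (h n)) -> bmeas I H ->
    (forall r : R, 0 < r -> exists N (F : seq bool -> R),
      (forall n y, B n y -> `|h n y - F (word n y N)| <= r) /\
      (forall t, I t -> `|H t - F (W t N)| <= r)) ->
    (fun n => \int[mu n]_(y in B n) (h n y * k n y)) @ U --> \int[leb]_(t in I) H t].
Proof.
exists address; split; [exact: size_address|by []|exact: address_occurs|exact: baddress|exact: observable_cvg].
Qed.
End skorokhod.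

Section skorokhod_sequences.
Context (R : realType) d (T : measurableType d).
Variables (mu : nat -> {measure set T -> \bar R}) (B : nat -> set T) (k : nat -> T -> R).
Variables (M : R) (Z : nat -> nat -> T -> R) (c : nat -> R).
Hypotheses (mB : forall n, measurable (B n)) (Hmu : forall n, (mu n (B n) < +oo)%E).
Hypotheses (bk : forall n, bmeas (B n) (k n)) (k0 : forall n y, B n y -> 0 <= k n y).
Hypothesis kM : forall n, \int[mu n]_(y in B n) k n y = M.
Hypothesis mZ : forall n j, measurable_fun (B n) (Z n j).
Hypothesis Zc : forall n j y, B n y -> 0 <= Z n j y <= c j.
Local Notation leb := (@lebesgue_measure R).
Local Notation TR := (measurableTypeR R).
Let I : set TR := `[0, M[%classic.

(* The bits compare [Z n j] with the levels [(l + 1) / (q + 1)].  The first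
   [N0 j q] of them determine [Z n j] up to [1 / (q + 1)], through [F j q]. *)
Let bit n i (y : T) : bool :=
  if unpickle i is Some (j, q, l) then l.+1%:R <= Z n j y * (q : nat).+1%:R else false.

Let bbit n i : bmeas (B n) (fun y => (bit n i y)%:R : R).
Proof.
rewrite /bit; case: (unpickle i) => [[[j q] l]|]; last exact: bmeas_cst.
split; last by exists 1 => y _; rewrite normr_nat lern1 leq_b1.
apply: (eq_measurable_fun
  ((\1_(`[(l.+1%:R : R), +oo[%classic) : R -> R) \o (fun y => Z n j y * q.+1%:R))).
  by move=> y _; rewrite /= indicE; congr (nat_of_bool _)%:R;
    apply/idP/idP; rewrite inE /= in_itv/= andbT.
apply: measurableT_comp; first by apply: measurable_indic; exact: measurable_itv.
by apply: measurable_funM => //; exact: measurable_cst.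
Qed.

Let L j q : nat := (Num.trunc (c j * q.+1%:R)).+1.

Let F j q (w : seq bool) : R :=
  \sum_(l < L j q) (nth false (rev w) (pickle (j, q, l : nat)))%:R / q.+1%:R.

Let N0 j q : nat := (\sum_(l < L j q) pickle (j, q, l : nat)).+1.

Let N0_gt j q (l : nat) : (l < L j q)%N -> (pickle (j, q, l) < N0 j q)%N.
Proof.
move=> lL; rewrite /N0 ltnS (bigD1 (Ordinal lL))//=; exact: leq_addr.
Qed.

Let F_word n y j q N : B n y -> (N0 j q <= N)%N ->
  `|Z n j y - F j q (word bit n y N)| <= q.+1%:R^-1.
Proof.
move=> By NN; have /andP[z0 zc] := Zc j By.
have q0 : 0 < q.+1%:R :> R by [].
set a := Num.trunc (Z n j y * q.+1%:R).
have aL : (a < L j q)%N.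
  by rewrite /a /L ltnS le_truncn// ler_wpM2r.
have -> : F j q (word bit n y N) = a%:R / q.+1%:R.
  rewrite /F -mulr_suml; congr (_ / _).
  transitivity (\sum_(l < L j q) ((l < a)%N)%:R : R).
    apply: eq_bigr => l _; rewrite nth_word; last by apply: leq_trans NN; exact: N0_gt.
    rewrite /bit pickleK; congr (nat_of_bool _)%:R.
    by rewrite truncn_gt_nat.
  rewrite -natr_sum; congr _%:R.
  rewrite (eq_bigr (fun l : 'I_(L j q) => if (l < a)%N then 1 else 0)%N); last first.
    by move=> l _; case: ifP.
  rewrite -big_mkcond/= -(big_ord_widen (L j q) (fun=> 1%N) (ltnW aL)).
  by rewrite sum1_card card_ord.
have /andP[h1 h2] : a%:R <= Z n j y * q.+1%:R < a.+1%:R.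
  by apply: truncn_itv; rewrite mulr_ge0.
rewrite ger0_norm; last by rewrite subr_ge0 ler_pdivrMr.
rewrite lerBlDr -[X in _ <= X + _]mul1r -mulrDl ler_pdivlMr//.
by move: h2; rewrite -[a.+1%:R]natr1; lra.
Qed.

(** [G j t] is the limit of [Z _ j] at points whose first bits follow the address of
    [t] for longer and longer.  At each scale [1 / (q + 1)], [G j] and the [Z n j]
    are close to the same function of the first bits, which gives the convergence of
    the integrals and, all functions being bounded, of the integrals of squares. *)
Lemma skorokhod : exists U : set_system nat, exists G : nat -> TR -> R,
  [/\ UltraFilter U, \oo `<=` U,
     forall j, bmeas I (G j),
     forall j, (fun n => \int[mu n]_(y in B n) (Z n j y * k n y)) @ U -->
               \int[leb]_(t in I) G j t /\
       (fun n => \int[mu n]_(y in B n) (Z n j y ^+ 2 * k n y)) @ U -->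
               \int[leb]_(t in I) G j t ^+ 2 &
     forall t, I t -> forall N (r : R), 0 < r ->
       exists2 n, (N <= n)%N & exists2 y, B n y &
         forall j, (j < N)%N -> `|Z n j y - G j t| < r].
Proof.
have [U UU sU] := ultra_infty.
have [W [sizeW behW occW bW obsW]] := address_coding mB Hmu bk k0 kM bbit UU.
have bZ n j : bmeas (B n) (Z n j).
  split=> //; exists (c j) => y /(Zc j)/andP[z0 zc]; by rewrite ger0_norm.
have c0 t : I t -> forall j, 0 <= c j.
  move=> It j; have [n [y By _]] := filter_ex (occW t 0%N It).
  by have /andP[+] := Zc j By; apply: le_trans.
(* a point that shows the first N bits of the address of t *)
have Hpt N t : exists p : nat * T, I t ->
    [/\ (N <= p.1)%N, B p.1 p.2 & word bit p.1 p.2 N = W t N].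
  have [It|] := pselect (I t); last by exists (0%N, point).
  have UN : U [set n | (N <= n)%N] by apply: sU; exists N.
  have [n [/= [y By yW] Nn]] := filter_ex (filterI (occW t N It) UN).
  by exists (n, y).
pose pt N t := projT1 (cid (Hpt N t)).
have ptP N t : I t -> [/\ (N <= (pt N t).1)%N, B (pt N t).1 (pt N t).2 &
    word bit (pt N t).1 (pt N t).2 N = W t N] by exact: (projT2 (cid (Hpt N t))).
have HG j t : exists g : R, I t -> (fun N => Z (pt N t).1 j (pt N t).2) @ U --> g.
  have [It|] := pselect (I t); last by exists 0.
  have [|g gl] := @bounded_ultra_lim R nat (fun N => Z (pt N t).1 j (pt N t).2) U (c j) UU.
    apply: (@filterS _ U _ setT) => [N _ /=|]; last exact: filterT.
    have [_ By _] := ptP N t It.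
    by have /andP[z0 zc] := Zc j By; rewrite ger0_norm.
  by exists g.
pose G j t := projT1 (cid (HG j t)).
have GP j t : I t -> (fun N => Z (pt N t).1 j (pt N t).2) @ U --> G j t.
  exact: (projT2 (cid (HG j t))).
have WF t j q N : (N0 j q <= N)%N -> F j q (W t N) = F j q (W t (N0 j q)).
  move=> NN; apply: eq_bigr => l _; congr ((nat_of_bool _)%:R / _).
  have lN := N0_gt (ltn_ord l); move: (pickle _) lN => i lN.
  elim: N NN => [|N IH]; first by rewrite leqn0 => /eqP ->.
  rewrite leq_eqVlt => /orP[/eqP->//|NN]; rewrite -IH// -(behW t N).
  have : size (W t N.+1) = N.+1 by rewrite sizeW.
  case: (W t N.+1) => //= b w [sw]; rewrite rev_cons nth_rcons size_rev sw.
  by rewrite (leq_trans lN NN).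
have GF j q t : I t -> `|G j t - F j q (W t (N0 j q))| <= q.+1%:R^-1.
  move=> It.
  have h : (fun N => `|Z (pt N t).1 j (pt N t).2 - F j q (W t (N0 j q))|) @ U -->
      `|G j t - F j q (W t (N0 j q))|.
    by apply: cvg_norm; apply: cvgB; [exact: GP|exact: cvg_cst].
  apply: (cvgr_to_le h).
  have UN : U [set N | (N0 j q <= N)%N] by apply: sU; exists (N0 j q).
  apply: filterS UN => N /= NN; have [_ By yW] := ptP N t It.
  by rewrite -(WF _ _ _ N NN) -yW; exact: F_word.
have G01 j t : I t -> 0 <= G j t <= c j.
  move=> It; apply/andP; split.
    apply: (cvgr_to_ge (@GP j t It)); apply: (@filterS _ U _ setT) => [N _ /=|]; last exact: filterT.
    by have [_ By _] := ptP N t It; have /andP[] := Zc j By.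
  apply: (cvgr_to_le (@GP j t It)); apply: (@filterS _ U _ setT) => [N _ /=|]; last exact: filterT.
  by have [_ By _] := ptP N t It; have /andP[] := Zc j By.
have mI : measurable I by exact: (measurable_itv `[0, M[).
have bG j : bmeas I (G j).
  split; last by exists (c j) => t /(G01 j)/andP[g0 gc]; rewrite ger0_norm.
  apply: (@measurable_fun_cvg _ TR R I (fun q t => F j q (W t (N0 j q)))).
    by move=> q; exact: (bW (N0 j q) (F j q)).1.
  move=> t It; apply/cvgrPdist_lt => e e0; near=> q.
  apply: (le_lt_trans (GF j q t It)); near: q.
  exists (Num.trunc e^-1) => // q /= hq.
  rewrite -[e]invrK ltf_pV2 ?posrE ?invr_gt0//.
  by apply: (lt_le_trans (truncnS_gt e^-1)); rewrite ler_nat.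
have small (r : R) : 0 < r -> exists q : nat, q.+1%:R^-1 < r.
  move=> r0; exists (Num.trunc r^-1); rewrite -[ltRHS]invrK ltf_pV2 ?posrE ?invr_gt0//.
  exact: truncnS_gt.
exists U, G; split => //.
- move=> j; split.
    apply: obsW => // r r0; have [q qr] := small r r0.
    exists (N0 j q), (F j q); split => [n y By|t It]; apply: le_trans (ltW qr).
      exact: F_word.
    exact: GF.
  have c1 : 0 < 2 * `|c j| + 1 by rewrite ltr_wpDl// mulr_ge0.
  apply: obsW => [n||r r0].
  + by apply: (eq_bmeas (f := fun y => Z n j y * Z n j y)) => //; exact: bmeasM.
  + by apply: (eq_bmeas (f := fun t => G j t * G j t)) => //; exact: bmeasM.
  have [q qr] := small (r / (2 * `|c j| + 1)) (divr_gt0 r0 c1).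
  have q1 : (q.+1%:R^-1 : R) <= 1 by rewrite invf_le1// ler1n.
  have est (z f : R) : 0 <= z <= c j -> `|z - f| <= q.+1%:R^-1 -> `|z ^+ 2 - f ^+ 2| <= r.
    move=> /andP[z0 zc] zf; rewrite subr_sqr normrM.
    have : `|z + f| <= 2 * `|c j| + 1.
      rewrite (_ : z + f = 2 * z - (z - f)); last by ring.
      apply: (le_trans (ler_normB _ _)); apply: lerD; last exact: le_trans zf q1.
      rewrite ger0_norm ?mulr_ge0// ler_pM2l//.
      exact: le_trans zc (ler_norm _).
    move=> h; apply: (le_trans (ler_pM _ _ zf h)) => //.
    by rewrite -ler_pdivlMr// ltW.
  exists (N0 j q), (fun w => F j q w ^+ 2); split => [n y By|t It].
    by apply: est; [exact: Zc|exact: F_word].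
  by apply: est; [exact: G01|exact: GF].
- move=> t It N r r0; have [q qr] := small (r / 2) (divr_gt0 r0 (ltr0Sn R 1)).
  pose N' := (N + \sum_(j < N) N0 j q)%N.
  have [NN By yW] := ptP N' t It.
  exists (pt N' t).1; first by apply: leq_trans NN; exact: leq_addr.
  exists (pt N' t).2 => // j jN.
  have jN' : (N0 j q <= N')%N.
    apply: leq_trans (leq_addl _ _); rewrite (bigD1 (Ordinal jN))//=; exact: leq_addr.
  have h1 := F_word By jN'; have h2 := GF j q t It.
  rewrite yW WF// in h1; rewrite distrC in h2.
  apply: (le_lt_trans (ler_distD (F j q (W t (N0 j q))) _ _)).
  by rewrite (splitr r); apply: ltrD; [exact: le_lt_trans h1 qr|exact: le_lt_trans h2 qr].
Unshelve. all: by end_near. Qed.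
End skorokhod_sequences.

(** * Harmonic measure and the kernel of one domain *)

Lemma Rint_setI (R : realType) d (T : measurableType d) (mu : {measure set T -> \bar R})
    (A B : set T) (k : T -> R) :
  \int[mu]_(y in A `&` B) k y = \int[mu]_(y in B) (k y * \1_A y).
Proof.
rewrite [LHS]Rint_zext [RHS]Rint_zext; apply: eq_Rint => y _.
have [By|By] := pselect (B y); last by rewrite !zext_out// => -[].
rewrite (zext_in _ By) indicE.
have [Ay|Ay] := pselect (A y); first by rewrite mem_set// mulr1 zext_in.
by rewrite memNset// mulr0 zext_out// => -[].
Qed.

Lemma fubini_cont (R : realType) (X : pmetricType R) d (T : measurableType d)
    (nu : {measure set (borel X) -> \bar R}) (mu : {measure set T -> \bar R})
    (C : set X) (B : set T) (F : X -> T -> R) (M : R) :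
  (nu setT < +oo)%E -> (mu setT < +oo)%E -> compact C -> measurable B ->
  (forall y, B y -> {within C, continuous (F^~ y)}) ->
  (forall z, C z -> measurable_fun B (F z)) ->
  (forall z y, C z -> B y -> `|F z y| <= M) ->
  [/\ \int[nu]_(z in C) \int[mu]_(y in B) F z y = \int[mu]_(y in B) \int[nu]_(z in C) F z y,
     bmeas (C : set (borel X)) (fun z => \int[mu]_(y in B) F z y) &
     bmeas B (fun y => \int[nu]_(z in C) F z y)].
Proof.
move=> fnu fmu cC mB cF mF FM.
have mC : measurable (C : set (borel X)) by apply: borel_compact => //; exact: metric_hausdorff.
have mFF := joint_measurable cC mB cF mF.
split.
- exact: (Rint_fubini fnu fmu mC mB mFF FM).
- exact: (bmeas_inner_snd fnu fmu mC mB mFF FM).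
- exact: (bmeas_inner_fst fnu fmu mC mB mFF FM).
Qed.

Section potential.
Context (R : realType) (X : pmetricType R).
Variables (Dom : set (set X)) (w : set X -> X -> {measure set (borel X) -> \bar R}).
Hypothesis Hframe : framework Dom w.

Lemma closed_boundary (U : set X) : closed (boundary U).
Proof.
rewrite /boundary setDE; apply: closedI; first exact: closed_closure.
by apply: open_closedC; exact: open_interior.
Qed.

Lemma boundary_sub (U : set X) : boundary U `<=` closure U.
Proof. by move=> x []. Qed.

Lemma compact_boundary (U : set X) : compact (closure U) -> compact (boundary U).
Proof.
move=> cU; apply: (subclosed_compact _ cU); [exact: closed_boundary|exact: boundary_sub].
Qed.

Lemma meas_boundary (U : set X) : measurable (boundary U : set (borel X)).
Proof. apply: borel_closed; exact: closed_boundary. Qed.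

Lemma harm_mass U x : Dom U -> U x -> w U x setT = 1%E.
Proof.
move=> DU Ux; have [h _] := framework_harmonic Hframe DU; have [h0 h1] := h x Ux.
have mb := meas_boundary U.
have mc : measurable (~` boundary U : set (borel X)) by exact: measurableC.
rewrite -(setvU (boundary U)) (measureU (w U x) mc mb (setICl _)).
by rewrite -[RHS]add0e; congr (_ + _)%E.
Qed.

Lemma harm_fin U x : Dom U -> U x -> (w U x setT < +oo)%E.
Proof. by move=> DU Ux; rewrite harm_mass// ltry. Qed.

Lemma harm_finB U x : Dom U -> U x -> (w U x (boundary U) < +oo)%E.
Proof.
by move=> DU Ux; have [h _] := framework_harmonic Hframe DU; rewrite (h x Ux).2 ltry.
Qed.

Lemma harm_cst U x c : Dom U -> U x -> \int[w U x]_(y in boundary U) c = c.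
Proof.
move=> DU Ux; rewrite Rintegral_cst; last exact: meas_boundary.
by have [h _] := framework_harmonic Hframe DU; rewrite (h x Ux).2 mulr1.
Qed.

Lemma eq_harmonic_on W (f g : X -> R) : (forall x, W x -> f x = g x) ->
  harmonic_on Dom w W f -> harmonic_on Dom w W g.
Proof.
move=> fg [cf hf]; split; first exact: eq_within_cont cf.
move=> V DV rV [cV VW] x Vx; rewrite -fg; last exact/VW/subset_closure.
rewrite (hf V)//; apply: eq_Rint => y By; apply: fg.
by apply: VW; exact: boundary_sub.
Qed.

Lemma harmonic_onW W W' (f : X -> R) : W' `<=` W ->
  harmonic_on Dom w W f -> harmonic_on Dom w W' f.
Proof.
move=> WW [cf hf]; split; first exact: continuous_subspaceW cf.
move=> V DV rV [cV VW] x Vx; apply: hf => //; split => //; exact: subset_trans VW WW.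
Qed.

Lemma harmonic_bmeas W (V : set X) (f : X -> R) : {within W, continuous f} ->
  compactly_inside V W -> bmeas (boundary V : set (borel X)) (f : borel X -> R).
Proof.
move=> cf [cV VW]; apply: bmeas_within; first exact: metric_hausdorff.
  exact: compact_boundary.
by apply: continuous_subspaceW cf; apply: subset_trans VW; exact: boundary_sub.
Qed.

Lemma harmonic_cst W (c : R) : harmonic_on Dom w W (fun=> c).
Proof.
split; first exact: within_cont_cst.
by move=> V DV rV _ x Vx; rewrite harm_cst.
Qed.

Lemma harmonic_lin W (a b : R) (f g : X -> R) : harmonic_on Dom w W f ->
  harmonic_on Dom w W g -> harmonic_on Dom w W (fun x => a * f x + b * g x).
Proof.
move=> [cf hf] [cg hg]; split.
  by apply: within_contD; apply: within_contM => //; exact: within_cont_cst.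
move=> V DV rV VW x Vx.
have bf := harmonic_bmeas cf VW; have bg := harmonic_bmeas cg VW.
have mV := meas_boundary V; have fV := harm_finB DV Vx.
rewrite (Rint_D mV fV) ?(Rint_Zl mV fV)//; last 2 first.
- by apply: bmeasM => //; exact: bmeas_cst.
- by apply: bmeasM => //; exact: bmeas_cst.
by rewrite -(hf V)// -(hg V).
Qed.

(** The kernel is a density, so that integral identities determine it almost
    everywhere only.  But it is continuous and harmonic measure charges all open
    sets meeting the boundary: by [le_of_density] the identities hold everywhere. *)
Section kernel.
Variables (U : set X) (x0 : X) (k : X -> X -> R).
Hypotheses (DU : Dom U) (rU : regular U (w U)) (Ux0 : U x0).
Hypothesis cU : compact (closure U).
Hypotheses (Hk : relative_kernel U (w U) x0 k) (ck : jointly_continuous U k).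
Local Notation B := (boundary U).
Local Notation mu := (w U x0).

Lemma oU : open U. Proof. by have [] := framework_domain Hframe DU. Qed.

Let hX : hausdorff_space X. Proof. exact: metric_hausdorff. Qed.
Let cB : compact B. Proof. exact: compact_boundary. Qed.
Let mB : measurable (B : set (borel X)). Proof. exact: meas_boundary. Qed.
Let fmu : (mu setT < +oo)%E. Proof. exact: harm_fin. Qed.

(** By regularity the harmonic measure of [V] tends to 1 at a boundary point in [V];
    so it is positive from some point of [U], and from [x0] by absolute continuity. *)
Lemma full_support (V : set X) : open V -> V `&` B !=set0 -> (0 < mu (V `&` B))%E.
Proof.
move=> oV [z [Vz Bz]].
have mV : measurable (V : set (borel X)) by exact: borel_open.
have mVB : measurable (V `&` B : set (borel X)) by exact: measurableI.
have b1 : bounded_borel B (\1_V : X -> R).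
  split; first by apply: measurable_funTS; exact: measurable_indic.
  by exists 1 => y _; rewrite indicE normr_nat lern1 leq_b1.
have h := rU Bz b1.
have {}h : \int[w U x]_(y in B) \1_V y @[x --> within U (nbhs z)] --> (1 : R).
  have := h; rewrite [\1_V z]indicE mem_set//; apply.
  apply: cvg_near_cst; rewrite near_withinE.
  have : \forall y \near z, V y by exact: open_nbhs_nbhs.
  by apply: filterS => y Vy By; rewrite indicE mem_set.
have PF : ProperFilter (within U (nbhs z)).
  apply: Build_ProperFilter_ex => P; rewrite /within /= => nP.
  have [x [Ux Px]] := Bz.1 _ nP.
  by exists x; exact: Px.
have h12 : 1 / 2 < 1 :> R by lra.
have [x [Ux hx]] : exists x, U x /\ 1 / 2 < \int[w U x]_(y in B) \1_V y.
  have nU : within U (nbhs z) U by rewrite /within /=; exact: nearW.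
  have /cvgr_gt/(_ _ h12) h3 := h.
  have [x [h4 h5]] := filter_ex (filterI h3 nU).
  by exists x.
rewrite lt0e measure_ge0 andbT; apply/eqP => mu0.
have [_ ac] := framework_harmonic Hframe DU.
have /null_content_dominatesP/(_ _ mVB mu0) wx0 := ac x x0 Ux Ux0.
move: hx; rewrite /Rintegral integral_indic// wx0 /=; lra.
Qed.

Lemma kernel_cont_snd x : U x -> {within B, continuous (k x)}.
Proof. by move=> Ux; exact: (joint_snd ck Ux). Qed.

Lemma kernel_bmeas x : U x -> bmeas (B : set (borel X)) (k x : borel X -> R).
Proof. by move=> Ux; apply: bmeas_within => //; exact: kernel_cont_snd. Qed.

Lemma kernel_int x f : U x -> bmeas (B : set (borel X)) (f : borel X -> R) ->
  \int[w U x]_(y in B) f y = \int[mu]_(y in B) (k x y * f y).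
Proof.
move=> Ux bf; apply: (Rint_density mB fmu (harm_fin DU Ux) (kernel_bmeas Ux)) => //.
by move=> A mA; exact: Hk.
Qed.

Lemma kernel_set x A : U x -> measurable (A : set (borel X)) ->
  \int[mu]_(y in A `&` B) k x y = fine (w U x A).
Proof. by move=> Ux mA; rewrite (Hk Ux mA). Qed.

Lemma kernel_ge0 x y : U x -> B y -> 0 <= k x y.
Proof.
move=> Ux; apply: (@le_of_density _ _ mu B fmu cB full_support (fun=> 0) (k x)).
- exact: within_cont_cst.
- exact: kernel_cont_snd.
- by move=> A mA; rewrite kernel_set// Rintegral_cst ?mul0r ?fine_ge0//; exact: measurableI.
Qed.

Lemma kernel_base y : B y -> k x0 y = 1.
Proof.
have H A : measurable (A : set (borel X)) ->
    \int[mu]_(y in A `&` B) k x0 y = \int[mu]_(y in A `&` B) 1.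
  move=> mA; rewrite kernel_set// Rintegral_cst ?mul1r; last exact: measurableI.
  have [h _] := framework_harmonic Hframe DU; have [h0 h1] := h x0 Ux0.
  have mC : measurable (~` B : set (borel X)) by exact: measurableC.
  have m1 : measurable (A `&` B : set (borel X)) by exact: measurableI.
  have m2 : measurable (A `&` ~` B : set (borel X)) by exact: measurableI.
  congr fine; rewrite -[in LHS](setIT A) -(setUv B) setIUr (measureU mu m1 m2); last first.
    by apply/seteqP; split => // z [[_ Cz] [_ nCz]]; exact: nCz.
  rewrite [X in (_ + X)%E](_ : _ = 0%E) ?adde0//.
  apply/eqP; rewrite eq_le measure_ge0 andbT -[leRHS]h0.
  by apply: le_measure; rewrite ?inE.
move=> By; apply/eqP; rewrite eq_le; apply/andP; split.
  apply: (@le_of_density _ _ mu B fmu cB full_support (k x0) (fun=> 1)) => //.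
  - exact: kernel_cont_snd.
  - exact: within_cont_cst.
  - by move=> A mA; rewrite H.
apply: (@le_of_density _ _ mu B fmu cB full_support (fun=> 1) (k x0)) => //.
- exact: within_cont_cst.
- exact: kernel_cont_snd.
- by move=> A mA; rewrite H.
Qed.

Lemma kernel_bounded (C : set X) : compact C -> C `<=` U ->
  exists M : R, forall x y, C x -> B y -> `|k x y| <= M.
Proof.
move=> cC CU; have := within_cont_bounded (compact_setX cC cB) (jointW CU ck).
by move=> [M hM]; exists M => x y Cx By; exact: (hM (x, y)).
Qed.

Lemma kernel_fst_cont y : B y -> {within U, continuous (k^~ y)}.
Proof. by move=> By; exact: (joint_fst ck By). Qed.

(** By Fubini and the nesting of harmonic measures, [k x] and the mean of [k z] over
    the boundary of [V] have the same integral over every Borel set. *)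
Lemma kernel_harmonic y : B y -> harmonic_on Dom w U (k^~ y).
Proof.
move=> By; split; first exact: kernel_fst_cont.
move=> V DV rV [cV VU] x Vx.
have Ux : U x by apply: VU; exact: subset_closure.
pose C := boundary V; pose nu := w V x.
have cC : compact C by exact: compact_boundary.
have CU : C `<=` U by apply: subset_trans VU; exact: boundary_sub.
have fnu : (nu setT < +oo)%E by exact: harm_fin.
have [M hM] := kernel_bounded cC CU.
pose k2 y := \int[nu]_(z in C) k z y.
have ck2 : {within B, continuous k2}.
  apply: (@param_continuous _ X nu C fnu cC X B (fun y z => k z y)).
  exact: (joint_swap (F := k) (jointW CU ck)).
have H A : measurable (A : set (borel X)) ->
    \int[mu]_(y in A `&` B) k x y = \int[mu]_(y in A `&` B) k2 y.
  move=> mA; rewrite (Rint_setI mu A B (k x)) (Rint_setI mu A B k2).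
  have b1 : bmeas (B : set (borel X)) (\1_A : borel X -> R).
    split; first by apply: measurable_funTS; exact: measurable_indic.
    by exists 1 => z _; rewrite indicE normr_nat lern1 leq_b1.
  transitivity (\int[w U x]_(y in B) \1_A y); first by rewrite (kernel_int Ux b1).
  rewrite (framework_nested Hframe DU DV rV (conj cV VU) Vx b1).
  transitivity (\int[nu]_(z in C) \int[mu]_(y in B) (k z y * \1_A y)).
    by apply: eq_Rint => z Cz; rewrite kernel_int//; exact: CU.
  have [|||-> _ _] := @fubini_cont R X _ (borel X) nu mu C B (fun z y => k z y * \1_A y) M
    fnu fmu cC mB.
  - move=> z Bz; apply: within_contM; last exact: within_cont_cst.
    by apply: (continuous_subspaceW CU); exact: kernel_fst_cont.
  - by move=> z Cz; apply: measurable_funM; [exact: (kernel_bmeas (CU _ Cz)).1|exact: b1.1].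
  - move=> z y' Cz By'; rewrite normrM -[leRHS]mulr1; apply: ler_pM => //; first exact: hM.
    by rewrite indicE normr_nat lern1 leq_b1.
  apply: eq_Rint => y' By'; rewrite /k2 mulrC.
  rewrite -(Rint_Zl (meas_boundary V) (harm_finB DV Vx)).
    by apply: eq_Rint => z _; rewrite mulrC.
  apply: bmeas_within => //.
  by apply: (continuous_subspaceW CU); exact: kernel_fst_cont.
apply/eqP; rewrite eq_le; apply/andP; split.
  apply: (@le_of_density _ _ mu B fmu cB full_support (k x) k2) => //.
  - exact: kernel_cont_snd.
  - by move=> A mA; rewrite H.
apply: (@le_of_density _ _ mu B fmu cB full_support k2 (k x)) => //.
- exact: kernel_cont_snd.
- by move=> A mA; rewrite H.
Qed.

Lemma mixture_harmonic f : {within B, continuous f} ->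
  harmonic_on Dom w U (fun z => \int[mu]_(y in B) (k z y * f y)).
Proof.
move=> cf; split.
  apply: (@param_continuous _ X mu B fmu cB X U (fun z y => k z y * f y)).
  apply: (@within_contM _ _ _ (fun p => k p.1 p.2) (fun p => f p.2)) => //.
  apply/within_contP => -[z y] [/= Uz By] e e0.
  have /within_contP/(_ y By e e0) h := cf.
  exists (setT, [set y' | B y' -> `|f y' - f y| < e]) => /=.
    by split => //; exact: filterT.
  by move=> [z' y'] [/= _ h'] [_ /= By']; exact: h'.
move=> V DV rV [cV VU] x Vx.
pose C := boundary V; pose nu := w V x.
have cC : compact C by exact: compact_boundary.
have CU : C `<=` U by apply: subset_trans VU; exact: boundary_sub.
have fnu : (nu setT < +oo)%E by exact: harm_fin.
have [M hM] := kernel_bounded cC CU.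
have [bf [N hN]] := bmeas_within hX cB cf.
have [|||-> _ _] := @fubini_cont R X _ (borel X) nu mu C B (fun z y => k z y * f y) (M * N)
    fnu fmu cC mB.
- move=> z Bz; apply: within_contM; last exact: within_cont_cst.
  by apply: (continuous_subspaceW CU); exact: kernel_fst_cont.
- by move=> z Cz; apply: measurable_funM => //; exact: (kernel_bmeas (CU _ Cz)).1.
- by move=> z y' Cz By'; rewrite normrM; apply: ler_pM => //; [exact: hM|exact: hN].
apply: eq_Rint => y' By'.
have [_ /(_ V DV rV (conj cV VU) x Vx) ->] := kernel_harmonic By'.
rewrite mulrC -(Rint_Zl (meas_boundary V) (harm_finB DV Vx)).
  by apply: eq_Rint => z _; rewrite mulrC.
apply: bmeas_within => //.
by apply: (continuous_subspaceW CU); exact: kernel_fst_cont.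
Qed.

Lemma kernel_rep W (u : X -> R) x : harmonic_on Dom w W u -> closure U `<=` W -> U x ->
  u x = \int[mu]_(y in B) (k x y * u y).
Proof.
move=> [cu hu] UW Ux; rewrite (hu U DU rU (conj cU UW) x Ux) kernel_int//.
by apply: harmonic_bmeas cu (conj cU UW).
Qed.
End kernel.
End potential.

(** * Spaces of functions and image measures *)

Lemma filter_all_seq (I : Type) (T : eqType) (F : set_system I) (s : seq T) (P : T -> set I) :
  Filter F -> (forall a, a \in s -> F (P a)) -> F [set i | forall a, a \in s -> P a i].
Proof.
move=> FF; elim: s => [|a s IH] H; first by apply: filterS (@filterT _ F _) => i _ b.
have h1 : F (P a) by apply: H; rewrite inE eqxx.
have h2 : F [set i | forall b, b \in s -> P b i] by apply: IH => b bs; apply: H; rewrite inE bs orbT.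
apply: filterS (filterI h1 h2) => i [Pa Ps] b; rewrite inE => /orP[/eqP->//|]; exact: Ps.
Qed.

Section extension_of_functions.
Context (R : realType) (X : pmetricType R) (A : set X).
Implicit Type g : A -> R.

Lemma ext0_in g x (Ax : A x) : ext0 g x = g (exist _ x (mem_set Ax)).
Proof.
rewrite /ext0 /valL_ /= oinv_set_val (insubT (fun x => x \in A) (mem_set Ax)) /=.
by congr g; exact: val_inj.
Qed.

Lemma ext0_val g (s : A) : ext0 g (val s) = g s.
Proof.
rewrite (ext0_in g (set_valP s)); congr g; exact: val_inj.
Qed.

Lemma ext0_out g x : ~ A x -> ext0 g x = 0.
Proof.
by move=> Ax; rewrite /ext0 /valL_ /= oinv_set_val insubN// memNset.
Qed.
End extension_of_functions.

Lemma hausdorff_of_functions (R : realType) (T : topologicalType) (J : Type) (e : J -> T -> R) :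
  (forall j, continuous (e j)) -> (forall p q, (forall j, e j p = e j q) -> p = q) ->
  hausdorff_space T.
Proof.
move=> ce sep p q pq; apply: sep => j; apply: (@Rhausdorff R) => A Be nA nB.
have [z [Az Bz]] := pq _ _ (ce j p _ nA) (ce j q _ nB).
by exists (e j z).
Qed.

Section topology_of_products.
Context (R : realType) (X : pmetricType R) (D_ : nat -> set X).
Local Notation L := (LL D_).
Local Notation PL := (prod_LL D_).

Lemma ball_LLE m (f g : fun_LL D_ m) (e : R) : ball f e g <-> forall s, `|f s - g s| < e.
Proof. by split. Qed.

Lemma eval_LL_continuous m (s : L m) : continuous (fun f : fun_LL D_ m => (f s : R)).
Proof.
move=> f; apply/(@cvgrPdist_lt _ _ _ (nbhs f) (nbhs_filter f)) => e e0.
apply: (@filterS _ _ (nbhs_filter f) (ball f e)); last exact: nbhsx_ballx.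
by move=> g /ball_LLE.
Qed.

Lemma proj_LL_continuous m : continuous (fun p : PL => p m : fun_LL D_ m).
Proof. exact: (@proj_continuous nat (fun_LL D_) m). Qed.

Lemma eval_prod_continuous m x : continuous (fun p : PL => ext0 (p m) x).
Proof.
have [Lx|Lx] := pselect (L m x); last first.
  rewrite (_ : (fun p : PL => _) = fun=> 0); first exact: cst_continuous.
  by apply/funext => p; rewrite ext0_out.
rewrite (_ : (fun p : PL => _) = (fun f : fun_LL D_ m => f (exist _ x (mem_set Lx)) : R) \o (fun p => p m)).
  by move=> p; apply: continuous_comp; [exact: proj_LL_continuous|exact: eval_LL_continuous].
by apply/funext => p; rewrite ext0_in.
Qed.

Lemma prod_LL_hausdorff : hausdorff_space PL.
Proof.
apply: (@hausdorff_of_functions R PL (nat * X) (fun mx p => ext0 (p mx.1) mx.2)).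
  by move=> mx; exact: eval_prod_continuous.
move=> p q pq; apply: functional_extensionality_dep => m; apply/funext => s.
by have := pq (m, val s); rewrite /= !ext0_val.
Qed.
End topology_of_products.

Section image_measures.
Context d1 d2 (T1 : measurableType d1) (T2 : measurableType d2) (R : realType).
Variables (m : {measure set T1 -> \bar R}) (f : T1 -> T2).
Hypotheses (mf : measurable_fun setT f).

Definition image_measure of measurable_fun setT f : set T2 -> \bar R := pushforward m f.

Let image0 : image_measure mf set0 = 0%E. Proof. exact: measure0. Qed.
Let image_ge0 A : (0 <= image_measure mf A)%E. Proof. exact: measure_ge0. Qed.
Let image_additive : semi_sigma_additive (image_measure mf).
Proof. exact: measure_semi_sigma_additive. Qed.
HB.instance Definition _ := isMeasure.Build _ _ _ (image_measure mf) image0 image_ge0 image_additive.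

Lemma integral_image (C : set T2) (h : T2 -> R) : (m setT < +oo)%E -> measurable C -> bmeas C h ->
  (\int[pushforward m f]_(q in C) (h q)%:E)%E = (\int[m]_(t in f @^-1` C) h (f t))%:E.
Proof.
move=> mfin mC bh.
have bhC : bmeas setT (zext C h) by exact: bmeas_zext.
have bhf : bmeas setT (zext C h \o f).
  case: bhC => mh [M hM]; split; first exact: measurableT_comp.
  by exists M => y _; exact: hM.
rewrite integral_mkcond.
have -> : (fun p => (h p)%:E) \_ C = EFin \o zext C h by rewrite EFin_zext.
rewrite integral_pushforward//; last 2 first.
- by apply/measurable_EFinP; exact: bhC.1.
- exact: (bmeas_integrable measurableT mfin bhf).
rewrite preimage_setT.
transitivity ((\int[m]_(y in setT) (zext C h \o f) y)%:E); first by rewrite -Rint_EFin.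
congr EFin; rewrite [RHS]Rint_zext; apply: eq_Rint => y _ /=.
by have [Cy|Cy] := pselect (C (f y)); [rewrite !zext_in|rewrite !zext_out].
Qed.
End image_measures.

Lemma within_cont_comp (R : realType) (T1 T2 : topologicalType) (A : set T1) (B : set T2)
    (q : T1 -> T2) (f : T2 -> R) : {within A, continuous q} -> (forall s, A s -> B (q s)) ->
  {within B, continuous f} -> {within A, continuous (fun s => f (q s))}.
Proof.
move=> cq qAB /within_contP cf; apply/within_contP => s As e e0.
move/subspace_continuousP/(_ s As): cq => cq.
have h := cq _ (cf _ (qAB s As) e e0).
apply: (@filterS _ (nbhs s) _ _ _ _ h) => t /= ht At; apply: (ht At); exact: qAB.
Qed.

Lemma bmeas_sub d (T : measurableType d) (R : realType) (A B : set T) (f : T -> R) :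
  measurable A -> B `<=` A -> bmeas A f -> bmeas B f.
Proof.
move=> mA BA [mf [M hM]]; split; first exact: measurable_funS mf.
by exists M => y /BA; exact: hM.
Qed.

Section coordinate_continuity.
Context (R : realType) (T : ptopologicalType).
Variables (C : set T) (e : nat -> T -> R) (f : T -> R).
Hypotheses (cC : compact C) (ce : forall j, {within C, continuous (e j)}).
Hypothesis sep : forall p q, C p -> C q -> (forall j, e j p = e j q) -> p = q.
Hypothesis cf : {within C, continuous f}.

Lemma coord_modulus q (r : R) : C q -> 0 < r -> exists N, exists2 d : R, 0 < d &
  forall p, C p -> (forall j, (j < N)%N -> `|e j p - e j q| < d) -> `|f p - f q| < r.
Proof.
move=> Cq r0; have /within_contP/(_ q Cq r r0) := cf.
rewrite /prop_near1 nbhsE => -[V [oV Vq] VC].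
have [N [d d0 H]] := coord_nbhs cC ce sep oV Cq Vq.
by exists N, d => // p Cp pq; apply: VC => //; exact: H.
Qed.

End coordinate_continuity.

Lemma coord_within_continuous (R : realType) (T : ptopologicalType) (C : set T) (e : nat -> T -> R)
    (S : topologicalType) (A : set S) (q : S -> T) :
  compact C -> (forall j, {within C, continuous (e j)}) ->
  (forall p q, C p -> C q -> (forall j, e j p = e j q) -> p = q) ->
  (forall s, A s -> C (q s)) -> (forall j, {within A, continuous (fun s => e j (q s))}) ->
  {within A, continuous q}.
Proof.
move=> cC ce sep qAC ceq; apply/subspace_continuousP => s As W.
rewrite nbhsE => -[V [oV Vs] VW].
have [N [d d0 H]] := coord_nbhs cC ce sep oV (qAC s As) Vs.
have h : \forall s' \near s, forall j, (j < N)%N -> A s' -> `|e j (q s') - e j (q s)| < d.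
  elim: N {H} => [|N IH]; first exact: nearW.
  have /within_contP/(_ s As d d0) hN := ceq N.
  apply: filterS2 IH hN => s' h1 h2 j; rewrite ltnS leq_eqVlt => /orP[/eqP->//|jN].
  exact: h1.
apply: (@filterS _ (nbhs s) _ _ _ _ h) => s' hs' As'; apply: VW; apply: H; first exact: qAC.
by move=> j jN; exact: hs'.
Qed.

Lemma Rint_sum d (T : measurableType d) (R : realType) (mu : {measure set T -> \bar R})
    (B : set T) (h : nat -> T -> R) N :
  measurable B -> (mu B < +oo)%E -> (forall j, bmeas B (h j)) ->
  bmeas B (fun y => \sum_(j < N) h j y) /\
  \int[mu]_(y in B) (\sum_(j < N) h j y) = \sum_(j < N) \int[mu]_(y in B) h j y.
Proof.
move=> mB fB bh; elim: N => [|N [b IH]].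
  have b0 : bmeas B (fun y => \sum_(j < 0) h j y).
    apply: (@eq_bmeas _ T R B (fun=> 0)); last exact: bmeas_cst.
    by move=> y _; rewrite big_ord0.
  split => //; rewrite big_ord0 (_ : \int[mu]_(y in B) _ = \int[mu]_(y in B) 0).
    by rewrite Rintegral_cst// mul0r.
  by apply: eq_Rint => y _; rewrite big_ord0.
have E y : \sum_(j < N) h j y + h N y = \sum_(j < N.+1) h j y by rewrite big_ord_recr.
split; first by apply: (@eq_bmeas _ T R B _ _ _ (bmeasD b (bh N))) => y _; rewrite E.
rewrite big_ord_recr/= -IH -Rint_D//; apply: eq_Rint => y _; by rewrite E.
Qed.

Lemma Rint_carried d (T : measurableType d) (R : realType) (mu : {measure set T -> \bar R})
    (A E : set T) (f : T -> R) :
  (mu setT < +oo)%E -> measurable A -> measurable E -> E `<=` A -> mu (~` E) = 0%E ->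
  bmeas A f -> \int[mu]_(x in A) f x = \int[mu]_(x in E) f x.
Proof.
move=> mfin mA mE EA muE bf.
have AE : mu (A `&` ~` E) = 0%E.
  apply: (subset_measure0 _ _ _ muE); [|exact: measurableC|by move=> g []].
  by apply: measurableI => //; exact: measurableC.
have muA : (mu A < +oo)%E by exact: (sub_finite mfin).
rewrite /Rintegral; congr fine.
rewrite (@negligible_integral _ _ _ mu A (A `&` ~` E)) //.
- congr (integral _ _ _); apply/seteqP; split => g; last by move=> Eg; split; [exact: EA|case].
  by case=> Ag nE; apply: contrapT => Eg; apply: nE.
- by apply: measurableI => //; exact: measurableC.
- exact: (bmeas_integrable mA muA bf).
Qed.

(** * The exhausted domain *)

Section exhaustion.
Context (R : realType) (X : pmetricType R).
Variables (Dom : set (set X)) (w : set X -> X -> {measure set (borel X) -> \bar R}).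
Variables (D : set X) (x0 : X) (D_ : nat -> set X) (K : nat -> X -> X -> R).
Hypotheses (Hframe : framework Dom w) (HDom : forall n, Dom (D_ n))
    (Hreg : forall n, regular (D_ n) (w (D_ n)))
    (Hx0 : D_ 0%N x0)
    (Hnest : forall n, compactly_inside (D_ n) (D_ n.+1))
    (Hunion : D = \bigcup_n D_ n)
    (HK : forall n, relative_kernel (D_ n) (w (D_ n)) x0 (K n))
    (HKc : forall n, jointly_continuous (D_ n) (K n)).
Local Notation L := (LL D_).
Local Notation B := (bnd D_).
Local Notation mu n := (w (D_ n) x0).
Local Notation Om := (omega_mod D_ K).
Local Notation PL := (prod_LL D_).
Local Notation P := (Pset Dom w x0 D_ K).
Local Notation FS := (fun_space D).
Local Notation H := (H1 Dom w D x0).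
Local Notation E := (minimal_boundary Dom w D x0).
Local Notation res := (restrict_LL D_ (D := D)).
Local Notation Tm := (@Tmap R X D_ K).

Lemma exh_open n : open (D_ n). Proof. exact: (oU Hframe). Qed.

Lemma exh_LD m n : (m < n)%N -> L m `<=` D_ n.
Proof.
elim: n => // n IH; rewrite ltnS leq_eqVlt => /orP[/eqP->|mn]; first exact: (Hnest n).2.
by move=> x /(IH mn) Dx; apply: (Hnest n).2; exact: subset_closure.
Qed.

Lemma exh_DL n : D_ n `<=` L n. Proof. exact: subset_closure. Qed.

Lemma exh_mono m n : (m <= n)%N -> D_ m `<=` D_ n.
Proof.
rewrite leq_eqVlt => /orP[/eqP->//|mn]; apply: subset_trans (exh_LD mn); exact: exh_DL.
Qed.

Lemma exh_Lmono m n : (m <= n)%N -> L m `<=` L n.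
Proof. by move=> mn; apply: closureS; exact: exh_mono. Qed.

Lemma exh_D n : D_ n `<=` D. Proof. by rewrite Hunion => x Dx; exists n. Qed.

Lemma exh_LinD n : L n `<=` D.
Proof. by apply: subset_trans (@exh_D n.+1); exact: exh_LD. Qed.

Lemma exh_x0 n : D_ n x0. Proof. exact: exh_mono Hx0. Qed.

Lemma exh_cL n : compact (L n). Proof. exact: (Hnest n).1. Qed.

Lemma exh_BL n : B n `<=` L n. Proof. exact: boundary_sub. Qed.

Lemma exh_BD n : B n `<=` D. Proof. by apply: subset_trans (@exh_LinD n); exact: exh_BL. Qed.

Lemma exh_cB n : compact (B n). Proof. by apply: compact_boundary; exact: exh_cL. Qed.

Lemma exh_mB n : measurable (B n : set (borel X)). Proof. exact: meas_boundary. Qed.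

Lemma exh_fin n : (mu n setT < +oo)%E.
Proof. by apply: (harm_fin Hframe) => //; exact: exh_x0. Qed.

Lemma exh_finB n : (mu n (B n) < +oo)%E.
Proof. by apply: (harm_finB Hframe) => //; exact: exh_x0. Qed.

Lemma exh_bmeas n f : {within B n, continuous f} -> bmeas (B n : set (borel X)) (f : borel X -> R).
Proof. by apply: bmeas_within; [exact: metric_hausdorff|exact: exh_cB]. Qed.

Lemma exh_BnotD m n : (m <= n)%N -> forall y, B n y -> ~ D_ m y.
Proof.
move=> mn y [_ ny] Dy; apply: ny.
by apply: open_nbhs_nbhs; split; [exact: exh_open|exact: (exh_mono mn)].
Qed.

Lemma exh_compact C : compact C -> C `<=` D -> exists m, C `<=` D_ m.
Proof.
move=> cC CD.
have Hi a : exists i, C a -> D_ i a.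
  have [Ca|] := pselect (C a); last by exists 0%N.
  by have := CD a Ca; rewrite Hunion => -[i _ Da]; exists i.
pose i a := projT1 (cid (Hi a)).
have iP a : C a -> D_ (i a) a by exact: (projT2 (cid (Hi a))).
have [|s [sC sU]] := @finite_subcover X C (fun a => D_ (i a)) cC.
  by move=> a Ca; split; [exact: exh_open|exact: iP].
exists (\sum_(a <- s) i a)%N => x /sU[a as_ Dx]; apply: exh_mono Dx.
by rewrite (big_rem a)//=; exact: leq_addr.
Qed.

Lemma Kge0 n x y : D_ n x -> B n y -> 0 <= K n x y.
Proof.
by apply: (kernel_ge0 Hframe) => //; first [exact: exh_x0|exact: exh_cL|exact: HK|exact: HKc].
Qed.

Lemma Kbase n y : B n y -> K n x0 y = 1.
Proof.
by apply: (kernel_base Hframe) => //; first [exact: exh_x0|exact: exh_cL|exact: HK|exact: HKc].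
Qed.

Lemma Kharm n y : B n y -> harmonic_on Dom w (D_ n) (K n ^~ y).
Proof.
by apply: (kernel_harmonic Hframe) => //; first [exact: exh_x0|exact: exh_cL|exact: HK|exact: HKc].
Qed.

Lemma Kmix n f : {within B n, continuous f} ->
  harmonic_on Dom w (D_ n) (fun z => \int[mu n]_(y in B n) (K n z y * f y)).
Proof.
by apply: (mixture_harmonic Hframe) => //; first [exact: exh_x0|exact: exh_cL|exact: HK|exact: HKc].
Qed.

Lemma Krep n W u x : harmonic_on Dom w W u -> L n `<=` W -> D_ n x ->
  u x = \int[mu n]_(y in B n) (K n x y * u y).
Proof.
by apply: (kernel_rep Hframe) => //; first [exact: exh_x0|exact: exh_cL|exact: HK|exact: HKc].
Qed.

Lemma Kcont n x : D_ n x -> {within B n, continuous (K n x)}.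
Proof. by move=> Dx; exact: (joint_snd (@HKc n) Dx). Qed.

Lemma Kbounded m n : (m < n)%N -> exists M : R, forall x y, L m x -> B n y -> `|K n x y| <= M.
Proof. by move=> mn; exact: (kernel_bounded (@exh_cL n) (@HKc n) (@exh_cL m) (exh_LD mn)). Qed.

Lemma mean_value n W u : harmonic_on Dom w W u -> L n `<=` W ->
  u x0 = \int[mu n]_(y in B n) u y.
Proof.
move=> hu LW; rewrite (Krep hu LW (exh_x0 n)); apply: eq_Rint => y By.
by rewrite Kbase// mul1r.
Qed.

(** If [h x = 0], then [h] vanishes almost everywhere on some boundary for the
    harmonic measure from [x], hence from [x0], and [h x0 = 0]. *)
Lemma harm_pos (h : X -> R) : harmonic_on Dom w D h -> (forall x, D x -> 0 <= h x) ->
  h x0 = 1 -> forall x, D x -> 0 < h x.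
Proof.
move=> hh h0 h1 x Dx; rewrite lt_def h0// andbT; apply/eqP => hx.
move: Dx; rewrite Hunion => -[m _ Dmx].
have [_ /(_ (D_ m) (HDom m) (@Hreg m))] := hh.
have inD : compactly_inside (D_ m) D by split; [exact: exh_cL|exact: exh_LinD].
move=> /(_ inD) rep.
have bh : bmeas (B m : set (borel X)) (h : borel X -> R).
  by apply: exh_bmeas; apply: continuous_subspaceW hh.1; exact: exh_BD.
have ae z : D_ m z -> h z = 0 <-> ae_eq (w (D_ m) z) (B m) (EFin \o h) (cst 0%E).
  move=> Dz.
  have mh : measurable_fun (B m : set (borel X)) (EFin \o h : borel X -> \bar R).
    by apply/measurable_EFinP; exact: bh.1.
  have := ae_eq_integral_abs (w (D_ m) z) (exh_mB m) mh.
  have -> : (\int[w (D_ m) z]_(y in B m) `|(EFin \o h) y| =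
            (\int[w (D_ m) z]_(y in B m) h y)%:E)%E.
    rewrite -(Rint_EFin (exh_mB m) (harm_finB Hframe (HDom m) Dz) bh).
    apply: eq_integral => y /[!inE] By; rewrite /= ger0_norm//; apply: h0; exact: exh_BD By.
  rewrite -[\int[_]_(_ in _) _](rep z Dz) => <-.
  by split => [->//|[]].
have /(ae x Dmx) aex := hx.
have [_ ac] := framework_harmonic Hframe (HDom m).
have : h x0 = 0.
  apply/(ae x0 (exh_x0 m)).
  apply: (null_dominates_ae_eq (exh_mB m) _ aex).
  by apply: ac => //; exact: exh_x0.
by rewrite h1 => /eqP; rewrite oner_eq0.
Qed.

Lemma Om_ge m s t z : L m s -> L m t -> B m.+1 z -> `|K m.+1 s z - K m.+1 t z| <= Om m s t.
Proof.
move=> Ls Lt Bz; apply: ub_le_sup; last by exists z.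
have [M hM] := @Kbounded m m.+1 (ltnSn m).
exists (M + M) => _ [z' Bz' <-]; apply: (le_trans (ler_normB _ _)).
by apply: lerD; exact: hM.
Qed.

Lemma Om_cont m a e : L m a -> 0 < e -> \forall t \near a, L m t -> Om m t a < e.
Proof.
move=> La e0; have e2 : 0 < e / 2 by rewrite divr_gt0.
have Da : D_ m.+1 a by exact: (exh_LD (ltnSn m)).
have := tube (@exh_cB m.+1) (@HKc m.+1) Da e2.
apply: filterS => t h Lt; apply: (@le_lt_trans _ _ (e / 2)); last by rewrite ltr_pdivrMr// ltr_pMr// ltr1n.
have [z0 Bz0] := framework_boundary Hframe (HDom m.+1).
apply: ge_sup; first by exists `|K m.+1 t z0 - K m.+1 a z0|, z0.
by move=> _ [z Bz <-]; apply: ltW; apply: h => //; exact: (exh_LD (ltnSn m)).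
Qed.

Lemma amin_le m s z : L m s -> B m.+1 z -> amin D_ K m <= K m.+1 s z.
Proof.
move=> Ls Bz; apply: ge_inf; last by exists (s, z).
have [M hM] := @Kbounded m m.+1 (ltnSn m).
exists (- M) => _ [[s' z'] [/= Ls' Bz'] <-].
by have := hM _ _ Ls' Bz'; rewrite ler_norml => /andP[].
Qed.

Lemma bmax_ge m s z : L m s -> B m.+1 z -> K m.+1 s z <= bmax D_ K m.
Proof.
move=> Ls Bz; apply: ub_le_sup; last by exists (s, z).
have [M hM] := @Kbounded m m.+1 (ltnSn m).
exists M => _ [[s' z'] [/= Ls' Bz'] <-].
by have := hM _ _ Ls' Bz'; rewrite ler_norml => /andP[].
Qed.

(** The bounds at one level in the definition of [Qset].  They are common to all
    normalized positive harmonic functions and make them equicontinuous. *)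
Definition harnack_bounds m (g : X -> R) := forall s t, L m s -> L m t ->
  [/\ amin D_ K m <= g s, g s <= bmax D_ K m & `|g s - g t| <= Om m s t].

(** [g] is an average of the kernels of level [m + 1], with weight [g y] at [y] and
    total weight [g x0 = 1]. *)
Lemma harmonic_bounds m W g : harmonic_on Dom w W g -> L m.+1 `<=` W ->
  (forall y, B m.+1 y -> 0 <= g y) -> g x0 = 1 -> harnack_bounds m g.
Proof.
move=> hg LW g0 g1 s t Ls Lt.
have mB := exh_mB m.+1; have fB := exh_finB m.+1.
have Ds : D_ m.+1 s by exact: (exh_LD (ltnSn m)).
have Dt : D_ m.+1 t by exact: (exh_LD (ltnSn m)).
have bg : bmeas (B m.+1 : set (borel X)) (g : borel X -> R).
  apply: exh_bmeas; apply: continuous_subspaceW hg.1.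
  by apply: subset_trans LW; exact: exh_BL.
have bKs := exh_bmeas (Kcont Ds); have bKt := exh_bmeas (Kcont Dt).
have int1 : \int[mu m.+1]_(y in B m.+1) g y = 1 by rewrite -(mean_value hg LW).
have bcst c : bmeas (B m.+1 : set (borel X)) (fun y => c * g y).
  by apply: bmeasM => //; exact: bmeas_cst.
rewrite !(Krep hg LW)//; split.
- rewrite -[leLHS]mulr1 -int1 -(Rint_Zl mB fB)//; apply: (le_Rint mB fB) => //.
    exact: bmeasM.
  by move=> y By; rewrite ler_wpM2r ?g0//; exact: amin_le.
- rewrite -[leRHS]mulr1 -int1 -(Rint_Zl mB fB)//; apply: (le_Rint mB fB) => //.
    exact: bmeasM.
  by move=> y By; rewrite ler_wpM2r ?g0//; exact: bmax_ge.
- rewrite -(Rint_B mB fB); [|exact: bmeasM|exact: bmeasM].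
  apply: (le_trans (Rint_norm mB fB _)); first by apply: bmeasB; exact: bmeasM.
  rewrite -[leRHS]mulr1 -int1 -(Rint_Zl mB fB)//; apply: (le_Rint mB fB) => //.
    by apply: bmeas_norm; apply: bmeasB; exact: bmeasM.
  move=> y By; rewrite -mulrBl normrM (ger0_norm (g0 _ By)) ler_wpM2r ?g0//.
  exact: Om_ge.
Qed.

Lemma net_ex m e : 0 < e -> exists s : seq X, (forall a, a \in s -> L m a) /\
  forall t, L m t -> exists2 a, a \in s & Om m t a < e.
Proof.
move=> e0.
have [|s [sL sU]] := @finite_subcover X (L m) (fun a => [set t | L m t -> Om m t a < e]°) (@exh_cL m).
  by move=> a La; split; [exact: open_interior|exact: Om_cont].
exists s; split => // t Lt; have [a as_ ta] := sU t Lt.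
by exists a => //; exact: (interior_subset ta).
Qed.

Lemma Om_within m (h : X -> R) : (forall s t, L m s -> L m t -> `|h s - h t| <= Om m s t) ->
  {within L m, continuous h}.
Proof.
move=> H; apply/within_contP => x Lx e e0; have := Om_cont Lx e0.
by apply: filterS => y h1 Ly; apply: le_lt_trans (h1 Ly); exact: H.
Qed.

Lemma within_exh (h : X -> R) : (forall m, {within L m, continuous h}) -> {within D, continuous h}.
Proof.
move=> H; apply/within_contP => x; rewrite {1}Hunion => -[m _ Dx] e e0.
have /within_contP/(_ x (exh_DL Dx) e e0) h1 := H m.
have : \forall y \near x, D_ m y by apply: open_nbhs_nbhs; split => //; exact: exh_open.
by apply: filterS2 h1 => y h2 Dy _; apply: h2; exact: exh_DL.
Qed.

Lemma harmonic_exh (h : X -> R) : {within D, continuous h} ->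
  (forall m, harmonic_on Dom w (D_ m) h) -> harmonic_on Dom w D h.
Proof.
move=> ch H; split => // V DV rV [cV VD].
have [m Vm] := exh_compact cV VD.
by have [_ h2] := H m; apply: h2.
Qed.

Section limits.
Context (I : Type) (F : set_system I) (PF : ProperFilter F).
Variables (g : I -> X -> R) (h : X -> R).

Lemma limit_modulus m : (forall s, L m s -> (fun i => g i s) @ F --> h s) ->
  F [set i | forall s t, L m s -> L m t -> `|g i s - g i t| <= Om m s t] ->
  forall s t, L m s -> L m t -> `|h s - h t| <= Om m s t.
Proof.
move=> gh FO s t Ls Lt.
have c : (fun i => `|g i s - g i t|) @ F --> `|h s - h t|.
  by apply: cvg_norm; apply: cvgB; exact: gh.
by apply: (cvgr_to_le c); apply: filterS FO => i /= hi; exact: hi.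
Qed.

(** By equicontinuity, convergence on a finite net is enough. *)
Lemma limit_uniform m : (forall s, L m s -> (fun i => g i s) @ F --> h s) ->
  F [set i | forall s t, L m s -> L m t -> `|g i s - g i t| <= Om m s t] ->
  forall e, 0 < e -> F [set i | forall s, L m s -> `|g i s - h s| < e].
Proof.
move=> gh FO e e0; have hO := limit_modulus gh FO.
have e3 : 0 < e / 3 by rewrite divr_gt0.
have [s [sL sU]] := net_ex m e3.
have Fs : F [set i | forall a, a \in s -> `|g i a - h a| < e / 3].
  apply: filter_all_seq => a /sL La; have /cvgrPdist_lt/(_ _ e3) := gh a La.
  by apply: filterS => i; rewrite distrC.
apply: filterS (filterI FO Fs) => i [gO gs] t Lt.
have [a as_ ta] := sU t Lt; have La := sL a as_.
have h1 := gO t a Lt La; have h2 := gs a as_; have h3 := hO t a Lt La.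
rewrite (_ : g i t - h t = (g i t - g i a) + ((g i a - h a) - (h t - h a))); last by ring.
apply: (le_lt_trans (ler_normD _ _)).
have := ler_normB (g i a - h a) (h t - h a).
by move: h1 h2 h3 ta; lra.
Qed.

Lemma limit_harmonic m : (forall s, L m s -> (fun i => g i s) @ F --> h s) ->
  F [set i | forall s t, L m s -> L m t -> `|g i s - g i t| <= Om m s t] ->
  F [set i | harmonic_on Dom w (D_ m) (g i)] -> harmonic_on Dom w (D_ m) h.
Proof.
move=> gh FO Fh.
have cL := Om_within (limit_modulus gh FO).
have ch : {within D_ m, continuous h} by apply: continuous_subspaceW cL; exact: exh_DL.
split => // V DV rV VD x Vx; have [cV VD'] := VD.
have Dx : D_ m x by apply: VD'; exact: subset_closure.
have bh := harmonic_bmeas ch VD.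
apply/eqP; rewrite -subr_eq0 -normr_le0; apply/ler_addgt0Pr => e e0; rewrite add0r.
have e2 : 0 < e / 2 by rewrite divr_gt0.
have [i [/= hi ui]] := filter_ex (filterI Fh (limit_uniform gh FO e2)).
have [ci /(_ V DV rV VD x Vx) ri] := hi.
have bi := harmonic_bmeas ci VD.
have h1 := ltW (ui x (exh_DL Dx)).
have h2 : `|\int[w V x]_(y in boundary V) g i y - \int[w V x]_(y in boundary V) h y| <= e / 2.
  have [hm _] := framework_harmonic Hframe DV.
  have := Rint_dist (meas_boundary V) (harm_finB Hframe DV Vx) bi bh (e := e / 2).
  rewrite (hm x Vx).2 mulr1; apply => y By.
  by apply/ltW/ui/exh_DL/VD'; exact: boundary_sub.
rewrite -ri in h2.
rewrite (_ : _ - _ = (g i x - \int[w V x]_(y in boundary V) h y) - (g i x - h x)); last by ring.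
apply: (le_trans (ler_normB _ _)); rewrite [leRHS]splitr; exact: lerD.
Qed.
End limits.

Definition net m k : seq X := projT1 (cid (@net_ex m k.+1%:R^-1 (ltac:(by rewrite invr_gt0)))).

Lemma netP m k : (forall a, a \in net m k -> L m a) /\
  forall t, L m t -> exists2 a, a \in net m k & Om m t a < k.+1%:R^-1.
Proof. exact: (projT2 (cid (net_ex _ _))). Qed.

(** Enumerates finite nets of all the sets [L m] at all scales, measured by [Om m]. *)
Definition dseq (j : nat) : X :=
  if unpickle j is Some (m, k, i) then nth x0 (net m k) i else x0.

Lemma dseq_ex j : exists m, L m (dseq j).
Proof.
rewrite /dseq; case: (unpickle j) => [[[m k] i]|]; last by exists 0%N; exact: exh_DL.
have [iN|iN] := ltnP i (size (net m k)); first by exists m; apply: (netP m k).1; exact: mem_nth.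
by exists 0%N; rewrite nth_default//; exact: exh_DL.
Qed.

(** All domains after this level contain [dseq j]. *)
Definition lev j : nat := projT1 (cid (dseq_ex j)).

Lemma dseqL j : L (lev j) (dseq j). Proof. exact: (projT2 (cid (dseq_ex j))). Qed.

Lemma dseqD j : D (dseq j). Proof. exact: (exh_LinD (@dseqL j)). Qed.

Lemma dseq_dense m e t : L m t -> 0 < e -> exists j, L m (dseq j) /\ Om m t (dseq j) < e.
Proof.
move=> Lt e0; pose k := Num.trunc e^-1.
have [a ak ta] := (netP m k).2 t Lt.
exists (pickle (m, k, index a (net m k))).
rewrite /dseq pickleK nth_index//; split; first exact: (netP m k).1 ak.
apply: (lt_le_trans ta); rewrite -[leRHS]invrK lef_pV2 ?posrE ?invr_gt0//.
by apply: ltW; exact: truncnS_gt.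
Qed.

Lemma dseq_sep m (g h : X -> R) : (forall s t, L m s -> L m t -> `|g s - g t| <= Om m s t) ->
  (forall s t, L m s -> L m t -> `|h s - h t| <= Om m s t) ->
  (forall j, L m (dseq j) -> g (dseq j) = h (dseq j)) -> forall s, L m s -> g s = h s.
Proof.
move=> gO hO gh s Ls; apply/eqP; rewrite -subr_eq0 -normr_le0; apply/ler_addgt0Pr => e e0.
rewrite add0r; have [j [Lj sj]] := dseq_dense Ls (divr_gt0 e0 (ltr0Sn R 1)).
rewrite (_ : g s - h s = (g s - g (dseq j)) - (h s - h (dseq j))); last by rewrite gh//; ring.
apply: (le_trans (ler_normB _ _)); rewrite [leRHS]splitr; apply: lerD.
  by apply: le_trans (ltW sj); exact: gO.
by apply: le_trans (ltW sj); exact: hO.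
Qed.

Local Notation xs := dseq.
Local Notation lv := lev.

Let LD n : L n `<=` D. Proof. exact: exh_LinD. Qed.
Let DL n : D_ n `<=` L n. Proof. exact: exh_DL. Qed.
Let BD n : B n `<=` D. Proof. exact: exh_BD. Qed.
Let BL n : B n `<=` L n. Proof. exact: exh_BL. Qed.
Let mB n : measurable (B n : set (borel X)). Proof. exact: exh_mB. Qed.
Let fB n : (mu n (B n) < +oo)%E. Proof. exact: exh_finB. Qed.
Let fT n : (mu n setT < +oo)%E. Proof. exact: exh_fin. Qed.
Let muB1 n : fine (mu n (B n)) = 1.
Proof.
have [h _] := framework_harmonic Hframe (HDom n).
by rewrite (h x0 (exh_x0 n)).2.
Qed.
Let bB n (f : X -> R) : {within B n, continuous f} -> bmeas (B n : set (borel X)) (f : borel X -> R).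
Proof. exact: exh_bmeas. Qed.
Let xsL n j : (lv j < n)%N -> L n (xs j).
Proof. by move=> jn; apply: (exh_Lmono (ltnW jn)); apply: dseqL. Qed.
Let xsD n j : (lv j < n)%N -> D_ n (xs j).
Proof. by move=> jn; apply: (exh_LD jn); apply: dseqL. Qed.
Let xD j : D (xs j). Proof. exact: dseqD. Qed.

(** * Second moments and extreme functions *)

(** [H1] for functions on the whole space instead of functions on [D]. *)
Definition posharm (g : X -> R) :=
  [/\ harmonic_on Dom w D g, forall x, D x -> 0 < g x & g x0 = 1].

Definition second_moment n x (g : X -> R) :=
  \int[mu n]_(y in B n) (K n x y ^+ 2 * g y).
Local Notation S := second_moment.

Let cBg n (g : X -> R) : {within D, continuous g} -> {within B n, continuous g}.
Proof. by apply: continuous_subspaceW; exact: BD. Qed.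

Let bKg n x (g : X -> R) : D_ n x -> {within D, continuous g} ->
  bmeas (B n : set (borel X)) (fun y => K n x y * g y).
Proof. by move=> Dx cg; apply: bB; apply: within_contM; [exact: Kcont|exact: cBg]. Qed.

Let bKKg n x (g : X -> R) : D_ n x -> {within D, continuous g} ->
  bmeas (B n : set (borel X)) (fun y => K n x y ^+ 2 * g y).
Proof.
move=> Dx cg; apply: (@eq_bmeas _ (borel X) R _ (fun y => K n x y * (K n x y * g y))).
  by move=> y _; rewrite mulrA.
by apply: bmeasM; [apply: bB; exact: Kcont|exact: bKg].
Qed.

Lemma second_moment_lin n x a b (g h : X -> R) : D_ n x -> {within D, continuous g} ->
  {within D, continuous h} -> S n x (fun y => a * g y + b * h y) = a * S n x g + b * S n x h.
Proof.
move=> Dx cg ch; rewrite -!(Rint_Zl (@mB n) (@fB n)); [|exact: bKKg|exact: bKKg].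
rewrite -(Rint_D (@mB n) (@fB n)).
- by apply: eq_Rint => y _; ring.
- by apply: bmeasM; [exact: bmeas_cst|exact: bKKg].
- by apply: bmeasM; [exact: bmeas_cst|exact: bKKg].
Qed.

(** [K n x] has mean [g x] under the probability measure [g y dw(y)]. *)
Lemma second_moment_spread n x g : posharm g -> D_ n x ->
  \int[mu n]_(y in B n) ((K n x y - g x) ^+ 2 * g y) = S n x g - g x ^+ 2.
Proof.
move=> [hg g0 g1] Dx; have cg := hg.1; have m := @mB n; have f := @fB n.
have -> : \int[mu n]_(y in B n) ((K n x y - g x) ^+ 2 * g y) =
    \int[mu n]_(y in B n) ((K n x y ^+ 2 * g y + (- 2 * g x) * (K n x y * g y)) + g x ^+ 2 * g y).
  by apply: eq_Rint => y _; ring.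
have b1 : bmeas (B n : set (borel X)) (fun y => - 2 * g x * (K n x y * g y)).
  by apply: bmeasM; [exact: bmeas_cst|exact: bKg].
have b2 : bmeas (B n : set (borel X)) (fun y => g x ^+ 2 * g y).
  by apply: bmeasM; [exact: bmeas_cst|apply: bB; exact: cBg].
rewrite (Rint_D m f)//; last by apply: bmeasD => //; exact: bKKg.
rewrite (Rint_D m f)//; last exact: bKKg.
rewrite (Rint_Zl m f); last by apply: bB; exact: cBg.
rewrite (Rint_Zl m f); last exact: bKg.
rewrite -(Krep hg (@LD n) Dx).
rewrite -(mean_value hg (@LD n)) g1 mulr1.
by rewrite -[\int[_]_(_ in _) _]/(S n x g); ring.
Qed.

Lemma second_moment_ge n x g : posharm g -> D_ n x -> g x ^+ 2 <= S n x g.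
Proof.
move=> pg Dx; rewrite -subr_ge0 -second_moment_spread//.
have [_ g0 _] := pg; apply: Rintegral_ge0 => y By; rewrite mulr_ge0 ?sqr_ge0//.
by apply/ltW/g0; exact: (BD By).
Qed.

Lemma posharm_bounds m g : posharm g -> harnack_bounds m g.
Proof.
move=> [hg g0 g1]; apply: (harmonic_bounds hg) => //.
by move=> y By; apply/ltW/g0; exact: (BD By).
Qed.

Lemma posharm_Om m g : posharm g -> forall s t, L m s -> L m t -> `|g s - g t| <= Om m s t.
Proof. by move=> pg s t Ls Lt; have [] := posharm_bounds pg Ls Lt. Qed.

Lemma kernel_bounds m n y : (m + 2 <= n)%N -> B n y -> harnack_bounds m (K n ^~ y).
Proof.
move=> mn By; have hK := Kharm By.
apply: (harmonic_bounds hK).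
- by apply: exh_LD; lia.
- move=> z Bz; apply: Kge0 => //.
  apply: (exh_LD _ (exh_BL Bz)); lia.
- exact: Kbase.
Qed.

Lemma eq_posharm g h : (forall j, g (xs j) = h (xs j)) ->
  posharm g -> posharm h -> forall x, D x -> g x = h x.
Proof.
move=> gh pg ph x; rewrite Hunion => -[m _ Dx].
apply: (dseq_sep (m := m)) => //.
- exact: posharm_Om.
- exact: posharm_Om.
- exact: DL.
Qed.

(** [S n x] is linear and at least the square; the left-hand side is what the
    square loses by convexity. *)
Lemma second_moment_convex n x t g h1 h2 : posharm h1 -> posharm h2 -> D_ n x -> 0 < t -> t < 1 ->
  (forall y, D y -> g y = t * h1 y + (1 - t) * h2 y) ->
  t * (1 - t) * (h1 x - h2 x) ^+ 2 <= S n x g - g x ^+ 2.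
Proof.
move=> p1 p2 Dx t0 t1 gE.
have -> : S n x g = t * S n x h1 + (1 - t) * S n x h2.
  have [[c1 _] _ _] := p1; have [[c2 _] _ _] := p2.
  rewrite -second_moment_lin//; apply: eq_Rint => y By; rewrite gE//.
  exact: (BD By).
have Dx' : D x by exact: (exh_D Dx).
rewrite gE//; have := second_moment_ge p1 Dx; have := second_moment_ge p2 Dx.
have : 0 < 1 - t by rewrite subr_gt0.
move=> s0 a b; have a' := ler_wpM2l (ltW s0) a; have b' := ler_wpM2l (ltW t0) b.
have : t * h1 x ^+ 2 + (1 - t) * h2 x ^+ 2 - (t * h1 x + (1 - t) * h2 x) ^+ 2 =
  t * (1 - t) * (h1 x - h2 x) ^+ 2 by ring.
by move=> <-; rewrite lerB// lerD.
Qed.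

(** The bounds give limits at every point and equicontinuity, so that the limit is
    harmonic; the normalization keeps it from vanishing. *)
Lemma ultra_montel (I : Type) (U : set_system I) (g : I -> X -> R) : UltraFilter U ->
  (forall m, U [set i | [/\ harmonic_on Dom w (D_ m) (g i), harnack_bounds m (g i) &
                            forall z, D_ m z -> 0 <= g i z]]) ->
  U [set i | g i x0 = 1] ->
  exists2 h, posharm h & forall z, D z -> (fun i => g i z) @ U --> h z.
Proof.
move=> UU Ug Ug1.
have in_some_LL z : D z -> exists m, D_ m z by rewrite {1}Hunion => -[m _ Dm]; exists m.
have Hl z : exists l : R, D z -> (fun i => g i z) @ U --> l.
  have [Dz|] := pselect (D z); last by exists 0.
  have [m Dmz] := in_some_LL z Dz.
  have [|l hl] := @bounded_ultra_lim R I (fun i => g i z) U (bmax D_ K m) UU; last by exists l.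
  apply: filterS (Ug m) => i [_ gi g0] /=.
  by rewrite ger0_norm ?g0//; have [] := gi _ _ (DL Dmz) (DL Dmz).
pose h z := projT1 (cid (Hl z)).
have hP z : D z -> (fun i => g i z) @ U --> h z by exact: (projT2 (cid (Hl z))).
have FO m : U [set i | forall s t, L m s -> L m t -> `|g i s - g i t| <= Om m s t].
  by apply: filterS (Ug m) => i [_ gi _] s t Ls Lt; have [] := gi _ _ Ls Lt.
have hh : harmonic_on Dom w D h.
  apply: harmonic_exh.
    apply: within_exh => m.
    apply: Om_within.
    apply: (limit_modulus _ (g := g) (F := U)) => //.
    by move=> s Ls; apply: hP; exact: (LD Ls).
  move=> m; apply: (limit_harmonic _ (g := g) (F := U)) => //.
    by move=> s Ls; apply: hP; exact: (LD Ls).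
  by apply: filterS (Ug m) => i [].
have h1 : h x0 = 1.
  apply: (cvg_unique (@Rhausdorff R) (@hP x0 (LD (DL (exh_x0 0))))).
  exact: cvg_near_cst.
have h0 z : D z -> 0 <= h z.
  move=> Dz; apply: (cvgr_to_ge (@hP z Dz)); have [m Dmz] := in_some_LL z Dz.
  by apply: filterS (Ug m) => i [_ _]; apply.
exists h => //; split => //; exact: harm_pos.
Qed.

Definition extreme g := posharm g /\ forall h1 h2 t, posharm h1 -> posharm h2 ->
  0 < t -> t < 1 -> (forall x, D x -> g x = t * h1 x + (1 - t) * h2 x) ->
  forall x, D x -> h1 x = g x /\ h2 x = g x.

(** By [second_moment_convex] the two parts of a decomposition agree on a dense
    sequence. *)
Lemma small_variance_extreme g : posharm g ->
  (forall j e, 0 < e -> exists n, D_ n (xs j) /\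
     S n (xs j) g - g (xs j) ^+ 2 < e) ->
  extreme g.
Proof.
move=> pg H; split => // h1 h2 t p1 p2 t0 t1 gE.
have h12 : forall x, D x -> h1 x = h2 x.
  apply: eq_posharm => // j; set x := xs j.
  have s0 : 0 < t * (1 - t) by rewrite mulr_gt0// subr_gt0.
  apply/eqP; rewrite -subr_eq0 -sqrf_eq0 eq_le sqr_ge0 andbT.
  apply/ler_addgt0Pr => e e0; rewrite add0r.
  have [n [Dx Se]] := H j _ (mulr_gt0 s0 e0).
  rewrite -(ler_pM2l s0); apply: le_trans (ltW Se).
  exact: second_moment_convex.
move=> x Dx; rewrite gE// h12//; split; ring.
Qed.

(** [h n] below is harmonic, normalized, at most [b / c * g], and its value at [x] is
    [S n x g / g x].  Any limit of the [h n] is a convex part of [g], hence is [g]. *)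
Lemma extreme_small_variance g x : extreme g -> D x -> (fun n => S n x g) @ \oo --> g x ^+ 2.
Proof.
move=> [pg ext] Dx; have [hg g0 g1] := pg; have cg := hg.1.
apply: cvg_ultra => U UU sU.
have [m Dmx] : exists m, D_ m x by move: Dx; rewrite Hunion => -[m _ Dm]; exists m.
pose b := bmax D_ K m; pose c := g x.
have c0 : 0 < c by exact: g0.
have Kb n y : (m + 2 <= n)%N -> B n y -> 0 <= K n x y <= b.
  move=> mn By; apply/andP; split.
    apply: Kge0 => //.
    by apply: (exh_mono _ Dmx); lia.
  by have [] := kernel_bounds mn By (DL Dmx) (DL Dmx).
have b0 : 0 <= b.
  have [y By] := framework_boundary Hframe (HDom (m + 2)%N).
  by have /andP[h1 h2] := Kb _ y (leqnn _) By; exact: le_trans h1 h2.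
pose f n y := c^-1 * (K n x y * g y).
pose h n z := \int[mu n]_(y in B n) (K n z y * f n y).
have Dnx n : (m + 2 <= n)%N -> D_ n x by move=> mn; apply: (exh_mono _ Dmx); lia.
have cf n : (m + 2 <= n)%N -> {within B n, continuous (f n)}.
  move=> mn; apply: within_contM; first exact: within_cont_cst.
  by apply: within_contM; [apply: Kcont; exact: Dnx|exact: cBg].
have hh n : (m + 2 <= n)%N -> harmonic_on Dom w (D_ n) (h n).
  by move=> mn; apply: Kmix; exact: cf.
have f0 n y : (m + 2 <= n)%N -> B n y -> 0 <= f n y.
  move=> mn By; rewrite mulr_ge0 ?invr_ge0 ?(ltW c0)// mulr_ge0//.
    by have /andP[] := Kb _ _ mn By.
  by apply/ltW/g0; exact: (BD By).
have h0 n z : (m + 2 <= n)%N -> D_ n z -> 0 <= h n z.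
  move=> mn Dz; apply: Rintegral_ge0 => y By; rewrite mulr_ge0 ?f0//.
  exact: Kge0.
have h1 n : (m + 2 <= n)%N -> h n x0 = 1.
  move=> mn; rewrite /h /f.
  transitivity (\int[mu n]_(y in B n) (c^-1 * (K n x y * g y))).
    by apply: eq_Rint => y By; rewrite (Kbase By) mul1r.
  rewrite (Rint_Zl (@mB n) (@fB n)); last by apply: bKg => //; exact: Dnx.
  rewrite -(Krep hg (@LD n) (Dnx n mn)).
  by rewrite mulVf// gt_eqF.
have hb n z : (m + 2 <= n)%N -> D_ n z -> h n z <= b / c * g z.
  move=> mn Dz; rewrite (Krep hg (@LD n) Dz).
  rewrite -(Rint_Zl (@mB n) (@fB n)); last exact: bKg.
  apply: (le_Rint (@mB n) (@fB n)).
  - by apply: bB; apply: within_contM; [exact: Kcont|exact: cf].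
  - by apply: bmeasM; [exact: bmeas_cst|exact: bKg].
  move=> y By; have Kz := Kge0 Dz By.
  have gy : 0 <= g y by apply/ltW/g0; exact: (BD By).
  have /andP[_ Ky] := Kb _ _ mn By.
  have -> : K n z y * f n y = c^-1 * (K n z y * g y) * K n x y.
    by rewrite /f; move: (c^-1) => c'; ring.
  have -> : b / c * (K n z y * g y) = c^-1 * (K n z y * g y) * b.
    by move: (c^-1) => c'; ring.
  by rewrite ler_wpM2l// !mulr_ge0// invr_ge0 ltW.
have hbounds n m' : (m + m' + 2 <= n)%N -> harnack_bounds m' (h n).
  move=> mn; apply: (harmonic_bounds (hh n _)).
  - lia.
  - by apply: exh_LD; lia.
  - move=> z Bz; apply: h0; first by lia.
    apply: (exh_LD _ (exh_BL Bz)); lia.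
  - by apply: h1; lia.
have Uge N : U [set n | (N <= n)%N] by apply: sU; exists N.
have [||hl phl hlP] := @ultra_montel nat U h UU.
- move=> m'; apply: filterS (Uge (m + m' + 2)%N) => n /= mn; split.
  + by apply: (harmonic_onW _ (hh n _)); [apply: exh_mono; lia|lia].
  + exact: hbounds.
  + by move=> z Dz; apply: h0; [lia|apply: (exh_mono _ Dz); lia].
- by apply: filterS (Uge (m + 2)%N) => n /= mn; exact: h1.
have [hhl hl0 hl1] := phl.
have hlb z : D z -> hl z <= b / c * g z.
  move=> Dz; apply: (cvgr_to_le (@hlP z Dz)).
  have [m' Dz'] : exists m, D_ m z by move: Dz; rewrite Hunion => -[m1 _ Dm]; exists m1.
  apply: filterS (Uge (m + m' + 2)%N) => n /= mn.
  by apply: hb; [lia|apply: (exh_mono _ Dz'); lia].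
(* g is a convex combination of hl and h2; as t * (b / c) < 1, the remaining part h2 is
   positive *)
pose b' := b + c + 1; pose t := c / b'.
have b'0 : 0 < b' by rewrite /b' addr_gt0// ltr_wpDl.
have t0 : 0 < t by rewrite divr_gt0.
have t1 : t < 1 by rewrite /t ltr_pdivrMr// mul1r /b'; lra.
have s0 : 0 < 1 - t by rewrite subr_gt0.
pose h2 z := (1 - t)^-1 * g z + (- (t / (1 - t))) * hl z.
have ph2 : posharm h2.
  split; first exact: harmonic_lin.
  - move=> z Dz; rewrite /h2 (_ : _ + _ = (1 - t)^-1 * (g z - t * hl z)); last by ring.
    rewrite mulr_gt0 ?invr_gt0// subr_gt0.
    apply: (@le_lt_trans _ _ (t * (b / c * g z))); first by rewrite ler_pM2l// hlb.
    rewrite mulrA -[ltRHS]mul1r ltr_pM2r ?g0//.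
    rewrite /t (_ : _ * _ = b / b'); last by field; rewrite !gt_eqF.
    by rewrite ltr_pdivrMr// mul1r /b'; lra.
  - by rewrite /h2 g1 hl1; field; rewrite gt_eqF.
have [|hlx _] := ext hl h2 t phl ph2 t0 t1 _ x Dx.
  by move=> z Dz; rewrite /h2; field; rewrite gt_eqF.
have := @hlP x Dx; rewrite hlx => hx.
have hS : (fun n => c * h n x) @ U --> c * g x by apply: cvgM => //; exact: cvg_cst.
rewrite expr2; apply: cvg_trans hS; apply: near_eq_cvg.
apply: filterS (Uge (m + 2)%N) => n /= mn.
rewrite /h -(Rint_Zl (@mB n) (@fB n)); last first.
  by apply: bB; apply: within_contM; [apply: Kcont; exact: Dnx|exact: cf].
apply: eq_Rint => y By; rewrite /f; field; rewrite gt_eqF//.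
Qed.

(** * Compactness of the function spaces *)

Lemma in_some_LL x : D x -> exists m, L m x.
Proof. by rewrite Hunion => -[m _ Dm]; exists m; exact: DL. Qed.

(** The bounds pass to pointwise limits and make pointwise convergence uniform. *)
Lemma Qset_compact m : compact (@Qset _ _ Dom w x0 D_ K m : set (fun_LL D_ m)).
Proof.
rewrite compact_ultra => F FU FQ.
pose g (f : fun_LL D_ m) : X -> R := ext0 (f : L m -> R).
have Fb x : exists l : R, L m x -> (fun f => g f x) @ F --> l.
  have [Lx|] := pselect (L m x); last by exists 0.
  have [|l hl] := @bounded_ultra_lim R _ (g ^~ x) F (`|amin D_ K m| + `|bmax D_ K m|) FU; last by exists l.
  apply: filterS FQ => f [_ _ _ /(_ m x x (leqnn m) Lx Lx) [h1 h2 _]] /=.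
  have := ler_norm (bmax D_ K m); have := ler_norm (- amin D_ K m); rewrite normrN => h3 h4.
  have := normr_ge0 (amin D_ K m); have := normr_ge0 (bmax D_ K m) => h5 h6.
  by rewrite ler_norml; apply/andP; split; rewrite /g; lra.
pose h x := projT1 (cid (Fb x)).
have hP x : L m x -> (fun f => g f x) @ F --> h x by exact: (projT2 (cid (Fb x))).
have FO : F [set f | forall s t, L m s -> L m t -> `|g f s - g f t| <= Om m s t].
  apply: filterS FQ => f [_ _ _ Qf] s t Ls Lt.
  by have [] := Qf m s t (leqnn m) Ls Lt.
pose h' : fun_LL D_ m := fun s : L m => h (val s).
have h'E x : L m x -> ext0 (h' : L m -> R) x = h x by move=> Lx; rewrite ext0_in.
exists h'; split.
  split.
  - apply/(@subspace_valL_continuousP' _ _ _ 0).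
    apply: (@eq_within_cont _ _ _ h); first by move=> x Lx; rewrite -h'E.
    by apply: Om_within; exact: (limit_modulus _ hP FO).
  - apply: (eq_harmonic_on (f := h)); first by move=> x /DL Lx; rewrite -h'E.
    apply: (limit_harmonic _ hP FO).
    by apply: filterS FQ => f [].
  - rewrite h'E; last exact/DL/exh_x0.
    apply: (cvg_unique (@Rhausdorff R) (@hP x0 (DL (@exh_x0 m)))).
    by apply: cvg_near_cst; apply: filterS FQ => f [].
  - move=> i s t im Ls Lt.
    have Ls' : L m s by apply: (exh_Lmono im).
    have Lt' : L m t by apply: (exh_Lmono im).
    rewrite !h'E//; split.
    + apply: (cvgr_to_ge (@hP s Ls')); apply: filterS FQ => f [_ _ _ Qf].
      by have [] := Qf i s t im Ls Lt.
    + apply: (cvgr_to_le (@hP s Ls')); apply: filterS FQ => f [_ _ _ Qf].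
      by have [] := Qf i s t im Ls Lt.
    + have c : (fun f => `|g f s - g f t|) @ F --> `|h s - h t|.
        by apply: cvg_norm; apply: cvgB; exact: hP.
      apply: (cvgr_to_le c); apply: filterS FQ => f [_ _ _ Qf].
      by have [] := Qf i s t im Ls Lt.
have uni e (e0 : 0 < e) : F [set f | forall s, L m s -> `|g f s - h s| < e].
  exact: (limit_uniform _ hP FO).
move=> A /nbhs_ballP[e /= e0 eA].
apply: (@filterS _ F _ _ _ _ (uni e e0)) => f hf; apply: eA; apply/ball_LLE => s.
by rewrite distrC /h'; have := hf (val s) (set_valP s); rewrite /g ext0_val.
Qed.

Lemma Pset_compact : compact P.
Proof. exact: (@tychonoff nat (fun_LL D_) (fun m => (@Qset _ _ Dom w x0 D_ K m : set (fun_LL D_ m))) Qset_compact). Qed.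

Lemma Pset_measurable : measurable (P : set (borel PL)).
Proof. by apply: borel_compact; [exact: prod_LL_hausdorff|exact: Pset_compact]. Qed.

Lemma Pset_bounds p m : P p -> harnack_bounds m (ext0 (p m)).
Proof. by move=> /(_ m)[_ _ _ Qp] s t Ls Lt; exact: (Qp m s t (leqnn m)). Qed.

(** Countably many evaluations, coded by pairs [(m, i)]; they separate the points of
    [P] because these are equicontinuous. *)
Definition coord (j : nat) (p : PL) : R :=
  if unpickle j is Some (m, i) then ext0 (p m) (xs i) else 0.

Lemma coord_continuous j : continuous (coord j).
Proof.
rewrite /coord; case: (unpickle j) => [[m i]|]; first exact: eval_prod_continuous.
exact: cst_continuous.
Qed.

Lemma coord_within j : {within P, continuous (coord j)}.
Proof. by apply: continuous_subspaceT; exact: coord_continuous. Qed.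

Lemma coord_sep p q : P p -> P q -> (forall j, coord j p = coord j q) -> p = q.
Proof.
move=> Pp Pq pq; apply: functional_extensionality_dep => m; apply/funext => s.
rewrite -(ext0_val (p m)) -(ext0_val (q m)).
apply: (dseq_sep (m := m)).
- by move=> a b La Lb; have [] := Pset_bounds Pp La Lb.
- by move=> a b La Lb; have [] := Pset_bounds Pq La Lb.
- by move=> i _; have := pq (pickle (m, i)); rewrite /coord pickleK.
- exact: set_valP.
Qed.

Lemma H1_posharm (h : FS) : H h <-> posharm (ext0 (h : D -> R)).
Proof.
split=> [[hh h0 h1]|[hh h0 h1]]; split => //.
  by move=> x Dx; rewrite ext0_in; exact: h0.
by move=> x; rewrite -(ext0_val h); apply: h0; exact: set_valP.
Qed.

Lemma posharm_H1 g : posharm g -> H (fun s : D => g (val s)).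
Proof.
move=> [hg g0 g1].
have E x : D x -> g x = ext0 (fun s : D => g (val s)) x by move=> Dx; rewrite ext0_in.
apply/H1_posharm; split.
- exact: eq_harmonic_on hg.
- by move=> x Dx; rewrite -E//; exact: g0.
- by rewrite -E//; apply: LD; apply: DL; exact: Hx0.
Qed.

Lemma restrictE m x (g : FS) : L m x -> ext0 (res g m) x = ext0 (g : D -> R) x.
Proof. by move=> Lx; rewrite ext0_in. Qed.

Lemma harmonic_continuous_LL m (f : L m -> R) g : {within D, continuous g} ->
  (forall x, L m x -> ext0 f x = g x) -> continuous f.
Proof.
move=> cg fg; apply/(@subspace_valL_continuousP' _ _ _ 0).
apply: (@eq_within_cont _ _ _ g); first by move=> x Lx; rewrite -fg.
by apply: continuous_subspaceW cg; exact: LD.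
Qed.

Lemma restrict_P (g : FS) : H g -> P (res g).
Proof.
move=> /H1_posharm pg m; have [hg g0 g1] := pg; split.
- apply: (harmonic_continuous_LL hg.1) => x Lx; exact: restrictE.
- apply: (eq_harmonic_on (f := ext0 (g : D -> R))).
    by move=> x /DL Lx; rewrite restrictE.
  apply: (harmonic_onW _ hg); exact: exh_D.
- by rewrite restrictE//; apply: DL; exact: exh_x0.
- move=> i s t im Ls Lt; rewrite !restrictE; try exact: (exh_Lmono im).
  exact: (posharm_bounds pg).
Qed.

Lemma restrict_inj : injective res.
Proof.
move=> g h gh; apply/funext => s; rewrite -(ext0_val (g : D -> R)) -(ext0_val (h : D -> R)).
have [m Lm] := in_some_LL (set_valP s).
by rewrite -(restrictE g Lm) -(restrictE h Lm) gh.
Qed.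

Lemma cylinder_compact m : compact ((fun s : D => L m (val s)) : set D).
Proof.
rewrite compact_ultra => F FU FL.
have [x Lx xF] := compact_ultra_lim (@exh_cL m) FU FL.
have Dx := LD Lx.
exists (exist _ x (mem_set Dx)); split => // A [_ [[W oW <-] /= Wx] WA].
by apply: (@filterS _ F _ _ _ WA); apply: xF; exact: open_nbhs_nbhs.
Qed.

(** [L m] is compact in [D], so that convergence on compact sets controls the
    uniform distance on it. *)
Lemma restrict_continuous : continuous (res : FS -> PL).
Proof.
move=> g; apply/(@cvg_sup _ _ _ _ (res g) (fmap_filter res (nbhs_filter g))) => m.
move=> A [_ [[W oW <-] /= Wg] WA].
have : nbhs (res g m : fun_LL D_ m) W by exact: open_nbhs_nbhs.
move=> /nbhs_ballP[e /= e0 eW].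
have := @fam_nbhs D R compact (fun s : D => L m (val s)) [set xy : R * R | ball xy.1 e xy.2] g
  (entourage_ball _ (PosNum e0)) (@cylinder_compact m).
apply: filterS => h hh; apply: WA; apply: eW; apply/ball_LLE => s.
have E (f : FS) : res f m s = f (exist _ (val s) (mem_set (LD (set_valP s)))).
  by rewrite /restrict_LL (ext0_in _ (LD (set_valP s))).
by rewrite -[proj m (res h) s]/(res h m s) !E; apply: hh; exact: (set_valP s).
Qed.

Lemma fun_space_hausdorff : hausdorff_space FS.
Proof.
apply: (@hausdorff_of_functions R FS (nat * X) (fun mx g => ext0 (res g mx.1) mx.2)).
  move=> mx g; apply: (@continuous_comp _ _ _ (res : FS -> PL) (fun p : PL => ext0 (p mx.1) mx.2)).
    exact: restrict_continuous.
  exact: eval_prod_continuous.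
move=> g h gh; apply: restrict_inj; apply: functional_extensionality_dep => m; apply/funext => s.
by have := gh (m, val s); rewrite /= !ext0_val.
Qed.

(** The pointwise limits of [ultra_montel] are uniform on every [L m], and a compact
    subset of [D] lies in one of these. *)
Lemma H1_compact : compact (H : set FS).
Proof.
rewrite compact_ultra => F FU FH.
have [||h phh hP] := ultra_montel
    (I := FS) (U := F) (g := fun f : FS => ext0 (f : D -> R)) FU.
- move=> m; apply: filterS FH => f /H1_posharm pf; have [hf f0 f1] := pf; split.
  + apply: (harmonic_onW _ hf); exact: exh_D.
  + exact: (posharm_bounds pf).
  + by move=> z /exh_D Dz; exact/ltW/f0.
- by apply: filterS FH => f /H1_posharm[].
pose h' : FS := fun s : D => h (val s).
exists h'; split; first exact: posharm_H1.
apply/fam_cvgP => C cC A /uniform_nbhs[E [entE EA]].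
have [e e0 eE] : exists2 e : R, 0 < e & [set xy | ball xy.1 e xy.2] `<=` E.
  by move: entE; rewrite -entourage_ballE => -[e /= e0 eE]; exists e.
have cvC : compact (val @` C : set X).
  by apply: continuous_compact => //; apply: continuous_subspaceT; exact: initial_continuous.
have [|m Cm] := exh_compact cvC.
  by move=> _ [s _ <-]; exact: set_valP.
have uni : F [set f | forall s, L m s -> `|ext0 (f : D -> R) s - h s| < e].
  apply: (limit_uniform _ (g := fun f : FS => ext0 (f : D -> R)) (h := h)) => //.
    by move=> s Ls; apply: hP; exact: (LD Ls).
  apply: filterS FH => f /H1_posharm pf s t Ls Lt.
  exact: (posharm_Om pf).
apply: filterS uni => f hf; apply: EA => s Cs; apply: eE; rewrite /= /ball/= /h' distrC.
have := hf (val s) (DL (Cm _ (ex_intro2 _ _ s Cs erefl))).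
by rewrite ext0_val.
Qed.

Lemma H1_measurable : measurable (H : set (borel FS)).
Proof. by apply: borel_compact; [exact: fun_space_hausdorff|exact: H1_compact]. Qed.

(** * The set of minimal functions *)

Lemma minimal_extreme (g : FS) : E g <-> extreme (ext0 (g : D -> R)).
Proof.
split=> [[/H1_posharm pg ext]|[pg ext]]; split => //.
- move=> h1 h2 t p1 p2 t0 t1 gE x Dx.
  have q1 := posharm_H1 p1; have q2 := posharm_H1 p2.
  have q : g = t *: (fun s : D => h1 (val s) : R^o) + (1 - t) *: (fun s : D => h2 (val s) : R^o) :> (D -> R^o).
    by apply/funext => s; rewrite -(ext0_val (g : D -> R)) gE//; exact: set_valP.
  have [e1 e2] := ext _ _ t q1 q2 t0 t1 q.
  split; first by rewrite (ext0_in _ Dx) -[in RHS]e1.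
  by rewrite (ext0_in _ Dx) -[in RHS]e2.
- exact/H1_posharm.
- move=> h1 h2 t /H1_posharm p1 /H1_posharm p2 t0 t1 gE.
  have gE' x : D x -> ext0 (g : D -> R) x = t * ext0 (h1 : D -> R) x + (1 - t) * ext0 (h2 : D -> R) x.
    by move=> Dx; rewrite !(ext0_in _ Dx) gE.
  have ext' := ext _ _ t p1 p2 t0 t1 gE'.
  split; apply/funext => s; have [e1 e2] := ext' _ (set_valP s).
    by rewrite -(ext0_val (h1 : D -> R)) e1 ext0_val.
  by rewrite -(ext0_val (h2 : D -> R)) e2 ext0_val.
Qed.

Lemma minimal_sub : E `<=` H.
Proof. by move=> g []. Qed.

(** The variance of [K n (xs j)] when [p] is the image of a harmonic function, by
    [second_moment_spread]. *)
Definition variance n j (p : PL) : R := S n (xs j) (ext0 (p n)) - ext0 (p n) (xs j) ^+ 2.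

Let Pcont n (p : PL) : P p -> {within B n, continuous (ext0 (p n))}.
Proof.
move=> Pp; apply: (continuous_subspaceW (BL (n := n))).
by apply/(@subspace_valL_continuousP' _ _ _ 0); have [] := Pp n.
Qed.

Let bKK n j (f : X -> R) : (lv j < n)%N -> {within B n, continuous f} ->
  bmeas (B n : set (borel X)) (fun y => K n (xs j) y ^+ 2 * f y).
Proof.
move=> jn cf; have cK := @Kcont n _ (xsD jn).
apply: bB; apply: within_contM => //.
apply: (@eq_within_cont _ _ _ (fun y => K n (xs j) y * K n (xs j) y)).
  by move=> y _; rewrite expr2.
exact: within_contM.
Qed.

Lemma variance_continuous n j : (lv j < n)%N -> {within P, continuous (variance n j)}.
Proof.
move=> jn; apply: within_contB; last first.
  apply: (@eq_within_cont _ _ _ (fun p : PL => ext0 (p n) (xs j) * ext0 (p n) (xs j))).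
    by move=> p _; rewrite expr2.
  by apply: within_contM; apply: continuous_subspaceT; exact: eval_prod_continuous.
have [M hM] := Kbounded jn.
apply/within_contP => p Pp e e0.
pose M2 := M ^+ 2 + 1.
have M20 : 0 < M2 by rewrite ltr_wpDl// sqr_ge0.
have d0 : 0 < e / 2 / M2 by rewrite !divr_gt0.
have : nbhs p ((fun q : PL => q n : fun_LL D_ n) @^-1` ball (p n : fun_LL D_ n) (e / 2 / M2)).
  by apply: proj_LL_continuous; exact: nbhsx_ballx.
apply: filterS => q /ball_LLE qp Pq.
have := Rint_dist (@mB n) (@fB n) (bKK jn (Pcont Pq)) (bKK jn (Pcont Pp)) (e := M2 * (e / 2 / M2)).
rewrite muB1 mulr1 => /(_ _)/le_lt_trans; apply; last first.
  by rewrite mulrCA divff ?gt_eqF// mulr1 ltr_pdivrMr// ltr_pMr// ltr1n.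
move=> y By; rewrite -mulrBr normrM; apply: ler_pM => //.
  rewrite normrX /M2; apply: (@le_trans _ _ (M ^+ 2)); last by rewrite lerDl.
  have hKM : `|K n (xs j) y| <= M by apply: hM => //; apply: dseqL.
  by rewrite lerXn2r ?nnegrE// (le_trans _ hKM).
rewrite !(ext0_in _ (BL By)) distrC; exact/ltW/qp.
Qed.

Lemma variance_restrict n j (g : FS) : (lv j < n)%N ->
  variance n j (res g) = S n (xs j) (ext0 (g : D -> R)) - ext0 (g : D -> R) (xs j) ^+ 2.
Proof.
move=> jn; rewrite /variance (restrictE g (xsL jn)); congr (_ - _).
by apply: eq_Rint => y By; rewrite (restrictE g (BL By)).
Qed.

Lemma variance_ge0 n j (g : FS) : H g -> (lv j < n)%N -> 0 <= variance n j (res g).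
Proof.
move=> /H1_posharm pg jn; rewrite variance_restrict// subr_ge0.
exact: (second_moment_ge pg (xsD jn)).
Qed.

(** The sequences that glue to a function on [D]; countably many conditions are
    enough by equicontinuity. *)
Definition compatible : set PL :=
  [set p | forall m i, L m (xs i) -> ext0 (p m) (xs i) = ext0 (p m.+1) (xs i)].

Lemma compatible_restrict (g : FS) : compatible (res g).
Proof.
move=> m i Lm; rewrite !restrictE//; apply: (exh_Lmono (leqnSn m)) => //.
Qed.

Lemma compatible_measurable : measurable (P `&` compatible : set (borel PL)).
Proof.
apply: measurableI; first exact: Pset_measurable.
rewrite (_ : compatible = \bigcap_m \bigcap_i (if `[< L m (xs i) >] then
    (fun p : PL => ext0 (p m) (xs i) - ext0 (p m.+1) (xs i)) @^-1` [set 0] else setT)).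
  apply: bigcap_measurableType => m _; apply: bigcap_measurableType => i _; case: asboolP => // _.
  have mf : measurable_fun (setT : set (borel PL))
      ((fun p : PL => ext0 (p m) (xs i) - ext0 (p m.+1) (xs i)) : borel PL -> R).
    apply: within_cont_measurableR => //; apply: within_contB;
      by apply: continuous_subspaceT; exact: eval_prod_continuous.
  by have := mf measurableT [set 0] (measurable_set1 0); rewrite setTI.
apply/seteqP; split => [p cp m _ i _|p cp m i Lm].
  by case: asboolP => //= Lm; rewrite (cp m i Lm) subrr.
have := cp m I i I; case: asboolP => // _ /= h.
by apply/eqP; rewrite -subr_eq0 h.
Qed.

Lemma compatible_glue p : P p -> compatible p -> exists2 g : FS, H g & res g = p.
Proof.
move=> Pp cp.
have step m s : L m s -> ext0 (p m) s = ext0 (p m.+1) s.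
  apply: (dseq_sep (m := m)).
  - by move=> a b La Lb; have [] := Pset_bounds Pp La Lb.
  - by move=> a b La Lb; have [_ _ _ /(_ m a b (leqnSn m) La Lb)[]] := Pp m.+1.
  - by move=> i; exact: cp.
have mono m n s : (m <= n)%N -> L m s -> ext0 (p m) s = ext0 (p n) s.
  move=> mn Ls; elim: n mn => [|n IH]; first by rewrite leqn0 => /eqP->.
  rewrite leq_eqVlt => /orP[/eqP<-//|mn]; rewrite IH// step//.
  by apply: (exh_Lmono _ Ls).
have Hl x : exists m, D x -> L m x.
  have [Dx|] := pselect (D x); last by exists 0%N.
  by have [m Lm] := in_some_LL Dx; exists m.
pose l x := projT1 (cid (Hl x)).
have lP x : D x -> L (l x) x by exact: (projT2 (cid (Hl x))).
pose g x := ext0 (p (l x)) x.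
have gE m x : L m x -> g x = ext0 (p m) x.
  move=> Lx; rewrite /g; have [lm|/ltnW ml] := leqP (l x) m.
    by apply: mono => //; apply: lP; exact: LD Lx.
  by rewrite (mono m (l x)).
have hg m : harmonic_on Dom w (D_ m) g.
  apply: (eq_harmonic_on (f := ext0 (p m))); last by have [] := Pp m.
  by move=> x /DL Lx; rewrite (gE m).
have pg : posharm g.
  have hD : harmonic_on Dom w D g.
    apply: harmonic_exh => //.
    apply: within_exh => m.
    apply: (@eq_within_cont _ _ _ (ext0 (p m))); first by move=> x Lx; rewrite -gE.
    by apply/(@subspace_valL_continuousP' _ _ _ 0); have [] := Pp m.
  have g1 : g x0 = 1 by rewrite (gE 0%N _ (DL Hx0)); have [] := Pp 0%N.
  split; [exact: hD| |exact: g1].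
  apply: (harm_pos hD _ g1) => x Dx.
  have [m Lm] := in_some_LL Dx; rewrite (gE m)//.
  have [h _ _] := Pset_bounds Pp Lm Lm; apply: le_trans h.
  have [z0 Bz0] := framework_boundary Hframe (HDom m.+1).
  apply: lb_le_inf; first by exists (K m.+1 x z0), (x, z0).
  move=> _ [[s z] [/= Ls Bz] <-].
  by apply: Kge0 => //; apply: (exh_LD (ltnSn m)).
exists (fun s : D => g (val s)); first exact: posharm_H1.
apply: functional_extensionality_dep => m; apply/funext => s.
have Ls := set_valP s.
by rewrite -(ext0_val (p m)) -(gE m)// /restrict_LL (ext0_in _ (LD Ls)).
Qed.

(** The image of the extreme functions, described by countably many conditions on
    Borel functions. *)
Definition minimal_image : set PL := P `&` compatible `&`
  [set p | forall j k, exists n, (lv j < n)%N /\ variance n j p < k.+1%:R^-1].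

Lemma minimal_variance (g : FS) : E g -> forall j, (fun n => variance n j (res g)) @ \oo --> 0.
Proof.
move=> /minimal_extreme eg j.
have := extreme_small_variance eg (xD j).
move=> h; rewrite -(subrr (ext0 (g : D -> R) (xs j) ^+ 2)).
have h2 : (fun n => S n (xs j) (ext0 (g : D -> R)) - ext0 (g : D -> R) (xs j) ^+ 2) @ \oo -->
    ext0 (g : D -> R) (xs j) ^+ 2 - ext0 (g : D -> R) (xs j) ^+ 2.
  by apply: cvgB => //; exact: cvg_cst.
apply: cvg_trans h2; apply: near_eq_cvg; near=> n.
by rewrite variance_restrict//; near: n; exists (lv j).+1.
Unshelve. all: by end_near. Qed.

Lemma minimal_image_restrict (g : FS) : H g -> minimal_image (res g) -> E g.
Proof.
move=> Hg [_ vg]; apply/minimal_extreme.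
apply: small_variance_extreme; first exact/H1_posharm.
move=> j e e0; have [n [jn vn]] := vg j (Num.trunc e^-1).
exists n; split; first exact: xsD.
rewrite -variance_restrict//; apply: (lt_le_trans vn).
by rewrite -[leRHS]invrK lef_pV2 ?posrE ?invr_gt0// ltW// truncnS_gt.
Qed.

Lemma restrict_minimal (g : FS) : E g -> minimal_image (res g).
Proof.
move=> Eg; split; first by split; [apply: restrict_P => //; exact: minimal_sub|exact: compatible_restrict].
move=> j k; have k0 : 0 < k.+1%:R^-1 :> R by rewrite invr_gt0.
have /cvgr_lt/(_ _ k0) h := minimal_variance Eg j.
have hn : \forall n \near \oo, (lv j < n)%N by exists (lv j).+1.
by have [n [h1 h2]] := filter_ex (filterI h hn); exists n.
Qed.

Lemma minimal_imageE : res @` E = minimal_image.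
Proof.
apply/seteqP; split => [_ [g Eg <-]|p mp]; first exact: restrict_minimal.
have [g Hg gp] := compatible_glue mp.1.1 mp.1.2.
by exists g => //; apply: minimal_image_restrict => //; rewrite gp.
Qed.

Lemma minimal_preimage : E = res @^-1` minimal_image.
Proof.
apply/seteqP; split => [g|g mg]; first exact: restrict_minimal.
have [h Hh hg] := compatible_glue mg.1.1 mg.1.2.
by rewrite -(restrict_inj hg); apply: minimal_image_restrict => //; rewrite hg.
Qed.

Lemma minimal_image_measurable : measurable (minimal_image : set (borel PL)).
Proof.
have mP := Pset_measurable.
have mPc := compatible_measurable.
rewrite (_ : minimal_image = (P `&` compatible) `&` \bigcap_j \bigcap_k \bigcup_n
   (if (lv j < n)%N then P `&` variance n j @^-1` `]-oo, k.+1%:R^-1[ else set0)).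
  apply: measurableI => //; apply: bigcap_measurableType => j _; apply: bigcap_measurableType => k _.
  apply: bigcupT_measurable => n; case: ifPn => // jn.
  by apply: (within_cont_measurableR mP (variance_continuous jn)) => //; exact: measurable_itv.
apply/seteqP; split => [p [Pp vp]|p [Pp vp]]; split => // j.
  move=> _ k _; have [n [jn vn]] := vp j k; exists n => //; rewrite jn.
  by split; [exact: Pp.1|rewrite /= in_itv].
move=> k; have [n _] := vp j I k I; case: ifPn => // jn [_ /=]; rewrite in_itv/= => vn.
by exists n.
Qed.

Lemma minimal_measurable : measurable (E : set (borel FS)).
Proof.
rewrite minimal_preimage -[X in measurable X]setTI.
apply: (cont_measurable restrict_continuous) => //.
exact: minimal_image_measurable.
Qed.

Let cH : compact (H : set FS). Proof. exact: H1_compact. Qed.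
Let mH : measurable (H : set (borel FS)). Proof. exact: H1_measurable. Qed.
Let mE : measurable (E : set (borel FS)). Proof. exact: minimal_measurable. Qed.
Let cP : compact P. Proof. exact: Pset_compact. Qed.
Let mP : measurable (P : set (borel PL)). Proof. exact: Pset_measurable. Qed.
Let EH : E `<=` H. Proof. exact: minimal_sub. Qed.
Let coord_restrict_sep (g h : FS) : H g -> H h ->
  (forall j, coord j (res g) = coord j (res h)) -> g = h.
Proof.
by move=> Hg Hh gh; apply: restrict_inj; apply: (coord_sep _ _ gh); exact: restrict_P.
Qed.

(** * Mixtures of harmonic functions *)

Lemma eval_continuous x : continuous (fun g : FS => ext0 (g : D -> R) x).
Proof.
have [Dx|Dx] := pselect (D x); last first.
  rewrite (_ : (fun g : FS => _) = fun=> 0); first exact: cst_continuous.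
  by apply/funext => g; rewrite ext0_out.
have [m Lm] := in_some_LL Dx.
rewrite (_ : (fun g : FS => _) = (fun p : PL => ext0 (p m) x) \o res).
  move=> g; apply: continuous_comp; first exact: restrict_continuous.
  exact: eval_prod_continuous.
by apply/funext => g /=; rewrite restrictE.
Qed.

Lemma H1_bounds (g : FS) m x : H g -> L m x -> 0 <= ext0 (g : D -> R) x <= bmax D_ K m.
Proof.
move=> /H1_posharm pg Lx; have [_ g0 _] := pg; rewrite (ltW (g0 _ (LD Lx)))/=.
by have [] := posharm_bounds pg Lx Lx.
Qed.

Lemma eval_bmeas (C : set FS) x : measurable (C : set (borel FS)) -> C `<=` H ->
  bmeas (C : set (borel FS)) (fun g => ext0 (g : D -> R) x).
Proof.
move=> mC CH; split.
  apply: within_cont_measurableR => //; apply: continuous_subspaceT; exact: eval_continuous.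
have [Dx|Dx] := pselect (D x); last by exists 0 => g _; rewrite ext0_out// normr0.
have [m Lm] := in_some_LL Dx; exists (bmax D_ K m) => g /CH Hg.
by have /andP[h1 h2] := H1_bounds Hg Lm; rewrite ger0_norm.
Qed.

Section mixture_of_functions.
Variables (tau : {measure set (borel FS) -> \bar R}) (C : set FS) (u : X -> R).
Hypotheses (tfin : (tau setT < +oo)%E) (mC : measurable (C : set (borel FS))) (CH : C `<=` H).
Hypothesis uC : forall x, D x -> u x = \int[tau]_(g in (C : set (borel FS))) ext0 (g : D -> R) x.

Lemma mixture_fubini n (phi : X -> R) : {within B n, continuous phi} ->
  \int[mu n]_(y in B n) (phi y * u y) =
    \int[tau]_(g in (C : set (borel FS))) \int[mu n]_(y in B n) (phi y * ext0 (g : D -> R) y) /\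
  bmeas (C : set (borel FS)) (fun g => \int[mu n]_(y in B n) (phi y * ext0 (g : D -> R) y)).
Proof.
move=> cphi.
have cB : compact (B n) by exact: exh_cB.
have [M hM] := within_cont_bounded cB cphi.
have tC : (tau C < +oo)%E by exact: (sub_finite tfin).
have mphi := (bB cphi).1.
have [|||e1 b1 b2] := @fubini_cont R X _ (borel FS) (mu n) tau (B n) C
   (fun y g => phi y * ext0 (g : D -> R) y) (M * bmax D_ K n) (@fT n) tfin cB mC.
- move=> g /CH/H1_posharm[[cg _] _ _]; apply: within_contM => //.
  by apply: continuous_subspaceW cg; exact: BD.
- move=> y By; apply: measurable_funM; first exact: measurable_cst.
  exact: (eval_bmeas y mC CH).1.
- move=> y g By Cg; rewrite normrM; apply: ler_pM => //; first exact: hM.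
  have /andP[h1 h2] := H1_bounds (CH Cg) (BL By).
  by rewrite ger0_norm.
split=> //; rewrite -e1; apply: eq_Rint => y By.
rewrite uC; last exact: BD By.
by rewrite -(Rint_Zl mC tC); [|exact: eval_bmeas].
Qed.

Lemma variance_bmeas n j : (lv j < n)%N ->
  bmeas (C : set (borel FS)) (fun g => variance n j (res g)).
Proof.
move=> jn; apply: (@bmeas_sub _ (borel FS) R H) => //.
apply: bmeas_within.
- exact: fun_space_hausdorff.
- exact: H1_compact.
apply: (within_cont_comp (f := variance n j) (B := P)); last exact: variance_continuous.
- by apply: continuous_subspaceT; exact: restrict_continuous.
- by move=> g Hg; exact: restrict_P.
Qed.

(** The second moment is linear in the function, so it commutes with the mixture. *)
Lemma mixture_variance n j : (lv j < n)%N ->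
  \int[tau]_(g in (C : set (borel FS))) variance n j (res g) =
    S n (xs j) u - \int[tau]_(g in (C : set (borel FS))) ext0 (g : D -> R) (xs j) ^+ 2.
Proof.
move=> jn; have tC : (tau C < +oo)%E by exact: (sub_finite tfin).
have cK : {within B n, continuous (fun y => K n (xs j) y ^+ 2)}.
  have c1 := @Kcont n _ (xsD jn).
  apply: (@eq_within_cont _ _ _ (fun y => K n (xs j) y * K n (xs j) y)).
    by move=> y _; rewrite expr2.
  exact: within_contM.
have [e1 b1] := mixture_fubini cK.
rewrite /second_moment e1 -(Rint_B mC tC b1).
  by apply: eq_Rint => g _; rewrite variance_restrict.
apply: (@eq_bmeas _ (borel FS) R _ (fun g => ext0 (g : D -> R) (xs j) * ext0 (g : D -> R) (xs j))).
  by move=> g _; rewrite expr2.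
by apply: bmeasM; exact: eval_bmeas.
Qed.
End mixture_of_functions.

(** For every [j], [small_ae] makes the variances at [xs j] arbitrarily small outside
    a null set. *)
Lemma minimal_null d (T : measurableType d) (m : {measure set T -> \bar R}) (C : set T)
    (q : T -> PL) : (m setT < +oo)%E -> measurable C ->
  (forall t, C t -> (P `&` compatible) (q t)) ->
  (forall n j, (lv j < n)%N -> bmeas C (fun t => variance n j (q t))) ->
  (forall j e, 0 < e -> exists2 n, (lv j < n)%N & \int[m]_(t in C) variance n j (q t) < e) ->
  exists N : set T, [/\ measurable N, m N = 0%E & forall t, C t -> ~ N t -> minimal_image (q t)].
Proof.
move=> mfin mC qC bv small.
pose f j n t := variance (lv j + 1 + n)%N j (q t).
have fP j : measurable (C `&` ~` [set x | forall e, 0 < e -> exists n, f j n x < e]) /\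
  m (C `&` ~` [set x | forall e, 0 < e -> exists n, f j n x < e]) = 0%E.
  apply: small_ae => //.
  - by move=> n; apply: bv; lia.
  - move=> n t Ct; have [Pq cq] := qC t Ct; have [g Hg gq] := compatible_glue Pq cq.
    by rewrite /f -gq; apply: variance_ge0 => //; lia.
  - move=> e e0; have [n jn ne] := small j e e0; exists (n - (lv j).+1)%N.
    by rewrite /f (_ : (lv j + 1 + (n - (lv j).+1) = n)%N)//; lia.
exists (\bigcup_j (C `&` ~` [set x | forall e, 0 < e -> exists n, f j n x < e])).
have mU : measurable (\bigcup_j (C `&` ~` [set x | forall e, 0 < e -> exists n, f j n x < e])).
  by apply: bigcupT_measurable => j; exact: (fP j).1.
split => //.
  apply/eqP; rewrite eq_le measure_ge0 andbT.
  apply: (le_trans (measure_sigma_subadditive m (fun j => (fP j).1) mU (@subset_refl _ _))).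
  by rewrite eseries0// => i _ _; exact: (fP i).2.
move=> t Ct nt; split; first exact: qC.
move=> j k; apply: contrapT => H; apply: nt; exists j => //; split => //= h.
have [|n fn] := h k.+1%:R^-1; first by rewrite invr_gt0.
by apply: H; exists (lv j + 1 + n)%N; split => //; lia.
Qed.

(** * Existence of a representing measure *)

Section existence.
Variable u : X -> R.
Hypotheses (hu : harmonic_on Dom w D u) (u0 : forall x, D x -> 0 < u x).
Local Notation leb := (@lebesgue_measure R).
Local Notation TR := (measurableTypeR R).
Local Notation M := (u x0).
Local Notation I := (`[0, M[%classic : set TR).

Let M0 : 0 < M. Proof. exact: (u0 (exh_D (exh_x0 0))). Qed.

Let cu n : {within B n, continuous u}.
Proof. by apply: continuous_subspaceW hu.1; exact: BD. Qed.

(* The value 0 is used for the few n for which [kernel_bounds] does not apply. *)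
Let Z n j (y : X) : R := if (lv j + 2 <= n)%N then K n (xs j) y else 0.
Let c j : R := `|bmax D_ K (lv j)|.

Let mZ n j : measurable_fun (B n : set (borel X)) (Z n j : borel X -> R).
Proof.
rewrite /Z; case: leqP => [jn|_]; last exact: measurable_cst.
have Dx : D_ n (xs j) by apply: xsD; lia.
exact: (bB (@Kcont n _ Dx)).1.
Qed.

Let Zc n j y : B n y -> 0 <= Z n j y <= c j.
Proof.
rewrite /Z /c; case: ifP => [jn|_] By; last by rewrite lexx normr_ge0.
apply/andP; split.
  by apply: Kge0 => //; apply: xsD; lia.
apply: le_trans (ler_norm _).
have Lx : L (lv j) (xs j) by apply: dseqL.
by have [] := kernel_bounds jn By Lx Lx.
Qed.

Let u_mean n : \int[mu n]_(y in B n) u y = M.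
Proof. by rewrite -(mean_value hu (@LD n)). Qed.

Let normalized : posharm (fun x => M^-1 * u x).
Proof.
split.
- apply: (eq_harmonic_on (f := fun x => M^-1 * u x + 0 * u x)).
    by move=> x _; rewrite mul0r addr0.
  exact: (harmonic_lin Hframe).
- by move=> x Dx; rewrite mulr_gt0 ?invr_gt0// u0.
- by rewrite mulVf// gt_eqF.
Qed.

(** The values sampled at [t] belong to a limit of kernels at points shadowing [t],
    hence to a function [Y t] in [H].  As second moments converge as well, the
    variances have arbitrarily small integrals, and [minimal_null] applies. *)
Lemma harmonic_mixture : exists tau : {measure set (borel FS) -> \bar R},
  [/\ (tau setT < +oo)%E, tau (~` E) = 0%E &
      forall x, D x -> u x = \int[tau]_(g in (E : set (borel FS))) ext0 (g : D -> R) x].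
Proof.
have [U [G [UU sU bG GZ occ]]] := @skorokhod R _ (borel X) (fun n => mu n) B (fun=> u) M Z c
  mB fB (fun n => bB (@cu n)) (fun n y By => ltW (u0 (BD By))) u_mean mZ Zc.
(* outside the interval the normalization of u serves as default value *)
have HX t : exists g : FS, H g /\ forall j, ext0 (g : D -> R) (xs j) = if t \in I then G j t else M^-1 * u (xs j).
  have [It|It] := pselect (I t); last first.
    exists (fun s : D => M^-1 * u (val s)); split; first exact: (posharm_H1 normalized).
    by move=> j; rewrite memNset// (ext0_in _ (xD j)).
  have Hny N : exists ny : nat * X, [/\ (N <= ny.1)%N, B ny.1 ny.2 &
      forall j, (j < N)%N -> `|Z ny.1 j ny.2 - G j t| < N.+1%:R^-1].
    have [|n Nn [y By h]] := occ t It N N.+1%:R^-1; first by rewrite invr_gt0.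
    by exists (n, y).
  pose ny N := projT1 (cid (Hny N)).
  have nyP N : [/\ (N <= (ny N).1)%N, B (ny N).1 (ny N).2 &
      forall j, (j < N)%N -> `|Z (ny N).1 j (ny N).2 - G j t| < N.+1%:R^-1].
    exact: (projT2 (cid (Hny N))).
  have Uge k : U [set N | (k <= N)%N] by apply: sU; exists k.
  have [||h ph hP] := ultra_montel (I := nat) (U := U)
      (g := fun N z => K (ny N).1 z (ny N).2) UU.
  - move=> m; apply: filterS (Uge (m + 2)%N) => N /= mN; have [Nn By _] := nyP N; split.
    + apply: (harmonic_onW _ (Kharm By)).
      by apply: exh_mono; lia.
    + by apply: kernel_bounds => //; lia.
    + move=> z Dz; apply: Kge0 => //.
      by apply: (exh_mono _ Dz); lia.
  - apply: filterS (Uge 0%N) => N _ /=; have [_ By _] := nyP N.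
    exact: Kbase.
  exists (fun s : D => h (val s)); split; first exact: (posharm_H1 ph).
  move=> j; rewrite mem_set// (ext0_in _ (xD j)) /=.
  apply: (cvg_unique (@Rhausdorff R) (hP _ (xD j))).
  apply/cvgrPdist_lt => e e0.
  apply: filterS (Uge (maxn (lv j + 2) (maxn j.+1 (Num.trunc e^-1).+1))) => N /=.
  rewrite !geq_max => /and3P[N1 N2 N3]; have [Nn _ /(_ j N2)] := nyP N.
  rewrite /Z ifT; last by lia.
  rewrite distrC => h1; apply: (lt_trans h1).
  rewrite -[ltRHS]invrK ltf_pV2 ?posrE ?invr_gt0//.
  by apply: (lt_le_trans (truncnS_gt _)); rewrite ler_nat (leq_trans N3).
pose Y t := projT1 (cid (HX t)).
have YH t : H (Y t) by exact: (projT2 (cid (HX t))).1.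
have YG t j : ext0 (Y t : D -> R) (xs j) = if t \in I then G j t else M^-1 * u (xs j).
  exact: (projT2 (cid (HX t))).2.
have mI : measurable I by exact: measurable_itv.
have Ifin : (leb I < +oo)%E.
  by rewrite lebesgue_measure_itv/= lte_fin; case: ifP => _; rewrite ltry.
have mYj j : measurable_fun setT (fun t : TR => ext0 (Y t : D -> R) (xs j)).
  rewrite (_ : (fun _ => _) = fun t : TR => if t \in I then G j t else M^-1 * u (xs j)).
    have mHj : measurable_fun setT (zext I (fun t => G j t - M^-1 * u (xs j))).
      by apply: (bmeas_zext mI _).1; apply: bmeasB => //; exact: bmeas_cst.
    rewrite (_ : (fun _ => _) = fun t : TR => zext I (fun t => G j t - M^-1 * u (xs j)) t + M^-1 * u (xs j)).
      by apply: measurable_funD => //; exact: measurable_cst.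
    by apply/funext => t; rewrite /zext; case: ifP => _; rewrite ?add0r// subrK.
  by apply/funext => t; rewrite YG.
have mY : measurable_fun setT (Y : TR -> borel FS).
  apply: (@measurable_into R FS H (fun j (g : FS) => coord j (res g))) => //.
  - by move=> j; apply: continuous_subspaceT => g; apply: continuous_comp; [exact: restrict_continuous|exact: coord_continuous].
  - move=> j; rewrite /coord; case: (unpickle j) => [[m i]|]; last exact: measurable_cst.
    have [Lx|Lx] := pselect (L m (xs i)).
      apply: eq_measurable_fun (mYj i) => t _ /=; by rewrite restrictE.
    apply: eq_measurable_fun (measurable_cst (0 : R)) => t _ /=; by rewrite ext0_out.
pose mr : {measure set TR -> \bar R} := mrestr leb mI.
pose tau : {measure set (borel FS) -> \bar R} := image_measure mr mY.
have mrfin : (mr setT < +oo)%E by rewrite /mr /= /mrestr setTI.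
have taufin : (tau setT < +oo)%E by rewrite /tau /= /image_measure /pushforward preimage_setT.
have int_tau (h : FS -> R) : bmeas (H : set (borel FS)) h ->
    \int[tau]_(g in (H : set (borel FS))) h g = \int[leb]_(t in I) h (Y t).
  move=> bh.
  have [mh [Mh hM]] := bh; have bhY : bmeas (setT : set TR) (fun t => h (Y t)).
    split; last by exists Mh => t _; exact: hM.
    rewrite -(_ : Y @^-1` H = setT); last by apply/seteqP; split => // t _; exact: YH.
    move=> mYH A mA; have := mY measurableT _ (mh mH A mA).
    by rewrite setTI preimage_setI.
  rewrite /Rintegral [in LHS](integral_image mY mrfin mH bh) /=.
  rewrite (_ : Y @^-1` H = setT); last by apply/seteqP; split => // t _; exact: YH.
  rewrite /Rintegral; congr fine.
  rewrite (@negligible_integral _ _ _ mr setT (~` I)) //; last 3 first.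
  - exact: measurableC.
  - exact: (bmeas_integrable measurableT mrfin bhY).
  - by rewrite /mr /= /mrestr setICl measure0.
  rewrite setTD setCK; apply: eq_measure_integral => A mA AI.
  by rewrite /mr /= /mrestr setIidl.
have bev x : bmeas (H : set (borel FS)) (fun g => ext0 (g : D -> R) x).
  exact: (eval_bmeas x mH (@subset_refl _ _)).
have evI j : \int[tau]_(g in (H : set (borel FS))) ext0 (g : D -> R) (xs j) = u (xs j).
  rewrite int_tau//; have [h _] := GZ j.
  rewrite (_ : \int[leb]_(t in I) _ = \int[leb]_(t in I) G j t); last first.
    by apply: eq_Rint => t It; rewrite YG mem_set.
  apply: esym; apply: (cvg_unique (@Rhausdorff R) _ h).
  apply: cvg_near_cst; have Hn : U [set n | (lv j + 2 <= n)%N] by apply: sU; exists (lv j + 2)%N.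
  apply: filterS Hn => n /= jn; have Dx : D_ n (xs j) by apply: xsD; lia.
  rewrite (Krep hu (@LD n) Dx).
  by apply: eq_Rint => y _; rewrite /Z jn.
have tauHM : fine (tau H) = M.
  rewrite /tau /= /image_measure /pushforward (_ : Y @^-1` H = setT); last first.
    by apply/seteqP; split => // t _; exact: YH.
  by rewrite /mr /= /mrestr setTI lebesgue_measure_itv/= lte_fin M0 -EFinD subr0.
have tH : (tau H < +oo)%E by exact: (sub_finite taufin).
have Hu x : D x -> u x = \int[tau]_(g in (H : set (borel FS))) ext0 (g : D -> R) x.
  move=> Dx; have [m Lx] := in_some_LL Dx.
  suff : M^-1 * u x = M^-1 * \int[tau]_(g in (H : set (borel FS))) ext0 (g : D -> R) x.
    by apply: mulfI; rewrite invr_neq0// gt_eqF.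
  apply: (dseq_sep (m := m)
    (g := fun x => M^-1 * u x)
    (h := fun x => M^-1 * \int[tau]_(g in (H : set (borel FS))) ext0 (g : D -> R) x)) => //.
  - exact: (posharm_Om normalized).
  - move=> a b La Lb; rewrite -mulrBr normrM gtr0_norm ?invr_gt0// mulrC ler_pdivrMr//.
    rewrite -tauHM; apply: Rint_dist => // g /H1_posharm pg.
    exact: (posharm_Om pg).
  - by move=> j _; rewrite evI.
have var0 j e : 0 < e -> exists2 n, (lv j < n)%N & \int[tau]_(g in (H : set (borel FS))) variance n j (res g) < e.
  move=> e0; have [_ h] := GZ j.
  have Hn : U [set n | (lv j + 2 <= n)%N] by apply: sU; exists (lv j + 2)%N.
  move/cvgrPdist_lt: h => /(_ e e0) h.
  have [n [/= jn hn]] := filter_ex (filterI Hn h).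
  have jn1 : (lv j < n)%N by move: jn; rewrite addn2 => /ltnW.
  exists n => //.
  rewrite (mixture_variance taufin mH (@subset_refl _ _) Hu jn1).
  apply: le_lt_trans hn; rewrite distrC; apply: le_trans (ler_norm _).
  rewrite int_tau; last first.
    apply: (@eq_bmeas _ (borel FS) R _ (fun g => ext0 (g : D -> R) (xs j) * ext0 (g : D -> R) (xs j))).
      by move=> g _; rewrite expr2.
    exact: bmeasM.
  rewrite le_eqVlt; apply/orP; left; apply/eqP; congr (_ - _).
    by apply: eq_Rint => y _; rewrite /Z jn.
  by apply: eq_Rint => t It; rewrite YG mem_set.
have tauH : tau (~` H) = 0%E.
  rewrite /tau /= /image_measure /pushforward (_ : Y @^-1` _ = set0) ?measure0//.
  by apply/seteqP; split => // t; apply; exact: YH.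
have [|n j jn|j e e0|N [mN N0 NE]] := minimal_null (C := (H : set (borel FS)))
   (q := res) taufin mH.
- by move=> g Hg; split; [exact: restrict_P|exact: compatible_restrict].
- exact: (variance_bmeas (@subset_refl _ _) jn).
- exact: var0.
have HE : H `&` ~` E `<=` N.
  move=> g [Hg Eg]; apply: contrapT => Ng; apply: Eg.
  by apply: (minimal_image_restrict Hg); exact: NE.
have mHN : measurable (~` (H : set (borel FS)) `|` N) by apply: measurableU => //; exact: measurableC.
have tauE : tau (~` E) = 0%E.
  apply: (@subset_measure0 _ _ _ tau _ (~` (H : set (borel FS)) `|` N)) => //; first exact: measurableC.
    by move=> g Eg; have [Hg|Hg] := pselect (H g); [right; exact: HE|left].
  have := @measureU0 _ _ _ tau (~` (H : set (borel FS))) N (measurableC mH) mN N0.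
  by rewrite tauH.
exists tau; split => // x Dx; rewrite Hu//.
exact: (Rint_carried taufin mH mE EH tauE (bev x)).
Qed.
End existence.

(** * Weak convergence *)

Lemma ext0_Tmap n m y x : L m x -> ext0 ((Tm n y : PL) m) x = if (m + 2 <= n)%N then K n x y else 1.
Proof. by move=> Lx; rewrite (ext0_in _ Lx). Qed.

Lemma Tmap_P n y : B n y -> P (Tm n y).
Proof.
move=> By m.
pose f x := if (m + 2 <= n)%N then K n x y else 1.
have fE x : L m x -> f x = ext0 ((Tm n y : PL) m) x by move=> Lx; rewrite ext0_Tmap.
have [hf gf] : harmonic_on Dom w (D_ m) f /\ {within L m, continuous f}.
  rewrite /f; case: leqP => mn.
    have hK := Kharm By.
    split; first by apply: (harmonic_onW _ hK); apply: exh_mono; lia.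
    by apply: continuous_subspaceW hK.1; apply: exh_LD; lia.
  by split; [exact: (harmonic_cst Hframe)|exact: within_cont_cst].
split.
- apply/(@subspace_valL_continuousP' _ _ _ 0); exact: eq_within_cont gf.
- by apply: (eq_harmonic_on _ hf) => x /DL Lx; rewrite fE.
- have := fE x0 (DL (exh_x0 m)); rewrite /f => <-; case: leqP => // _.
  exact: (Kbase By).
- move=> i s t im Ls Lt.
  have Lms : L m s by exact: (exh_Lmono im).
  have Lmt : L m t by exact: (exh_Lmono im).
  rewrite -!fE// /f; case: leqP => mn.
    by apply: (kernel_bounds _ By) => //; lia.
  by apply: (harmonic_bounds (harmonic_cst Hframe setT 1)).
Qed.

Lemma crd_Tmap n j : {within B n, continuous (fun y => coord j (Tm n y))}.
Proof.
rewrite /coord; case: (unpickle j) => [[m i]|]; last exact: within_cont_cst.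
have [Lx|Lx] := pselect (L m (xs i)); last first.
  apply: (@eq_within_cont _ _ _ (fun=> 0)); last exact: within_cont_cst.
  by move=> y _; rewrite ext0_out.
apply: (@eq_within_cont _ _ _ (fun y => if (m + 2 <= n)%N then K n (xs i) y else 1)).
  by move=> y _; rewrite ext0_Tmap.
case: leqP => mn; last exact: within_cont_cst.
apply: (@Kcont); apply: (exh_LD _ Lx); lia.
Qed.

Lemma Tmap_continuous n : {within B n, continuous (Tm n : X -> PL)}.
Proof.
apply: (@coord_within_continuous R PL P coord) => //.
- by move=> j; exact: coord_within.
- by move=> p q; exact: coord_sep.
- exact: Tmap_P.
- exact: crd_Tmap.
Qed.

Lemma Tmap_measurable n : measurable_fun (B n : set (borel X)) (Tm n : borel X -> borel PL).
Proof. by apply: within_cont_measurable => //; exact: Tmap_continuous. Qed.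

Section test_functions.
Variable f : PL -> R.
Hypothesis cf : {within P, continuous f}.

Lemma Tmap_test n : {within B n, continuous (fun y => f (Tm n y))}.
Proof. by apply: (within_cont_comp (@Tmap_continuous n) (@Tmap_P n) cf). Qed.

Lemma rho_integral (u : X -> R) n : {within B n, continuous u} -> (forall y, B n y -> 0 <= u y) ->
  (\int[rho w x0 D_ K u n]_(p in P) (f p)%:E)%E = (\int[mu n]_(y in B n) (f (Tm n y) * u y))%:E.
Proof.
move=> cu u0.
have bu := bB cu.
have bf : bmeas (P : set (borel PL)) (f : borel PL -> R).
  by apply: bmeas_within => //; exact: prod_LL_hausdorff.
exact: (integral_density_push (fT n) (mB n) bu u0 (@Tmap_measurable n) mP (@Tmap_P n) bf).
Qed.

Let bP : bmeas (P : set (borel PL)) (f : borel PL -> R).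
Proof. by apply: bmeas_within => //; exact: prod_LL_hausdorff. Qed.

Let cH1 n (g : FS) : H g -> {within B n, continuous (ext0 (g : D -> R))}.
Proof. by move=> /H1_posharm[[cg _] _ _]; apply: continuous_subspaceW cg; exact: BD. Qed.

Let crd_spread j n (g : FS) y : R := (coord j (Tm n y) - coord j (res g)) ^+ 2.

Let spread_cont j n (g : FS) : H g ->
  {within B n, continuous (fun y => crd_spread j n g y * ext0 (g : D -> R) y)}.
Proof.
move=> Hg; apply: within_contM; last exact: cH1.
have c : {within B n, continuous (fun y => coord j (Tm n y) - coord j (res g))}.
  by apply: within_contB; [exact: crd_Tmap|exact: within_cont_cst].
apply: (eq_within_cont _ (within_contM c c)) => y _; by rewrite /crd_spread expr2.
Qed.

Lemma spread_cvg j (g : FS) : E g ->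
  (fun n => \int[mu n]_(y in B n) (crd_spread j n g y * ext0 (g : D -> R) y)) @ \oo --> (0 : R).
Proof.
move=> Eg; have Hg := EH Eg.
have zero : (forall n y, coord j (Tm n y) = coord j (res g)) ->
    (fun n => \int[mu n]_(y in B n) (crd_spread j n g y * ext0 (g : D -> R) y)) @ \oo --> (0 : R).
  move=> h; apply: cvg_near_cst; apply: nearW => n.
  rewrite (_ : \int[_]_(_ in _) _ = \int[mu n]_(y in B n) 0).
    by rewrite Rintegral_cst// mul0r.
  by apply: eq_Rint => y _; rewrite /crd_spread h subrr expr0n mul0r.
case Ej : (unpickle j : option (nat * nat)) => [[m i]|]; last by apply: zero => n y; rewrite /coord Ej.
have [Lx|Lx] := pselect (L m (xs i)); last first.
  by apply: zero => n y; rewrite /coord Ej !ext0_out.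
have := minimal_variance Eg i.
apply: cvg_trans; apply: near_eq_cvg; near=> n.
have mn : (m + 2 <= n)%N by near: n; exists (m + 2)%N.
have jn : (lv i < n)%N by near: n; exists (lv i).+1.
rewrite variance_restrict// -second_moment_spread //.
- by apply: eq_Rint => y _; rewrite /crd_spread /coord Ej ext0_Tmap// mn restrictE.
- exact/H1_posharm.
- exact: xsD.
Unshelve. all: by end_near. Qed.

(** Chebyshev's inequality: [f (Tm n y)] is close to [f (res g)] unless one of finitely
    many coordinates is off by [d], and their mean square errors tend to 0. *)
Lemma minimal_test (g : FS) : E g ->
  (fun n => \int[mu n]_(y in B n) (f (Tm n y) * ext0 (g : D -> R) y)) @ \oo --> f (res g).
Proof.
move=> Eg; have Hg := EH Eg; have /H1_posharm [hg g0 g1] := Hg.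
have [F hF] := within_cont_bounded cP cf.
have F0 : 0 <= F by apply: (le_trans _ (hF _ (restrict_P Hg))).
apply/cvgrPdist_lt => e e0.
have e2 : 0 < e / 2 by rewrite divr_gt0.
have [N [d d0 close]] := @coord_modulus R PL P coord f cP (@coord_within) (@coord_sep) cf
  (res g) (e / 2) (restrict_P Hg) e2.
pose c := 2 * F / d ^+ 2.
have c0 : 0 <= c by apply: divr_ge0; [exact: mulr_ge0|exact: sqr_ge0].
have bound n y : B n y ->
    `|f (Tm n y) - f (res g)| <= e / 2 + c * \sum_(j < N) crd_spread j n g y.
  move=> By; have PT := Tmap_P By.
  have s0 : 0 <= \sum_(j < N) crd_spread j n g y by apply: sumr_ge0 => j _; exact: sqr_ge0.
  have [h|/existsNP[j /not_implyP[jN /negP]]] :=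
      pselect (forall j, (j < N)%N -> `|coord j (Tm n y) - coord j (res g)| < d).
    by apply: ltW; apply: (lt_le_trans (close _ PT h)); rewrite lerDl mulr_ge0.
  rewrite -leNgt => dj.
  apply: (@le_trans _ _ (2 * F)).
    apply: (le_trans (ler_normB _ _)); rewrite mulrDl mul1r; apply: lerD; [exact: hF|exact/hF/restrict_P].
  apply: (@le_trans _ _ (c * crd_spread j n g y)).
    rewrite /c mulrAC ler_pdivlMr ?exprn_gt0// ler_wpM2l ?mulr_ge0//.
    by rewrite /crd_spread -(real_normK (num_real (coord j (Tm n y) - _))) lerXn2r ?nnegrE// ltW.
  apply: ler_wpDl; first exact: ltW.
  rewrite ler_wpM2l// (bigD1 (Ordinal jN))//= lerDl; apply: sumr_ge0 => i _; exact: sqr_ge0.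
have sums : (fun n => \sum_(j < N) \int[mu n]_(y in B n)
    (crd_spread j n g y * ext0 (g : D -> R) y)) @ \oo --> (0 : R).
  elim: N {close bound} => [|N IH].
    rewrite (_ : (fun n => _) = fun=> 0); first exact: cvg_cst.
    by apply/funext => n; rewrite big_ord0.
  rewrite (_ : (fun n => _) = fun n =>
    \sum_(j < N) \int[mu n]_(y in B n) (crd_spread j n g y * ext0 (g : D -> R) y) +
    \int[mu n]_(y in B n) (crd_spread N n g y * ext0 (g : D -> R) y)).
    by rewrite -[X in _ --> X]addr0; apply: cvgD => //; exact: spread_cvg.
  by apply/funext => n; rewrite big_ord_recr.
have lim : (fun n => e / 2 + c * \sum_(j < N) \int[mu n]_(y in B n)
    (crd_spread j n g y * ext0 (g : D -> R) y)) @ \oo --> e / 2 + c * 0.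
  by apply: cvgD; [exact: cvg_cst|apply: cvgM => //; exact: cvg_cst].
rewrite mulr0 addr0 in lim.
have e2e : e / 2 < e by rewrite ltr_pdivrMr// ltr_pMr// ltr1n.
have /cvgr_lt/(_ _ e2e) h := lim.
apply: filterS h => n; apply: le_lt_trans.
have bg := bB (@cH1 n g Hg).
have bfg : bmeas (B n : set (borel X)) (fun y => f (Tm n y) * ext0 (g : D -> R) y).
  by apply: bmeasM => //; apply: bB; exact: Tmap_test.
have gint : \int[mu n]_(y in B n) ext0 (g : D -> R) y = 1.
  by rewrite -(mean_value hg (@LD n)).
have bfr : bmeas (B n : set (borel X)) (fun y => f (res g) * ext0 (g : D -> R) y).
  by apply: bmeasM => //; exact: bmeas_cst.
rewrite distrC.
have -> : f (res g) = \int[mu n]_(y in B n) (f (res g) * ext0 (g : D -> R) y).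
  by rewrite (Rint_Zl (mB n) (fB n) _ bg) gint mulr1.
have [bs es] := Rint_sum N (mB n) (fB n) (fun j => bB (@spread_cont j n g Hg)).
rewrite -(Rint_B (mB n) (fB n) bfg bfr).
apply: (le_trans (Rint_norm (mB n) (fB n) (bmeasB bfg bfr))).
have e2E : e / 2 = \int[mu n]_(y in B n) (e / 2 * ext0 (g : D -> R) y).
  by rewrite (Rint_Zl (mB n) (fB n) _ bg) gint mulr1.
rewrite -es -(Rint_Zl (mB n) (fB n) _ bs) [X in _ <= X + _]e2E.
have b1 : bmeas (B n : set (borel X)) (fun y => e / 2 * ext0 (g : D -> R) y).
  by apply: bmeasM => //; exact: bmeas_cst.
have b2 : bmeas (B n : set (borel X))
    (fun y => c * \sum_(j < N) (crd_spread j n g y * ext0 (g : D -> R) y)).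
  by apply: bmeasM => //; exact: bmeas_cst.
rewrite -(Rint_D (mB n) (fB n) b1 b2).
apply: (le_Rint (mB n) (fB n)).
- by apply: bmeas_norm; exact: bmeasB.
- exact: bmeasD.
move=> y By; have gy : 0 <= ext0 (g : D -> R) y by apply/ltW/g0; exact: (BD By).
rewrite -mulrBl normrM (ger0_norm gy) -mulr_suml mulrA -mulrDl.
by apply: ler_wpM2r => //; exact: bound.
Qed.

Section representing_measure.
Variables (u : X -> R) (tau : {measure set (borel FS) -> \bar R}).
Hypotheses (cu : {within D, continuous u}).
Hypotheses (tfin : (tau setT < +oo)%E).
Hypothesis uE : forall x, D x -> u x = \int[tau]_(g in (E : set (borel FS))) ext0 (g : D -> R) x.

(** By Fubini the integrals are averages of those of [minimal_test] over [tau]. *)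
Lemma test_cvg : bmeas (E : set (borel FS)) (fun g => f (res g)) /\
  (fun n => \int[mu n]_(y in B n) (f (Tm n y) * u y)) @ \oo -->
    \int[tau]_(g in (E : set (borel FS))) f (res g).
Proof.
have [F hF] := within_cont_bounded cP cf.
have tE : (tau E < +oo)%E by exact: (sub_finite tfin).
have fub n := mixture_fubini tfin mE EH uE (@Tmap_test n).
have [|||bE lim] := @Rint_dominated R _ (borel FS) tau E mE tE
   (fun n g => \int[mu n]_(y in B n) (f (Tm n y) * ext0 (g : D -> R) y)) (fun g => f (res g)) F.
- by move=> n; exact: (fub n).2.1.
- move=> n g Eg; have Hg := EH Eg; have /H1_posharm [hg g0 g1] := Hg.
  have bg := bB (@cH1 n g Hg).
  have bfg : bmeas (B n : set (borel X)) (fun y => f (Tm n y) * ext0 (g : D -> R) y).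
    by apply: bmeasM => //; apply: bB; exact: Tmap_test.
  apply: (le_trans (Rint_norm (mB n) (fB n) bfg)).
  rewrite -[leRHS]mulr1 -g1 (mean_value hg (@LD n)).
  rewrite -(Rint_Zl (mB n) (fB n) _ bg); apply: (le_Rint (mB n) (fB n)).
  + exact: bmeas_norm.
  + by apply: bmeasM => //; exact: bmeas_cst.
  move=> y By; have gy : 0 <= ext0 (g : D -> R) y by apply/ltW/g0; exact: (BD By).
  by rewrite normrM (ger0_norm gy) ler_wpM2r//; apply: hF; exact: Tmap_P.
- exact: minimal_test.
split => //; apply: cvg_trans lim; apply: near_eq_cvg; apply: nearW => n.
by rewrite (fub n).1.
Qed.
End representing_measure.
End test_functions.

(** * Uniqueness *)

Lemma representsP (u : X -> R) (tau : {finite_measure set (borel FS) -> \bar R}) :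
  represents Dom w x0 u tau <->
  tau (~` E) = 0%E /\ forall x, D x -> u x = \int[tau]_(g in (E : set (borel FS))) ext0 (g : D -> R) x.
Proof.
have tfin : (tau setT < +oo)%E by rewrite ltey_eq fin_num_measure.
have tE : (tau E < +oo)%E by exact: (sub_finite tfin).
have bev x : bmeas (E : set (borel FS)) (fun g => ext0 (g : D -> R) x).
  exact: (eval_bmeas x mE EH).
split=> [[[_ t0] hE]|[t0 hE]]; split => //.
  move=> x Dx; apply: EFin_inj; rewrite -(Rint_EFin mE tE (bev x)).
  rewrite (hE (exist _ x (mem_set Dx))); apply: eq_integral => g _.
  by rewrite (ext0_in _ Dx).
move=> s; rewrite (hE _ (set_valP s)) -(Rint_EFin mE tE (bev _)).
by apply: eq_integral => g _; rewrite ext0_val.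
Qed.

Lemma test_preimage (m : {measure set (borel FS) -> \bar R}) (f : PL -> R) :
  (m setT < +oo)%E -> m (~` E) = 0%E -> {within P, continuous f} ->
  (\int[pushforward m (res : borel FS -> borel PL)]_(p in (P : set (borel PL))) (f p)%:E)%E =
  (\int[m]_(g in (E : set (borel FS))) f (res g))%:E.
Proof.
move=> mfin mE0 cf; have mres := cont_measurable restrict_continuous.
have bP : bmeas (P : set (borel PL)) (f : borel PL -> R).
  by apply: bmeas_within => //; exact: prod_LL_hausdorff.
rewrite (integral_image mres mfin mP bP); congr EFin.
have mrP : measurable (res @^-1` P : set (borel FS)).
  by rewrite -[X in measurable X]setTI; exact: mres.
apply: Rint_carried => //; first by move=> g /EH; exact: restrict_P.
split; last by have [_ [M hM]] := bP; exists M => g; exact: hM.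
move=> _ A mA; have := mres measurableT _ (bP.1 mP A mA).
by rewrite setTI preimage_setI.
Qed.

(** By [test_cvg] both measures have the same integrals of test functions. *)
Lemma representing_unique (u : X -> R) (tau sig : {measure set (borel FS) -> \bar R}) :
  {within D, continuous u} ->
  (tau setT < +oo)%E -> (sig setT < +oo)%E -> tau (~` E) = 0%E -> sig (~` E) = 0%E ->
  (forall x, D x -> u x = \int[tau]_(g in (E : set (borel FS))) ext0 (g : D -> R) x) ->
  (forall x, D x -> u x = \int[sig]_(g in (E : set (borel FS))) ext0 (g : D -> R) x) ->
  forall A : set (borel FS), measurable A -> tau A = sig A.
Proof.
move=> cu tfin sfin tE sE ut us.
have toH (m : {measure set (borel FS) -> \bar R}) : m (~` E) = 0%E -> m (~` (H : set (borel FS))) = 0%E.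
  move=> m0; apply: (subset_measure0 _ _ _ m0); [exact: measurableC|exact: measurableC|].
  by move=> g Hg Eg; apply: Hg; exact: EH.
apply: (@coord_measure_unique R FS H (fun j g => coord j (res g)) cH _ _ tau sig PL P coord) => //.
- by move=> j; apply: continuous_subspaceT => g; apply: continuous_comp; [exact: restrict_continuous|exact: coord_continuous].
- by move=> j; exact: coord_within.
- exact: toH.
- exact: toH.
move=> f cf.
have bH (m : {measure set (borel FS) -> \bar R}) : bmeas (H : set (borel FS)) (fun g => f (fun j => coord j (res g))).
  apply: bmeas_within => //; first exact: fun_space_hausdorff.
  apply: (within_cont_comp (q := res) (f := fun p => f (fun j => coord j p)) _ _ cf); last exact: restrict_P.
  by apply: continuous_subspaceT; exact: restrict_continuous.
rewrite (Rint_carried tfin mH mE EH tE (bH tau)) (Rint_carried sfin mH mE EH sE (bH sig)).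
have [_ c1] := test_cvg cf tfin ut.
have [_ c2] := test_cvg cf sfin us.
exact: (cvg_unique (@Rhausdorff R) c1 c2).
Qed.

(** * Limits in a compactification *)

Section compactification.
Variables (Dh : pmetricType R) (j : D -> Dh).
Hypotheses (cDh : compact [set: Dh]) (ej : embedding j).
Local Notation jx := (valL_ point j : X -> Dh).
Local Notation DP := (Dh * PL)%type.
Local Notation W := ([set: Dh] `*` P).

Let jx_val (s : D) : jx (val s) = j s.
Proof. by have := congr1 (@^~ s) (valLK point j); rewrite /sigL. Qed.

Let jxE x (Dx : D x) : jx x = j (exist _ x (mem_set Dx)).
Proof. by rewrite -jx_val. Qed.

Let cj : continuous j.
Proof. by apply/continuousP => V oV; apply/ej.2; exists V. Qed.

Let cjx : {within D, continuous jx}.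
Proof. exact/(@subspace_valL_continuousP' _ _ _ point). Qed.

Let cfst : continuous (fst : DP -> Dh).
Proof. by move=> p; exact: cvg_fst. Qed.
Let csnd : continuous (snd : DP -> PL).
Proof. by move=> p; exact: cvg_snd. Qed.

Let mW : measurable (W : set (borel DP)).
Proof.
rewrite (_ : W = snd @^-1` P); last by apply/seteqP; split => p //= [].
rewrite -[X in measurable X]setTI; exact: (cont_measurable csnd).
Qed.

Lemma pair_continuous n : {within B n, continuous (fun y => (jx y, Tm n y : PL))}.
Proof.
have c1 := continuous_subspaceW (@BD n) cjx.
have c2 := @Tmap_continuous n.
apply/subspace_continuousP => y By.
move/subspace_continuousP/(_ y By): c1 => c1; move/subspace_continuousP/(_ y By): c2 => c2.
exact: cvg_pair c1 c2.
Qed.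

Lemma Lambda_integral (f : DP -> R) (u : X -> R) n : {within W, continuous f} ->
  {within B n, continuous u} -> (forall y, B n y -> 0 <= u y) ->
  (\int[Lambda w x0 D_ K j u n]_(p in W) (f p)%:E)%E =
    (\int[mu n]_(y in B n) (f (jx y, Tm n y : PL) * u y))%:E.
Proof.
move=> cf cu u0.
have bf : bmeas (W : set (borel DP)) (f : borel DP -> R).
  split; first exact: within_cont_measurableR.
  by apply: within_cont_bounded cf; exact: compact_setX.
apply: (integral_density_push (fT n) (mB n) (bB cu) u0 _ mW _ bf).
  by apply: within_cont_measurable => //; exact: pair_continuous.
by move=> y By; split => //; exact: (Tmap_P By).
Qed.

Section weak_limit.
Variables (u : X -> R) (sig : {measure set (borel FS) -> \bar R}).
Variables (phi : nat -> nat) (m : {measure set (borel DP) -> \bar R}).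
Hypotheses (hu : harmonic_on Dom w D u) (u0 : forall x, D x -> 0 < u x).
Hypotheses (sfin : (sig setT < +oo)%E) (sE : sig (~` E) = 0%E).
Hypothesis us : forall x, D x -> u x = \int[sig]_(g in (E : set (borel FS))) ext0 (g : D -> R) x.
Hypotheses (phi_mono : {homo phi : a b / (a < b)%N}) (mfin : (m setT < +oo)%E).
Hypothesis mWC : m (~` W) = 0%E.
Hypothesis lim : weakly_cvg_on W (fun k => Lambda w x0 D_ K j u (phi k)) m.

Let phi_ge k : (k <= phi k)%N.
Proof.
elim: k => // k IH; apply: (leq_ltn_trans IH); exact: phi_mono.
Qed.

Let phi_infty : phi @ \oo --> \oo.
Proof.
by move=> A [N _ NA]; exists N => // k /= Nk; apply: NA => /=; exact: leq_trans (phi_ge k).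
Qed.

Lemma weak_limit_test (f : DP -> R) : {within W, continuous f} ->
  (fun k => \int[mu (phi k)]_(y in B (phi k)) (f (jx y, Tm (phi k) y : PL) * u y)) @ \oo -->
    \int[m]_(p in (W : set (borel DP))) f p.
Proof.
move=> cf; have := lim cf.
have bf : bmeas (W : set (borel DP)) (f : borel DP -> R).
  split; first exact: within_cont_measurableR.
  by apply: within_cont_bounded cf; exact: compact_setX.
have mfW : (m W < +oo)%E by exact: (sub_finite mfin).
rewrite (Rint_EFin mW mfW bf) => h.
have {}h := fine_cvg h.
rewrite (_ : (fun k => _) = fun k => fine (\int[Lambda w x0 D_ K j u (phi k)]_(p in W) (f p)%:E)%E); first exact: h.
apply/funext => k; rewrite Lambda_integral//.
  by apply: continuous_subspaceW hu.1; exact: BD.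
by move=> y By; apply/ltW/u0; exact: (BD By).
Qed.

Let msnd : measurable_fun setT (snd : borel DP -> borel PL).
Proof. exact: cont_measurable. Qed.

(** Test functions of the second variable only see the measures of [test_cvg]. *)
Lemma weak_limit_snd (A : set PL) : measurable (A : set (borel PL)) ->
  m (snd @^-1` A) = sig (res @^-1` A).
Proof.
move=> mA; have mres := cont_measurable restrict_continuous.
apply: (@coord_measure_unique R PL P coord cP _ _ (image_measure m msnd) (image_measure sig mres) PL P coord) => //.
- by move=> i; exact: coord_within.
- by move=> p q; exact: coord_sep.
- by move=> i; exact: coord_within.
- rewrite /= /image_measure /pushforward -mWC; congr (m _).
  by apply/seteqP; split => p /= h; [case|move=> Pp; apply: h].
- rewrite /= /image_measure /pushforward; apply/eqP; rewrite eq_le measure_ge0 andbT -sE.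
  apply: le_measure; rewrite ?inE.
  + have := mres measurableT _ (measurableC mP); by rewrite setTI.
  + exact: measurableC.
  + by move=> g /= nP Eg; apply: nP; apply: restrict_P; exact: EH.
move=> f cf.
have -> : \int[image_measure sig mres]_(p in (P : set (borel PL))) f (coord^~ p) =
    \int[sig]_(g in (E : set (borel FS))) f (fun i => coord i (res g)).
  rewrite /Rintegral.
  by have -> := test_preimage sfin sE cf.
have bP : bmeas (P : set (borel PL)) (fun p => f (coord^~ p)).
  by apply: bmeas_within => //; exact: prod_LL_hausdorff.
have -> : \int[image_measure m msnd]_(p in (P : set (borel PL))) f (coord^~ p) =
    \int[m]_(p in (W : set (borel DP))) f (coord^~ p.2).
  rewrite [LHS]/Rintegral; have -> := integral_image msnd mfin mP bP.
  by congr Rintegral; apply/seteqP; split => p //= [].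
have cfW : {within W, continuous (fun p : DP => f (coord^~ p.2))}.
  apply: (within_cont_comp (q := snd) (f := fun p => f (coord^~ p)) _ _ cf) => //.
    exact: continuous_subspaceT.
  by move=> p [].
have c1 := weak_limit_test cfW.
have [_ c2] := test_cvg cf sfin us.
have {}c2 := cvg_comp _ _ phi_infty c2.
exact: (cvg_unique (@Rhausdorff R) c1 c2).
Qed.

Let mdist_continuous (z : Dh) : continuous (mdist z : Dh -> R).
Proof.
move=> y; apply/cvgrPdist_lt => e e0.
apply: (@filterS _ (nbhs y) _ (ball y e)); last exact: nbhsx_ballx.
move=> y'; rewrite ballEmdist /= => h.
apply: le_lt_trans h; rewrite ler_norml.
have := metric_triangle z y y'; have := metric_triangle z y' y.
by rewrite (metric_sym y' y) => h1 h2; apply/andP; split; lra.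
Qed.

(** A continuous function supported in a small ball around [jx x], which contains
    no points of [D] outside [D_ k], vanishes on the boundaries of the later domains. *)
Lemma weak_limit_fst x : D x -> exists V : set Dh,
  [/\ open V, V (jx x) & m ((V `*` setT) `&` W) = 0%E].
Proof.
move=> Dx; have [k Dk] : exists k, D_ k x by move: Dx; rewrite {1}Hunion => -[k _ Dk]; exists k.
have oS : open (val @^-1` D_ k : set D).
  have cv : continuous (val : D -> X) by exact: initial_continuous.
  by move/continuousP: cv; apply; exact: exh_open.
have [A oA jA] := (ej.2 _).1 oS.
have Ax : A (jx x) by rewrite jxE; have : (j @^-1` A) (exist _ x (mem_set Dx)) by rewrite jA.
have : nbhs (jx x) A by exact: open_nbhs_nbhs.
move=> /nbhs_ballP[r /= r0 rA].
pose psi (p : DP) : R := Num.max 0 (r - mdist (jx x) p.1).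
have cpsi : {within W, continuous psi}.
  apply: within_cont_max; first exact: within_cont_cst.
  apply: within_contB; first exact: within_cont_cst.
  apply: continuous_subspaceT => p.
  apply: (@continuous_comp _ _ _ (fst : DP -> Dh) (mdist (jx x) : Dh -> R)).
    exact: cfst.
  exact: mdist_continuous.
have psi0 p : 0 <= psi p by rewrite le_max lexx.
have psiB n y : (k <= n)%N -> B n y -> psi (jx y, Tm n y : PL) = 0.
  move=> kn By; have Dy : D y := BD By.
  apply/eqP; rewrite /psi/= eq_le le_max lexx andbT ge_max lexx/= subr_le0 leNgt; apply/negP => h.
  have : A (jx y) by apply: rA; rewrite ballEmdist.
  rewrite (jxE Dy) => Ay; have : (val @^-1` D_ k) (exist _ y (mem_set Dy)) by rewrite -jA.
  exact: (exh_BnotD kn By).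
have int0 : \int[m]_(p in (W : set (borel DP))) psi p = 0.
  apply: (cvg_unique (@Rhausdorff R) (weak_limit_test cpsi)).
  apply: cvg_near_cst; exists k => // n /= kn.
  rewrite (_ : \int[_]_(_ in _) _ = \int[mu (phi n)]_(y in B (phi n)) 0).
    by rewrite Rintegral_cst// mul0r.
  by apply: eq_Rint => y By; rewrite psiB ?mul0r// (leq_trans kn).
pose V0 : set Dh := [set z | mdist (jx x) z < r / 2].
have oV0 : open V0.
  have /continuousP h := @mdist_continuous (jx x).
  by apply: (h [set y : R | y < r / 2]); exact: open_lt.
exists V0; split => //.
  by rewrite /V0 /= mdistxx divr_gt0.
set V := _ `&` W.
have mV : measurable (V : set (borel DP)).
  apply: measurableI => //; apply: borel_open.
  rewrite (_ : _ `*` setT = fst @^-1` V0); first by move/continuousP: cfst; apply.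
  by apply/seteqP; split => p //= [].
have bpsi : bmeas (W : set (borel DP)) psi.
  split; first exact: within_cont_measurableR.
  by apply: within_cont_bounded cpsi; exact: compact_setX.
have mfW : (m W < +oo)%E by exact: (sub_finite mfin).
have mfV : (m V < +oo)%E by exact: (sub_finite mfin).
apply/eqP; rewrite eq_le measure_ge0 andbT -(@fineK _ (m V)) ?ge0_fin_numE// lee_fin.
rewrite -(@ler_pM2l _ (r / 2)) ?divr_gt0// mulr0 -int0 -Rintegral_cst//.
rewrite Rint_zext [leRHS]Rint_zext; apply: (le_Rint measurableT mfin).
- by apply: bmeas_zext => //; exact: bmeas_cst.
- exact: bmeas_zext.
move=> p _; have [Vp|Vp] := pselect (V p); last by rewrite zext_out//; apply: zext_ge0.
rewrite !zext_in//; last exact: Vp.2.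
have := Vp.1.1; rewrite /V0 /= => h.
by rewrite le_max; apply/orP; right; lra.
Qed.

(** [D] is a countable union of compact sets, each covered by finitely many of the
    neighbourhoods of [weak_limit_fst]. *)
Lemma weak_limit_carried : carried m ((~` range j) `*` (res @` E)).
Proof.
pose J n := jx @` L n.
have cJ n : compact (J n).
  by apply: continuous_compact; [exact: (continuous_subspaceW (@LD n) cjx)|exact: exh_cL].
have mJ n : measurable (fst @^-1` J n : set (borel DP)).
  rewrite -[X in measurable X]setTI; apply: (cont_measurable cfst) => //.
  by apply: borel_compact => //; exact: metric_hausdorff.
have rangeE : range j = \bigcup_n J n.
  apply/seteqP; split => [_ [s _ <-]|_ [n _ [x Lx <-]]].
    have [n Ln] := in_some_LL (set_valP s); exists n => //; exists (val s) => //.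
  by rewrite (jxE (LD Lx)); eexists.
have mM : measurable (snd @^-1` (res @` E) : set (borel DP)).
  rewrite -[X in measurable X]setTI; apply: (cont_measurable csnd) => //.
  rewrite minimal_imageE.
  exact: minimal_image_measurable.
have mR : measurable (fst @^-1` range j : set (borel DP)).
  by rewrite rangeE preimage_bigcup; exact: bigcupT_measurable.
have null2 (A C : set (borel DP)) : measurable A -> measurable C -> m A = 0%E -> m C = 0%E -> m (A `|` C) = 0%E.
  move=> mA mC A0 C0; apply/eqP; rewrite eq_le measure_ge0 andbT.
  have h : (m (A `|` C) <= m A + m C)%E by exact: measureU2.
  by apply: (le_trans h); rewrite A0 C0 adde0.
have J0 n : m (fst @^-1` J n) = 0%E.
  have HV z : exists V : set Dh, J n z -> [/\ open V, V z & m ((V `*` setT) `&` W) = 0%E].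
    have [[x Lx <-]|nz] := pselect (J n z); last by exists setT.
    by have [V hV] := weak_limit_fst (LD Lx); exists V.
  pose V z := projT1 (cid (HV z)).
  have VP z : J n z -> [/\ open (V z), V z z & m ((V z `*` setT) `&` W) = 0%E].
    exact: (projT2 (cid (HV z))).
  have [z Jz|s [sJ sV]] := @finite_subcover Dh (J n) V (cJ n); first by have [] := VP z Jz.
  have [N [mN N0 sN]] : exists N : set (borel DP), [/\ measurable N, m N = 0%E &
      forall p, W p -> (exists2 a, a \in s & V a p.1) -> N p].
    elim: s sJ {sV} => [_|a s IH sJ]; first by exists set0; split => // p _ [].
    have [|N [mN N0 sN]] := IH; first by move=> b bs; apply: sJ; rewrite inE bs orbT.
    have [oV Va V0] := VP a (sJ a (mem_head a s)).
    have mVa : measurable ((V a `*` setT) `&` W : set (borel DP)).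
      apply: measurableI => //; apply: borel_open.
      rewrite (_ : _ `*` setT = fst @^-1` V a); first by move/continuousP: cfst; apply.
      by apply/seteqP; split => p //= [].
    exists (N `|` ((V a `*` setT) `&` W)); split; first exact: measurableU.
      exact: null2.
    move=> p Wp [b]; rewrite inE => /orP[/eqP->|bs] Vp; first by right.
    by left; apply: sN => //; exists b.
  apply/eqP; rewrite eq_le measure_ge0 andbT -(null2 _ _ (measurableC mW) mN mWC N0).
  apply: le_measure; rewrite ?inE//; first by apply: measurableU => //; exact: measurableC.
  move=> p /= Jp; have [Wp|Wp] := pselect (W p); last by left.
  by right; apply: sN => //; exact: sV.
have M0 : m (~` (snd @^-1` (res @` E))) = 0%E.
  rewrite preimage_setC weak_limit_snd; last first.
    apply: measurableC; rewrite minimal_imageE.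
    exact: minimal_image_measurable.
  rewrite -sE -preimage_setC; congr (sig (~` _)).
  rewrite minimal_imageE.
  by rewrite -minimal_preimage.
have RE : (~` range j) `*` (res @` E) = ~` (fst @^-1` range j) `&` snd @^-1` (res @` E).
  by apply/seteqP; split => p [].
split; rewrite RE.
  by apply: measurableI => //; exact: measurableC.
rewrite setCI setCK; apply: null2 => //; first exact: measurableC.
rewrite rangeE preimage_bigcup; apply/eqP; rewrite eq_le measure_ge0 andbT.
have mU : measurable (\bigcup_n fst @^-1` J n : set (borel DP)) by exact: bigcupT_measurable.
apply: (le_trans (measure_sigma_subadditive m mJ mU (@subset_refl _ _))).
by rewrite eseries0// => i _ _; exact: J0.
Qed.
End weak_limit.
End compactification.
End exhaustion.

(** * The representation theorem *)

Theorem lemma4p10 (R : realType) (X : pmetricType R)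
    (Dom : set (set X))
    (w : set X -> X -> {measure set (borel X) -> \bar R})
    (D : set X) (x0 : X) (D_ : nat -> set X) (K : nat -> X -> X -> R)
    (Hframe : framework Dom w)
    (HD : domain D) (Hx0D : D x0)
    (HDom : forall n, Dom (D_ n))
    (Hreg : forall n, regular (D_ n) (w (D_ n)))
    (Hx0 : D_ 0%N x0)
    (Hnest : forall n, compactly_inside (D_ n) (D_ n.+1))
    (Hunion : D = \bigcup_n D_ n)
    (HK : forall n, relative_kernel (D_ n) (w (D_ n)) x0 (K n))
    (HKc : forall n, jointly_continuous (D_ n) (K n))
    (u : X -> R) (Hu : harmonic_on Dom w D u)
    (Hu0 : forall x, D x -> 0 < u x) :
  exists sigma : {finite_measure set (borel (fun_space D)) -> \bar R},
    [/\ represents Dom w x0 u sigma,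
        (forall tau : {finite_measure set (borel (fun_space D)) -> \bar R},
           represents Dom w x0 u tau ->
           forall A, measurable A -> tau A = sigma A),
        weakly_cvg_on (Pset Dom w x0 D_ K) (rho w x0 D_ K u)
          (pushforward sigma
             (restrict_LL D_ : borel (fun_space D) -> borel (prod_LL D_))) &
        forall (Dh : pmetricType R) (j : D -> Dh),
          compact [set: Dh] -> embedding j -> dense (range j) ->
          forall (phi : nat -> nat)
            (L : {finite_measure set (borel (Dh * prod_LL D_)%type) -> \bar R}),
            {homo phi : a b / (a < b)%N} ->
            L (~` ([set: Dh] `*` Pset Dom w x0 D_ K)) = 0%E ->
            weakly_cvg_on ([set: Dh] `*` Pset Dom w x0 D_ K)
              (fun k => Lambda w x0 D_ K j u (phi k)) L ->
            carried L ((~` range j) `*`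
              (restrict_LL D_ @` minimal_boundary Dom w D x0))].
Proof.
have [tau [taufin tauE utau]] := harmonic_mixture Hframe HDom Hreg Hx0 Hnest Hunion HK HKc Hu Hu0.
have finite (T : ptopologicalType) (m : {finite_measure set (borel T) -> \bar R}) : (m setT < +oo)%E.
  by rewrite ltey_eq fin_num_measure.
pose sigma : {finite_measure set (borel (fun_space D)) -> \bar R} := fin_of taufin.
have rep := representsP Hframe HDom Hreg Hx0 Hnest Hunion HK HKc u.
exists sigma; split.
- exact/rep.
- move=> m /rep[mE um] A mA.
  exact: (representing_unique Hframe HDom Hreg Hx0 Hnest Hunion HK HKc Hu.1
    (finite _ m) taufin mE tauE um utau mA).
- move=> f cf.
  rewrite (test_preimage Hframe HDom Hreg Hx0 Hnest Hunion HK HKc taufin tauE cf).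
  have [_ c] := test_cvg Hframe HDom Hreg Hx0 Hnest Hunion HK HKc cf taufin utau.
  have cu n : {within bnd D_ n, continuous u}.
    by apply: continuous_subspaceW Hu.1; exact: (exh_BD Hnest Hunion).
  have u0 n y : bnd D_ n y -> 0 <= u y.
    by move=> By; apply/ltW/Hu0; exact: (exh_BD Hnest Hunion By).
  apply/fine_cvgP; split.
    apply: nearW => n.
    by rewrite (rho_integral Hframe HDom Hreg Hx0 Hnest HK HKc cf (cu n) (u0 n)).
  rewrite (_ : fine \o _ = fun n => \int[w (D_ n) x0]_(y in bnd D_ n)
     (f (@Tmap R X D_ K n y) * u y)) //.
  apply/funext => n /=.
  by rewrite (rho_integral Hframe HDom Hreg Hx0 Hnest HK HKc cf (cu n) (u0 n)).
- move=> Dh j cDh ej _ phi m phi_mono mW lim.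
  exact: (weak_limit_carried Hframe HDom Hreg Hx0 Hnest Hunion HK HKc cDh ej Hu Hu0 taufin
    tauE utau phi_mono (finite _ m) mW lim).
Qed.
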